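(* Let $d\ge2$. For $n\in\mathbb{N}^*$, let $U_n=(u_1^n,u_2,\dots,u_d)$ be a sequence of vector fields in $C^2(\mathbb{R}^d)^d$ (only the first component depends on $n$) with $\nabla U_n\in C^1_\sharp(Y_d)^{d\times d}$, and let $a$ be a positive function in $C^1_\sharp(Y_d)$ such that $$\det(\nabla U_n)>0\ \text{ in }Y_d,$$ $$\rho_n:=\frac{1}{a\det(\nabla U_n)}\ \text{ converges uniformly in }Y_d\text{ to some }\rho\in C^1_\sharp(Y_d),$$ $$\rho\le\rho_n\ \text{ in }Y_d.$$ Then the sequence of vector fields $(b_n)$ defined by $b_n=\rho_n\,\Phi$, where $$\Phi:=\begin{cases}a\,R_\perp\nabla u_2&\text{if }d=2\\ a\,(\nabla u_2\times\cdots\times\nabla u_d)&\text{if }d>2,\end{cases}$$ converges uniformly in $Y_d$ to the vector field $b=\rho\,\Phi$. Moreover, let $X$ be the flow associated with $b$, let $\underline{a\rho}$ be the harmonic mean of $a\rho$, and set $$\zeta:=\begin{cases}\underline{a\rho}\displaystyle\int_{Y_2}R_\perp\nabla u_2(y)\,dy&\text{if }d=2\\ \underline{a\rho}\displaystyle\int_{Y_d}(\nabla u_2\times\cdots\times\nabla u_d)(y)\,dy&\text{if }d>2.\end{cases}$$ Then: - If $\rho$ is positive in $Y_d$, then $\displaystyle\lim_{t\to\infty}\frac{X(t,x)}{t}=\zeta$ for every $x\in Y_d$. - If $\rho$ vanishes in $Y_d$ (at some point) and $\underline{a\rho}=0$, then $\displaystyle\lim_{t\to\infty}\frac{X(t,x)}{t}=0_{\mathbb{R}^d}$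 for every $x\in Y_d$. - If $\rho$ vanishes in $Y_d$ (at some point) and $\underline{a\rho}>0$, then $\mathsf{C}_b=[0_{\mathbb{R}^d},\zeta]$ and $\zeta\neq0_{\mathbb{R}^d}$.
   Context: $Y_d=\mathbb{R}^d/\mathbb{Z}^d$ is the $d$-dimensional torus, identified with $[0,1)^d$. $C^k_\sharp(Y_d)$ is the space of real-valued $\mathbb{Z}^d$-periodic functions in $C^k(\mathbb{R}^d)$. The matrix $R_\perp=\begin{pmatrix}0&1\\-1&0\end{pmatrix}$ is the $-\pi/2$ rotation matrix. For $d>2$, the cross product $w_2\times\cdots\times w_d$ of $d-1$ vectors of $\mathbb{R}^d$ is the vector defined by $v\cdot(w_2\times\cdots\times w_d)=\det(v,w_2,\dots,w_d)$ for all $v\in\mathbb{R}^d$. For a non negative $f\in L^1_\sharp(Y_d)$ (periodic, integrable on $Y_d$), the harmonic mean is $\underline{f}:=\left(\int_{Y_d}\frac{dy}{f(y)}\right)^{-1}$, with value $0$ when the integral is $+\infty$. For $b\in C^1_\sharp(Y_d)^d$, the flow $X:\mathbb{R}\times\mathbb{R}^d\to\mathbb{R}^d$ associated with $b$ is the solution of $\partial_t X(t,x)=b(X(t,x))$, $t\in\mathbb{R}$, $X(0,x)=x$; it satisfies $X(t,x+\kappa)=X(t,x)+\kappa$ for $\kappa\in\mathbb{Z}^d$, so it induces a flow on $Y_d$. A probability measure $\mu$ on $Y_d$ is invariant for the flow $X$ if $\int_{Y_d}\psi(X(t,y))\,d\mu(y)=\int_{Y_d}\psi(y)\,d\mu(y)$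 for all $t\in\mathbb{R}$ and $\psi\in C^0_\sharp(Y_d)$; $\mathscr{I}_b$ denotes the set of these invariant probability measures. The (Herman) rotation set is $\mathsf{C}_b:=\left\{\int_{Y_d}b(y)\,d\mu(y):\mu\in\mathscr{I}_b\right\}\subset\mathbb{R}^d$. $[0_{\mathbb{R}^d},\zeta]$ is the closed line segment. *)

(* Defs.v *)
From HB Require Import structures.
From mathcomp Require Import all_boot all_order all_algebra.
From mathcomp Require Import all_classical all_reals all_analysis.
From mathcomp Require Import measurable_realfun.
Import Order.TTheory GRing.Theory Num.Theory.
Import numFieldNormedType.Exports.

Set Implicit Arguments.
Unset Strict Implicit.
Unset Printing Implicit Defensive.

Local Open Scope classical_set_scope.
Local Open Scope ring_scope.

Section defs.
Context {R : realType}.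

(* Functions on the torus R^n / Z^n are Z^n-periodic functions on R^n. *)
Definition periodic n (T : Type) (f : 'rV[R]_n -> T) : Prop :=
  forall (x : 'rV[R]_n) (k : 'rV[int]_n), f (x + map_mx intr k) = f x.

Definition Y n : set 'rV[R]_n := [set x | forall i, 0 <= x 0 i < 1].
Arguments Y : clear implicits.

Fixpoint Ck (k : nat) n (f : 'rV[R]_n -> R) : Prop :=
  if k is k'.+1 then
    (forall x, differentiable f x) /\
    (forall i : 'I_n, Ck k' (fun x => 'D_(delta_mx 0 i) f x))
  else continuous f.

Definition Ck_periodic (k : nat) n (f : 'rV[R]_n -> R) : Prop :=
  Ck k f /\ periodic f.

Definition grad n (f : 'rV[R]_n -> R) (x : 'rV[R]_n) : 'rV[R]_n :=
  \row_i 'D_(delta_mx 0 i) f x.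

Definition row_cons n (s : R) (v : 'I_n -> R) : 'rV[R]_n.+1 :=
  \row_i (if unlift ord0 i is Some k then v k else s).

Definition Rperp : 'M[R]_2 := block_mx 0 1 (-1) 0 : 'M[R]_(1 + 1).

(* det(v, w_0, ..., w_(n-1)), the arguments being the columns of the matrix *)
Definition det_cons n (v : 'rV[R]_n.+1) (w : 'I_n -> 'rV[R]_n.+1) : R :=
  \det (\matrix_(i, j) (if unlift ord0 j is Some k then w k 0 i else v 0 i)).

(* The cross product is the vector z such that v . z = det(v, w_0, ...) for all
   v, cf. crossP and cross_unique; its coordinates are obtained by taking for v
   the vectors of the canonical basis. *)
Definition cross n (w : 'I_n -> 'rV[R]_n.+1) : 'rV[R]_n.+1 :=
  \row_i det_cons (delta_mx 0 i) w.

Lemma crossP n (w : 'I_n -> 'rV[R]_n.+1) (v : 'rV[R]_n.+1) :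
  \sum_i v 0 i * cross w 0 i = det_cons v w.
Proof.
rewrite /det_cons (expand_det_col _ ord0); apply: eq_bigr => i _.
rewrite !mxE unlift_none; congr (_ * _).
rewrite /det_cons (expand_det_col _ ord0) (bigD1 i)//= big1 => [|k ki].
  rewrite addr0 !(unlift_none, mxE) !eqxx mul1r.
  rewrite /cofactor; congr (_ * \det _).
  by apply/matrixP => p q; rewrite !mxE liftK.
by rewrite !(unlift_none, mxE) (negPf ki) mul0r.
Qed.

Lemma cross_unique n (w : 'I_n -> 'rV[R]_n.+1) (z : 'rV[R]_n.+1) :
  (forall v : 'rV[R]_n.+1, \sum_i v 0 i * z 0 i = det_cons v w) -> z = cross w.
Proof.
move=> h; apply/rowP => i; rewrite mxE -h (bigD1 i)//= big1 => [|k ki].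
  by rewrite !mxE !eqxx mul1r addr0.
by rewrite !mxE (negPf ki) andbF mul0r.
Qed.

(* In dimension 2, the -pi/2 rotation of the only vector of the family w; in
   dimension > 2, the cross product of the family. *)
Definition perp m : ('I_m.+1 -> 'rV[R]_m.+2) -> 'rV[R]_m.+2 :=
  match m with
  | 0 => fun w => (Rperp *m (w ord0)^T)^T
  | m'.+1 => fun w => cross w
  end.

(* Borel sets of R^n; as Y n is a fundamental domain, the Borel subsets of Y n
   are the Borel sets of the torus. *)
Definition borel n := g_sigma_algebraType (@open 'rV[R]_n).

Definition consv n (p : measurableTypeR R * borel n) : borel n.+1 :=
  \row_i (if unlift ord0 i is Some j then (p.2 : 'rV[R]_n) 0 j else p.1).

Lemma ball_rV n (x y : 'rV[R]_n) e :
  ball x e y <-> 0 < e /\ forall j, `|x 0 j - y 0 j| < e.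
Proof.
split=> [[e0 h]|[e0 h]]; split => //; first by move=> j; exact: h.
by move=> i j; rewrite ord1; exact: h.
Qed.

Lemma open_rV_bigcup n (U : set 'rV[R]_n) : open U ->
  U = \bigcup_(q in [set q : 'rV[rat]_n * nat |
        ball (map_mx ratr q.1 : 'rV[R]_n) (q.2.+1%:R^-1) `<=` U])
      ball (map_mx ratr q.1 : 'rV[R]_n) (q.2.+1%:R^-1).
Proof.
move=> oU; apply/seteqP; split => [x Ux|x [q /= qU /qU]//].
have /nbhs_ballP[e /= e0 eU] := open_nbhs_nbhs (conj oU Ux).
have [N _ /(_ N (leqnn N)) Ne] :=
  near_infty_natSinv_lt (PosNum (divr_gt0 e0 (ltr0n _ 2))).
have N0 : 0 < N.+1%:R^-1 :> R by rewrite invr_gt0 ltr0n.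
have hq j : {q : rat | `|ratr q - x 0 j| < N.+1%:R^-1}.
  have h : x 0 j - N.+1%:R^-1 < x 0 j + N.+1%:R^-1.
    by rewrite ltrBlDr -addrA ltrDl addr_gt0.
  apply: cid; have [q] := rat_in_itvoo h.
  rewrite in_itv/= => /andP[q1 q2]; exists q.
  by rewrite ltr_norml ltrBlDl q2 andbT ltrBrDl.
pose q := \row_j sval (hq j).
have hqx : ball (map_mx ratr q : 'rV[R]_n) N.+1%:R^-1 x.
  by apply/ball_rV; split => // j; rewrite !mxE; exact: svalP (hq j).
exists (q, N) => //= z hz; apply: eU.
apply: (ball_split (z := map_mx ratr q : 'rV[R]_n)).
- by apply: ball_sym; apply: le_ball hqx; exact: ltW.
- by apply: le_ball hz; exact: ltW.
Qed.

Lemma measurable_consv n :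
  measurable_fun [set: measurableTypeR R * borel n] (@consv n).
Proof.
have := @measurability _ _ _ _ [set: measurableTypeR R * borel n] (@consv n)
  (@open 'rV[R]_n.+1) erefl.
apply => _ [U oU <-].
rewrite setTI (open_rV_bigcup oU) bigcup_mkcond preimage_bigcup.
apply: countable_bigcupT_measurable => // q; case: ifPn => _; last first.
  by rewrite preimage_set0.
rewrite (_ : _ @^-1` _ = ball (ratr (q.1 0 0) : R) q.2.+1%:R^-1 `*`
   ball (\row_j ratr (q.1 0 (lift ord0 j)) : 'rV[R]_n) q.2.+1%:R^-1).
  apply: measurableX; first exact: measurable_ball.
  by apply: sub_sigma_algebra; exact: ball_open.
apply/seteqP; split => [p /ball_rV[e0 h]|p [/= h0 /ball_rV[e0 h]]].
  split => /=.
    by have := h 0; rewrite !mxE unlift_none.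
  apply/ball_rV; split => // j.
  by have := h (lift ord0 j); rewrite !mxE liftK.
apply/ball_rV; split => // i; rewrite !mxE.
by case: unliftP => [j ->|->]; [have := h j; rewrite !mxE|exact: h0].
Qed.

HB.instance Definition _ n :=
  isMeasurableFun.Build _ _ _ _ (@consv n) (@measurable_consv n).

Definition lebesgue01 :=
  @mrestr _ (measurableTypeR R) R _ (@lebesgue_measure R)
    (measurable_itv `[0 : R, 1[).

HB.instance Definition _ := Measure.on lebesgue01.

Let lebesgue01_setT : lebesgue01 setT = 1%E.
Proof.
rewrite /lebesgue01/= /mrestr setTI lebesgue_measure_itv/= lte01.
by rewrite oppr0 addr0.
Qed.

HB.instance Definition _ :=
  Measure_isProbability.Build _ _ _ lebesgue01 lebesgue01_setT.

(* Lebesgue measure on the unit cube Y n, as an n-fold product of the Lebesgue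
   measure on [0, 1[, carried over to row vectors; cf. lebesgueY_prod. *)
Fixpoint lebesgueY n : probability (borel n) R :=
  match n with
  | 0 => dirac ((0 : 'rV[R]_0) : borel 0)
  | n'.+1 => distribution (lebesgue01 \x lebesgueY n')%E (@consv n')
  end.

Lemma measurable_coord n (i : 'I_n) :
  measurable_fun [set: borel n]
    (fun x : borel n => (x : 'rV[R]_n) 0 i : measurableTypeR R).
Proof.
apply: (measurability _ (RGenOpens.measurableE R)) => _ [_ [a [b ->] <-]].
rewrite setTI; apply: sub_sigma_algebra.
by apply: open_comp (@interval_open _ _ _ _ _) => // x _;
  exact: coord_continuous.
Qed.

Lemma lebesgueY_prod n (A : 'I_n -> set (measurableTypeR R)) :
  (forall i, measurable (A i)) ->
  lebesgueY n [set x : 'rV[R]_n | forall i, A i (x 0 i)] =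
  (\prod_i lebesgue01 (A i))%E.
Proof.
elim: n A => [|n IH] A mA.
  rewrite big_ord0 /= /dirac indicE mem_set //= => -[]//.
rewrite big_ord_recl -IH//=.
rewrite /distribution/= /pushforward/=.
rewrite -product_measure1E//.
  congr (_ _); apply/seteqP; split => [p h|p [/= h0 h] i].
    split => [|i] /=.
      by have := h 0; rewrite !mxE unlift_none.
    by have := h (lift ord0 i); rewrite !mxE liftK.
  by rewrite !mxE; case: unliftP => [j ->|->]; [exact: h|exact: h0].
rewrite (_ : mkset _ = \bigcap_(i in [set: 'I_n])
    ((fun x : borel n => (x : 'rV[R]_n) 0 i) @^-1` A (lift ord0 i))).
  apply: fin_bigcap_measurable => // i _.
  by rewrite -[X in measurable X]setTI; exact: measurable_coord.
by apply/seteqP; split => [x h i _|x h i]; exact: h.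
Qed.

(* On extended reals, 0^-1 = +oo and +oo^-1 = 0. *)
Definition hmean n (f : 'rV[R]_n -> R) : R :=
  fine ((\int[lebesgueY n]_(y in Y n) ((f y)%:E)^-1)^-1)%E.

Definition integralv n (mu : probability (borel n) R)
    (f : 'rV[R]_n -> 'rV[R]_n) : 'rV[R]_n :=
  \row_i \int[mu]_(y in Y n) (f y 0 i).

Definition is_flow n (b : 'rV[R]_n -> 'rV[R]_n)
    (X : R -> 'rV[R]_n -> 'rV[R]_n) : Prop :=
  forall x, X 0 x = x /\
    forall t, is_derive (t : R) (1 : R) (fun s : R => X s x) (b (X t x)).

(* A probability measure on the torus is one on R^n that is carried by Y n. *)
Definition invariant_measures n (X : R -> 'rV[R]_n -> 'rV[R]_n) :
    set (probability (borel n) R) :=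
  [set mu : probability (borel n) R | mu (Y n) = 1%E /\
    forall (t : R) (psi : 'rV[R]_n -> R), Ck_periodic 0 psi ->
      \int[mu]_(y in Y n) psi (X t y) = \int[mu]_(y in Y n) psi y].

(* b is meant to be the vector field of which X is the flow. *)
Definition rotation_set n (b : 'rV[R]_n -> 'rV[R]_n)
    (X : R -> 'rV[R]_n -> 'rV[R]_n) : set 'rV[R]_n :=
  [set integralv mu b | mu in invariant_measures X].

Definition segment0 n (z : 'rV[R]_n) : set 'rV[R]_n :=
  [set s *: z | s in `[0 : R, 1]].

End defs.

Arguments Y {R} n _.

(* Main.v *)
Require Import Defs.
From HB Require Import structures.
From mathcomp Require Import all_boot all_order all_algebra.
From mathcomp Require Import perm fingroup.
From mathcomp Require Import all_classical all_reals all_analysis.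
From mathcomp Require Import measurable_realfun.
From mathcomp Require Import ring lra.
Import Order.TTheory GRing.Theory Num.Theory.
Import numFieldNormedType.Exports.
Import Defs.
Set Implicit Arguments.
Unset Strict Implicit.
Unset Printing Implicit Defensive.
Local Open Scope classical_set_scope.
Local Open Scope ring_scope.

(** Let g be the cross product of grad u_2, ..., grad u_d, which in dimension 2
    is the rotated gradient (perpE); thus b = a rho g. The field g is orthogonal
    to the gradients of u_2, ..., u_d, its scalar product with the gradient of
    the first component u_1^n is det J U_n, and it is solenoidal by the Piola
    identity (cross_grad_divergence_free).

    Along a trajectory of b the functions u_2, ..., u_d are therefore constant,
    and u_1^n grows at the rate a rho det J U_n = rho / rho_n, which lies in
    [0, 1]. Since J U_n is periodic, U_n is the sum of a linear map x M_n and of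
    a periodic function; M_n is invertible, for otherwise some nonzero
    combination of the coordinates of U_n would be periodic and have a critical
    point, at which det J U_n vanishes (linear_part_unit). So X(t, x) - x stays
    at bounded distance from theta t z_n, where z_n is the row that M_n sends to
    the first basis vector and theta is a value of rho / rho_n
    (trajectory_drift, flow_drift). Gradients of periodic functions being
    orthogonal to g in L^2, z_n is the mean of g divided by the mean of
    det J U_n = 1 / (a rho_n) (mean_cross_linear_part). The latter mean tends to
    the integral of 1 / (a rho), finite or not: it is not larger because
    rho <= rho_n, and the lower bound is Fatou's lemma (hmean_cvg). Hence z_n
    tends to zeta. When rho > 0, theta tends to 1 uniformly, and when the
    harmonic mean is 0, so is the limit of z_n: these are the first two cases
    (flow_velocity).

    In the third case, the mean against an invariant measure mu of the
    derivative along b of a periodic function is 0 (invariant_flux). Applied to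
    the periodic part of U_n this gives that the mean of b is z_n times the mean
    of rho / rho_n, for every n (rotation_vector), so it lies on the segment.
    Conversely the origin is the mean of b for the Dirac mass at a zero of rho,
    zeta is the mean of b for the probability with density proportional to
    1 / (a rho), and convex combinations reach the points between
    (rotation_set_segment).

    The invariance of that density (invariant_density) is the delicate point,
    for 1 / (a rho) is unbounded. The time derivative of the integral of
    psi(X(t, x)) / (a rho) is the integral of the derivative along g of
    v = psi o X(t, .), a function that is only Lipschitz. That this integral is
    0 is proved by averaging the difference quotients of v against a kernel of
    small width (divergence_free_flux). *)

(** * Periodic functions *)

Lemma continuous_compose (T U V : topologicalType) (f : T -> U) (g : U -> V) :
  continuous f -> continuous g -> continuous (fun x => g (f x)).
Proof. by move=> cf cg x; exact: (continuous_comp (cf x) (cg (f x))). Qed.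

Lemma continuous_translate (K : numFieldType) (V : normedModType K)
    (U : topologicalType) (f : V -> U) (z : V) :
  continuous f -> continuous (fun x => f (x + z)).
Proof.
move=> cf; apply: (@continuous_compose _ _ _ (fun x => x + z) f) => // x.
by apply: continuousD; [exact: cvg_id|exact: cst_continuous].
Qed.

Section torus.
Context {R : realType}.
Implicit Types (n : nat).

Lemma normr_sum_le n (f : 'I_n -> R) (M : R) :
  (forall i, `|f i| <= M) -> `|\sum_i f i| <= n%:R * M.
Proof.
move=> fM; apply: le_trans (ler_norm_sum _ _ _) _.
by rewrite mulr_natl -[X in _ *+ X]card_ord -sumr_const ler_sum.
Qed.

Lemma normr_coord_le n (x : 'rV[R]_n) i : `|x 0 i| <= `|x|.
Proof.
rewrite /Num.norm/= mx_normrE.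
exact: (le_bigmax _ (fun ij : 'I_1 * 'I_n => `|x ij.1 ij.2|) (0, i)).
Qed.

Lemma normr_row_le n (x : 'rV[R]_n) (e : R) :
  0 <= e -> (forall i, `|x 0 i| <= e) -> `|x| <= e.
Proof.
move=> e0 h; rewrite /Num.norm/= mx_normrE; apply/bigmax_leP; split => // -[i j] _.
by rewrite /= ord1.
Qed.

Lemma normr_delta_mx_le n (i : 'I_n) : `|delta_mx 0 i : 'rV[R]_n| <= 1.
Proof.
apply: normr_row_le => // j; rewrite mxE eqxx/=.
by case: (j == i); rewrite ?normr0 ?normr1.
Qed.

Lemma decomp_Y n (x : 'rV[R]_n) :
  exists y k, Y n y /\ x = y + map_mx intr k.
Proof.
exists (\row_i (x 0 i - (Num.floor (x 0 i))%:~R)), (\row_i Num.floor (x 0 i)).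
split=> [i|]; last by apply/rowP => i; rewrite !mxE subrK.
rewrite mxE; have /andP[h1 h2] := floor_itv (x 0 i).
by rewrite subr_ge0 h1 ltrBlDl -intrD1 h2.
Qed.

Lemma periodic_forall n T (f : 'rV[R]_n -> T) (P : T -> Prop) :
  Defs.periodic f -> (forall y, Y n y -> P (f y)) -> forall x, P (f x).
Proof.
by move=> pf h x; have [y [k [Yy ->]]] := decomp_Y x; rewrite pf; exact: h.
Qed.

Lemma periodic_max n (f : 'rV[R]_n -> R) :
  continuous f -> Defs.periodic f -> exists c, forall x, f x <= f c.
Proof.
move=> cf pf.
pose A := [set v : 'rV[R]_n | forall i, `[0, 1]%classic (v ord0 i)].
have [|||c _ hc] := @EVT_max_rV R n f A.
- by exists 0 => i /=; rewrite mxE in_itv/= lexx ler01.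
- apply: (@rV_compact R n (fun=> `[0, 1]%classic)) => i.
  exact: segment_compact.
- exact: continuous_subspaceT.
exists c; apply: (@periodic_forall _ _ _ (fun r => r <= f c)) => // y Yy.
apply: hc; rewrite inE => i /=; rewrite in_itv/=.
by have /andP[-> /ltW ->] := Yy i.
Qed.

Lemma periodic_min n (f : 'rV[R]_n -> R) :
  continuous f -> Defs.periodic f -> exists c, forall x, f c <= f x.
Proof.
move=> cf pf; have [|x k|c hc] := @periodic_max n (fun x => - f x).
- by move=> x; apply: continuousN; exact: cf.
- by rewrite pf.
by exists c => x; rewrite -lerN2.
Qed.

Lemma periodic_bounded n (f : 'rV[R]_n -> R) :
  continuous f -> Defs.periodic f ->
  exists2 M, 0 <= M & forall x, `|f x| <= M.
Proof.
move=> cf pf; have [|x k|c hc] := @periodic_max n (fun x => `|f x|).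
- by move=> x; exact: (continuous_comp (cf x) (@norm_continuous _ R^o _)).
- by rewrite pf.
by exists `|f c|.
Qed.

Lemma periodic_delta n T (f : 'rV[R]_n -> T) :
  (forall i x, f (x + delta_mx 0 i) = f x) -> Defs.periodic f.
Proof.
move=> h x k.
have hn i m y : f (y + delta_mx 0 i *+ m) = f y.
  by elim: m y => [|m IH] y; rewrite ?mulr0n ?addr0// mulrSr addrA h.
have hz i (m : int) y : f (y + delta_mx 0 i *~ m) = f y.
  case: m => m; first exact: hn.
  by rewrite NegzE mulrNz -[in RHS](subrK (delta_mx 0 i *+ m.+1) y) hn.
have -> : map_mx intr k = \sum_i delta_mx 0 i *~ k 0 i :> 'rV[R]_n.
  rewrite [LHS]row_sum_delta; apply: eq_bigr => i _.
  by rewrite mxE scaler_int.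
elim/big_ind: (\sum_i _) x => [x|a b ha hb x|i _ x]; first by rewrite addr0.
  by rewrite addrA hb ha.
exact: hz.
Qed.

Lemma periodic_shift n (k : 'rV[int]_n) T (f : 'rV[R]_n -> T) :
  Defs.periodic f -> forall x, f (x - map_mx intr k) = f x.
Proof. by move=> pf x; rewrite -[in RHS](subrK (map_mx intr k) x) pf. Qed.

End torus.

(** * Integration against a probability on the unit cube *)

Section borel.
Context {R : realType}.
Implicit Types (n : nat).

Lemma measurable_rV n d (T : measurableType d) (h : T -> borel (R:=R) n) :
  (forall i, measurable_fun [set: T]
     (fun t => (h t : 'rV[R]_n) 0 i : measurableTypeR R)) ->
  measurable_fun [set: T] h.
Proof.
move=> mh; apply: (@measurability _ _ _ _ [set: T] h (@open 'rV[R]_n) erefl).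
move=> _ [U oU <-].
rewrite setTI (open_rV_bigcup oU) bigcup_mkcond preimage_bigcup.
apply: countable_bigcupT_measurable => // q; case: ifPn => _; last first.
  by rewrite preimage_set0.
rewrite (_ : _ @^-1` _ = \bigcap_(j in [set: 'I_n])
    ((fun t => (h t : 'rV[R]_n) 0 j) @^-1`
      ball (ratr (q.1 0 j) : R) q.2.+1%:R^-1)).
  apply: fin_bigcap_measurable => // j _.
  rewrite -[X in measurable X]setTI; apply: mh => //.
  exact: measurable_ball.
apply/seteqP; split => [t /ball_rV[e0 H] j _|t H].
  by have := H j; rewrite mxE.
apply/ball_rV; split; first by rewrite invr_gt0.
by move=> j; have := H j I; rewrite mxE.
Qed.

Lemma measurable_cont n (f : 'rV[R]_n -> R) : continuous f ->
  measurable_fun [set: borel n] (f : borel n -> measurableTypeR R).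
Proof.
move=> cf.
apply: (measurability _ (RGenOpens.measurableE R)) => _ [_ [a [b ->] <-]].
rewrite setTI; apply: sub_sigma_algebra.
by apply: open_comp (@interval_open _ _ _ _ _) => // x _; exact: cf.
Qed.

Lemma measurable_box n (r : R) :
  measurable ([set x : 'rV[R]_n | forall i, 0 <= x 0 i < r] : set (borel n)).
Proof.
rewrite (_ : mkset _ = \bigcap_(i in [set: 'I_n])
   ((fun x : borel (R:=R) n => (x : 'rV[R]_n) 0 i) @^-1` `[0, r[%classic)).
  apply: fin_bigcap_measurable => // i _.
  rewrite -[X in measurable X]setTI.
  by apply: (measurable_coord i) => //; exact: measurable_itv.
apply/seteqP; split => [x h i _ /=|x h i]; first by rewrite in_itv/=; exact: h.
by have := h i I; rewrite /= in_itv.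
Qed.

Lemma measurable_Y n : measurable (Y n : set (borel (R:=R) n)).
Proof. exact: measurable_box. Qed.

Lemma lebesgueY_box n (r : R) : 0 <= r <= 1 ->
  lebesgueY n [set x : 'rV[R]_n | forall i, 0 <= x 0 i < r] = (r ^+ n)%:E.
Proof.
move=> /andP[r0 r1].
have -> : [set x : 'rV[R]_n | forall i, 0 <= x 0 i < r] =
    [set x : 'rV[R]_n | forall i, `[0, r[%classic (x 0 i)].
  by apply/seteqP; split => x /= h i; have := h i; rewrite /= in_itv.
rewrite (@lebesgueY_prod _ n (fun=> `[0, r[%classic)); last first.
  by move=> i; exact: measurable_itv.
rewrite (eq_bigr (fun=> r%:E)) => [|i _].
  elim: n => [|n IH]; first by rewrite big_ord0.
  by rewrite big_ord_recl IH exprS EFinM.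
rewrite /lebesgue01/= /mrestr.
rewrite (_ : `[0, r[ `&` `[0, 1[ = `[0, r[)%classic; last first.
  apply: setIidl => x /=; rewrite !in_itv/= => /andP[-> /lt_le_trans -> //].
rewrite lebesgue_measure_itv/= lte_fin.
by case: ltP => [_|]; rewrite ?sube0// => r0'; rewrite (le_anti (_ : r <= 0 <= r))// r0 r0'.
Qed.

Lemma lebesgueY_Y n : lebesgueY n (Y n : set 'rV[R]_n) = 1%E.
Proof. by rewrite (@lebesgueY_box n 1) ?expr1n// ler01 lexx. Qed.

End borel.

Section bounded_integration.
Context {R : realType} d (T : measurableType d).
Implicit Types (mu : probability T R) (f : T -> R) (D : set T).

Lemma bounded_integrable mu D f (M : R) : measurable D ->
  measurable_fun [set: T] f -> (forall x, `|f x| <= M) ->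
  mu.-integrable D (EFin \o f).
Proof.
move=> mD mf fM; apply: measurable_bounded_integrable => //.
- by rewrite (le_lt_trans (probability_le1 mu mD))// ltry.
- exact: measurable_funS mf.
- by exists M; split; [exact: num_real|move=> N MN x _ /=; exact: le_trans (ltW MN)].
Qed.

Lemma integrableB_fun (mu : {measure set T -> \bar R}) D (f g : T -> R) :
  measurable D -> mu.-integrable D (EFin \o f) ->
  mu.-integrable D (EFin \o g) ->
  mu.-integrable D (EFin \o (fun x => f x - g x)).
Proof.
move=> mD fi gi; rewrite /comp; under eq_fun do rewrite EFinB.
exact: integrableB.
Qed.

Lemma Rintegral_prob_cst mu (r : R) : \int[mu]_x r = r.
Proof.
rewrite Rintegral_cst//.
by rewrite [X in fine X](_ : _ = 1%E) ?mulr1//; exact: probability_setT.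
Qed.

(** Integrals over the unit cube become integrals over the whole space, which
    spares carrying the domain through the computations. *)
Lemma Rintegral_full mu D f : measurable D -> mu D = 1%E ->
  measurable_fun [set: T] f ->
  mu.-integrable [set: T] (EFin \o f) ->
  \int[mu]_(x in D) f x = \int[mu]_x f x.
Proof.
move=> mD muD mf intf; rewrite /Rintegral; congr fine.
have muDC : mu (~` D) = 0 by rewrite probability_setC// muD subee.
rewrite [RHS](negligible_integral (measurableC mD) measurableT intf muDC).
by rewrite setTD setCK.
Qed.

Lemma normr_Rintegral_le mu f (M : R) : measurable_fun [set: T] f ->
  (forall x, `|f x| <= M) -> `|\int[mu]_x f x| <= M.
Proof.
move=> mf fM; have intf := bounded_integrable mu measurableT mf fM.
apply: le_trans (le_normr_Rintegral _ intf) _ => //.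
rewrite -[leRHS](Rintegral_prob_cst mu); apply: le_Rintegral => //.
  apply: (@bounded_integrable _ _ _ M) => //; first exact: measurableT_comp.
  by move=> x; rewrite normr_id.
exact: (@bounded_integrable _ _ _ `|M|).
Qed.

Lemma Rintegral_cvg mu (f_ : nat -> T -> R) f (g : T -> R) :
  (forall k, measurable_fun [set: T] (f_ k)) ->
  measurable_fun [set: T] f ->
  mu.-integrable [set: T] (EFin \o g) ->
  {ae mu, forall x, f_ k x @[k --> \oo] --> f x} ->
  {ae mu, forall x, forall k, `|f_ k x| <= g x} ->
  \int[mu]_x f_ k x @[k --> \oo] --> \int[mu]_x f x.
Proof.
move=> mf_ mf ig ff fg.
have [||||intf _ h] := @dominated_convergence _ _ _ mu _ measurableT
  (fun k x => (f_ k x)%:E) (EFin \o f) (EFin \o g) _ _ _ ig _.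
- by move=> k; exact/measurable_EFinP.
- exact/measurable_EFinP.
- apply: filterS ff => x h _; apply: cvg_EFin h; exact: nearW.
- by apply: filterS fg => x h k _; rewrite lee_fin.
apply: fine_cvg; rewrite fineK//.
exact: integrable_fin_num.
Qed.

End bounded_integration.

(** * Translation invariance of the Lebesgue measure of the torus *)

Section lebesgue01.
Context {R : realType}.
Notation mu := (@lebesgue_measure R).

Lemma Rintegral_lebesgue01 (f : R -> R) (M : R) :
  continuous f -> (forall x, `|f x| <= M) ->
  \int[lebesgue01]_x f x = \int[mu]_(x in `[0, 1]) f x.
Proof.
move=> cf fM.
have mf : measurable_fun [set: measurableTypeR R] (f : _ -> measurableTypeR R).
  exact: continuous_measurable_fun.
pose I01 : set (measurableTypeR R) := `[0, 1[%classic.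
have mI : measurable I01 by exact: measurable_itv.
rewrite -(@Rintegral_full _ _ _ lebesgue01 I01)//; last 2 first.
- transitivity (mu `[0, 1[%classic).
    by rewrite /lebesgue01/= /mrestr; congr (lebesgue_measure _); exact: setIid.
  by rewrite lebesgue_measure_itv/= lte01 oppr0 addr0.
- exact: (@bounded_integrable _ _ _ _ _ _ M).
rewrite /Rintegral; congr fine.
rewrite -(@integral_itv_bndo_bndc _ (BLeft 0) 1 (EFin \o f)); last first.
  exact/measurable_EFinP/measurable_funTS.
apply: (@eq_measure_integral _ _ _ I01 mu lebesgue01) => E mE EI.
by rewrite /lebesgue01/= /mrestr; congr (mu _); exact: setIidl.
Qed.

(** Differentiating in z, the integral over [z, z + 1] of a 1-periodic
    function has derivative f (z + 1) - f z = 0. *)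
Lemma translation_lebesgue01 (f : R -> R) (z : R) :
  continuous f -> (forall x, f (x + 1) = f x) ->
  \int[mu]_(x in `[0, 1]) f (x + z) = \int[mu]_(x in `[0, 1]) f x.
Proof.
move=> cf f1.
pose a : R := - `|z| - 1; pose u : R := `|z| + 2.
have fi : mu.-integrable `[a, u] (EFin \o f).
  apply: continuous_compact_integrable; first exact: segment_compact.
  exact: continuous_subspaceT.
pose P (x : R) := \int[mu]_(t in `[a, x]) f t.
have dP (x : R) : a < x < u -> is_derive x 1 P (f x).
  move=> /andP[ax xu]; have [dP P'] := continuous_FTC1_closed xu fi ax (cf x).
  by apply: DeriveDef; [exact: dP|rewrite -[LHS]derive1E; exact: P'].
have intP (y : R) : - `|z| <= y <= `|z| ->
    \int[mu]_(x in `[0, 1]) f (x + y) = P (1 + y) - P y.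
  move=> /andP[zy yz].
  have dPy (x : R) : 0 <= x <= 1 -> is_derive x 1 (P \o shift y) (f (x + y)).
    move=> /andP[x0 x1]; rewrite -[f _]mulr1; apply: is_derive1_comp.
      by apply: dP; apply/andP; split; rewrite /a /u /=; lra.
    exact: is_derive_shift.
  rewrite /Rintegral (@continuous_FTC2 _ (fun x => f (x + y)) (P \o shift y) 0 1)//.
  - by rewrite /= add0r.
  - apply: continuous_subspaceT => x.
    apply: (@continuous_comp _ _ _ (shift y) f) => //.
      by apply: continuousD; [exact: cvg_id|exact: cvg_cst].
    exact: cf.
  - split.
    + move=> x; rewrite in_itv/= => /andP[/ltW x0 /ltW x1].
      by have [] := dPy x; rewrite ?x0.
    + apply: cvg_at_right_filter; apply: differentiable_continuous.
      by apply/derivable1_diffP; have [] := dPy 0; rewrite ?lexx ?ler01.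
    + apply: cvg_at_left_filter; apply: differentiable_continuous.
      by apply/derivable1_diffP; have [] := dPy 1; rewrite ?lexx ?ler01.
  - move=> x; rewrite in_itv/= => /andP[/ltW x0 /ltW x1].
    by rewrite derive1E; have [] := dPy x; rewrite ?x0.
have z0 := normr_ge0 z.
transitivity (\int[mu]_(x in `[0, 1]) f (x + 0)); last first.
  by apply: eq_Rintegral => x _; rewrite addr0.
rewrite !intP; [|by rewrite oppr_le0 z0|by rewrite -ler_norml].
pose H (y : R) := P (1 + y) - P y.
have dH (y : R) : - `|z| <= y <= `|z| -> is_derive y 1 H 0.
  move=> /andP[zy yz].
  have dPy : is_derive y 1 (P \o shift 1) (f (y + 1)).
    rewrite -[f _]mulr1; apply: is_derive1_comp.
      by apply: dP; apply/andP; split; rewrite /a /u /=; lra.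
    exact: is_derive_shift.
  have dPy' : is_derive y 1 P (f y).
    by apply: dP; apply/andP; split; rewrite /a /u; lra.
  rewrite (_ : H = (P \o shift 1) - P); last first.
    by apply/funext => s; rewrite /H [1 + s]addrC.
  rewrite (_ : 0 = f (y + 1) - f y); last by rewrite f1 subrr.
  exact: is_deriveB.
have cH : {within `[- `|z|, `|z|], continuous H}.
  apply: derivable_within_continuous => y; rewrite in_itv/= => yz.
  by have [] := dH y yz.
rewrite -/(H z) -/(H 0); have [zge0|/ltW zle0] := leP 0 z.
  have [|||c _ /eqP] := @MVT_segment R H (cst 0) 0 z; rewrite ?zge0//.
  - move=> x; rewrite in_itv/= => /andP[/ltW x0 /ltW x1]; apply: dH.
    by rewrite (ger0_norm zge0); apply/andP; split; lra.
  - apply: continuous_subspaceW cH; apply: subset_itvScc;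
      rewrite bnd_simp (ger0_norm zge0); lra.
  by rewrite mul0r subr_eq0 => /eqP.
have [|||c _ /eqP] := @MVT_segment R H (cst 0) z 0; rewrite ?zle0//.
- move=> x; rewrite in_itv/= => /andP[/ltW x0 /ltW x1]; apply: dH.
  by rewrite (ler0_norm zle0); apply/andP; split; lra.
- apply: continuous_subspaceW cH; apply: subset_itvScc;
    rewrite bnd_simp (ler0_norm zle0); lra.
by rewrite mul0r subr_eq0 => /eqP.
Qed.

End lebesgue01.

Section fubini.
Context {R : realType} d1 d2 (T1 : measurableType d1) (T2 : measurableType d2).
Variables (m1 : probability T1 R) (m2 : probability T2 R).
Variables (f : T1 * T2 -> R) (M : R).
Hypothesis mf : measurable_fun [set: T1 * T2] f.
Hypothesis fM : forall p, `|f p| <= M.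

Lemma bounded_integrable_prod :
  (m1 \x m2)%E.-integrable [set: T1 * T2] (EFin \o f).
Proof. exact: (@bounded_integrable _ _ _ (m1 \x m2)%E _ _ M). Qed.

Lemma Rintegral_prod1 :
  fine (\int[(m1 \x m2)%E]_p (f p)%:E)%E = \int[m1]_x \int[m2]_y f (x, y).
Proof.
rewrite /Rintegral -(integral12_prod_meas1 bounded_integrable_prod).
congr fine; apply: eq_integral => x _; rewrite /fubini_F/= fineK//.
apply: (integrable_fin_num _ (bounded_integrable m2 measurableT _ (M := M) _)) => //.
by apply: measurableT_comp => //; exact: pair1_measurable.
Qed.

Lemma Rintegral_prod2 :
  fine (\int[(m1 \x m2)%E]_p (f p)%:E)%E = \int[m2]_y \int[m1]_x f (x, y).
Proof.
rewrite /Rintegral -(integral21_prod_meas1 bounded_integrable_prod).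
congr fine; apply: eq_integral => x _; rewrite /fubini_G/= fineK//.
apply: (integrable_fin_num _ (bounded_integrable m1 measurableT _ (M := M) _)) => //.
by apply: measurableT_comp => //; exact: pair2_measurable.
Qed.

Lemma Rintegral_fubini :
  \int[m1]_x \int[m2]_y f (x, y) = \int[m2]_y \int[m1]_x f (x, y).
Proof. by rewrite -Rintegral_prod1 Rintegral_prod2. Qed.

End fubini.

Section translation.
Context {R : realType}.
Implicit Types (n : nat).

Definition consr n (s : R) (y : 'rV[R]_n) : 'rV[R]_n.+1 := consv (s, y).

Lemma consrD n s t (y z : 'rV[R]_n) :
  consr s y + consr t z = consr (s + t) (y + z).
Proof. by apply/rowP => i; rewrite !mxE/=; case: unlift => [j|]//; rewrite mxE. Qed.

Lemma consr_ex n (x : 'rV[R]_n.+1) : exists s y, x = consr s y.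
Proof.
exists (x 0 0), (\row_j x 0 (lift 0 j)); apply/rowP => i; rewrite mxE.
by case: unliftP => [j ->|->]; rewrite ?mxE.
Qed.

Lemma continuous_consr n (T : topologicalType) (f : T -> R)
    (g : T -> 'rV[R]_n) :
  continuous f -> continuous g -> continuous (fun t => consr (f t) (g t)).
Proof.
move=> cf cg x; apply/cvgrPdist_lt => e e0.
have /cvgrPdist_lt/(_ _ e0) ss := cf x.
have /cvgrPdist_lt/(_ _ e0) yy := cg x.
near=> t; have hs : `|f x - f t| < e by near: t.
have hy : `|g x - g t| < e by near: t.
apply: (@le_lt_trans _ _ (Num.max `|f x - f t| `|g x - g t|)); last first.
  by rewrite gt_max hs.
apply: normr_row_le => [|i]; first by rewrite le_max normr_ge0.
rewrite !mxE le_max; case: unliftP => [j _|_] /=; last by rewrite lexx.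
apply/orP; right; apply: le_trans (normr_coord_le _ j).
by rewrite !mxE.
Unshelve. all: by end_near. Qed.

Lemma Rintegral_lebesgueYS n (f : 'rV[R]_n.+1 -> R) (M : R) :
  continuous f -> (forall x, `|f x| <= M) ->
  \int[lebesgueY n.+1]_x f x =
  \int[lebesgue01]_s \int[lebesgueY n]_y f (consr s y).
Proof.
move=> cf fM.
have mf := measurable_cont cf.
have mfc : measurable_fun [set: measurableTypeR R * borel n]
    ((f : borel n.+1 -> R) \o @consv R n).
  by apply: measurableT_comp => //; exact: measurable_consv.
rewrite -[RHS](@Rintegral_prod1 _ _ _ _ _ _ _ (f \o @consv R n) M)//;
  last by move=> p; exact: fM.
rewrite /Rintegral; congr fine => /=.
rewrite integral_distribution//; first exact/measurable_EFinP.
apply: (@bounded_integrable_prod _ _ _ _ _ _ _ (f \o @consv R n) M) => //.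
by move=> p; exact: fM.
Qed.

Lemma continuous_param n (f : 'rV[R]_n.+1 -> R) (M : R) :
  continuous f -> (forall x, `|f x| <= M) ->
  continuous (fun s => \int[lebesgueY n]_y f (consr s y)).
Proof.
move=> cf fM s.
have cfs y : continuous (fun s => f (consr s y)).
  apply: (continuous_compose _ cf).
  by apply: continuous_consr => ?; [exact: cvg_id|exact: cst_continuous].
have cfy t : continuous (fun y => f (consr t y)).
  apply: (continuous_compose _ cf) .
  by apply: continuous_consr => ?; [exact: cst_continuous|exact: cvg_id].
apply: (@continuity_under_integral _ _ _ (lebesgueY n)
  (fun s y => f (consr s y)) setT measurableT (s - 1) (s + 1) _ _ (cst M)).
- move=> t _; apply: (@bounded_integrable _ _ _ _ _ _ M) => //.
  exact: measurable_cont.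
- by apply: aeW => y _ t _; exact: cfs.
- exact: (@bounded_integrable _ _ _ _ _ _ `|M|).
- by move=> t _; exact: aeW.
- by rewrite inE/= in_itv/=; apply/andP; split; lra.
Qed.

(** Fubini isolates the first coordinate, to which the one-dimensional case
    applies; the induction hypothesis takes care of the others. *)
Lemma lebesgueY_translation n (f : 'rV[R]_n -> R) (z : 'rV[R]_n) :
  continuous f -> Defs.periodic f ->
  \int[lebesgueY n]_x f (x + z) = \int[lebesgueY n]_x f x.
Proof.
elim: n f z => [|n IH] f z cf pf.
  by congr Rintegral; apply/funext => x; congr f; apply/rowP => -[].
have [M M0 fM] := periodic_bounded cf pf.
have [t [w ->]] := consr_ex z.
have cft : continuous (fun x : 'rV[R]_n.+1 => f (x + consr t w)).
  exact: continuous_translate.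
rewrite (Rintegral_lebesgueYS cft (fun x => fM _)) (Rintegral_lebesgueYS cf fM).
transitivity (\int[lebesgue01]_s \int[lebesgueY n]_y f (consr (s + t) y)).
  apply: eq_Rintegral => s _.
  under eq_Rintegral do rewrite consrD.
  rewrite (IH (fun y => f (consr (s + t) y)))//.
    apply: (continuous_compose _ cf) .
    by apply: continuous_consr => ?; [exact: cst_continuous|exact: cvg_id].
  move=> y k; rewrite -[RHS](pf _ (\row_i if unlift ord0 i is Some j then k 0 j else 0)).
  congr f; apply/rowP => i; rewrite !mxE/=.
  by case: unlift => [j|]; rewrite ?mxE// addr0.
pose G (s : R) := \int[lebesgueY n]_y f (consr s y).
have cG : continuous G by exact: continuous_param cf fM.
have GM s : `|G s| <= M.
  apply: normr_Rintegral_le => //; apply: measurable_cont.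
  apply: (continuous_compose _ cf) .
  by apply: continuous_consr => ?; [exact: cst_continuous|exact: cvg_id].
have cGt : continuous (fun s : R => G (s + t)) by exact: continuous_translate.
rewrite -/G (Rintegral_lebesgue01 cGt (fun s => GM _)).
rewrite (Rintegral_lebesgue01 cG GM) translation_lebesgue01// => s.
apply: eq_Rintegral => y _.
rewrite -[RHS](pf _ (\row_i if unlift ord0 i is Some j then 0 else 1)).
congr f; apply/rowP => i; rewrite !mxE/=.
by case: unlift => [j|]; rewrite ?addr0.
Qed.

End translation.

(** * Derivatives and integration by parts *)

Section calculus.
Context {R : realType}.
Implicit Types (n : nat).

Lemma MVT_global (f df : R -> R) (a b : R) :
  (forall x : R, is_derive x (1 : R) f (df x)) ->
  exists2 c, `|c - a| <= `|b - a| & f b - f a = df c * (b - a).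
Proof.
move=> hf; have cf : continuous f.
  move=> x; apply: differentiable_continuous; apply/derivable1_diffP.
  by have [] := hf x.
have [ab|/ltW ba] := leP a b.
  have [|c + ->] := @MVT_segment R f df a b ab.
    exact: continuous_subspaceT.
  rewrite in_itv/= => /andP[ac cb]; exists c => //.
  by rewrite !ger0_norm ?subr_ge0// lerB.
have [|c + fab] := @MVT_segment R f df b a ba.
  exact: continuous_subspaceT.
rewrite in_itv/= => /andP[bc ca]; exists c; last by rewrite -opprB fab -mulrN opprB.
by rewrite !ler0_norm ?subr_le0// lerN2 lerB.
Qed.

Lemma diff_partial n (f : 'rV[R]_n -> R) (x v : 'rV[R]_n) :
  differentiable f x ->
  'd f x v = \sum_i v 0 i * 'D_(delta_mx 0 i) f x.
Proof.
move=> df; rewrite {1}(row_sum_delta v) linear_sum; apply: eq_bigr => i _.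
by rewrite linearZ/= deriveE.
Qed.

Lemma is_derive_curve n (f : 'rV[R]_n -> R) (phi : R -> 'rV[R]_n) (t : R)
    (w : 'rV[R]_n) :
  differentiable f (phi t) -> is_derive t (1 : R) phi w ->
  is_derive t (1 : R) (fun s => f (phi s))
    (\sum_i w 0 i * 'D_(delta_mx 0 i) f (phi t)).
Proof.
move=> df [/derivable1_diffP dphi dw].
have dfphi : differentiable (f \o phi) t by exact: differentiable_comp.
apply: DeriveDef; first exact/derivable1_diffP.
rewrite (deriveE _ dfphi) diff_comp//= -diff_partial//; congr ('d f _ _).
by rewrite -dw deriveE.
Qed.

Lemma is_derive_coord n (phi : R -> 'rV[R]_n) (t : R) (w : 'rV[R]_n) i :
  is_derive t (1 : R) phi w ->
  is_derive t (1 : R) (fun s => phi s 0 i) (w 0 i).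
Proof.
move=> [dphi <-]; have hd := differentiable_coord (phi t) 0 i.
have dphi' : differentiable phi t by exact/derivable1_diffP.
apply: DeriveDef.
  by apply/derivable1_diffP; exact: (@differentiable_comp _ _ _ _ phi (fun N => N 0 i)).
rewrite deriveE; last exact: (@differentiable_comp _ _ _ _ phi (fun N => N 0 i)).
rewrite (@diff_comp _ _ _ _ phi (fun N => N 0 i))//= deriveE//.
have lc : linear (fun N : 'rV[R]_n => N 0 i : R) by move=> a u v; rewrite !mxE.
pose L := HB.pack_for {linear 'rV[R]_n -> R} (fun N : 'rV[R]_n => N 0 i : R)
  (GRing.isLinear.Build _ _ _ _ _ lc).
by rewrite (@diff_lin _ _ _ L)//; exact: coord_continuous.
Qed.

Lemma is_derive_line n (x v : 'rV[R]_n) (t : R) :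
  is_derive t (1 : R) (fun s => x + s *: v) v.
Proof.
have := @is_deriveD _ _ _ (cst x) (fun s : R => s *: v) t 1 0 v.
rewrite add0r; apply.
have h := is_derive_id t (1 : R).
have dd : differentiable (fun s : R => s *: v) t.
  by apply: (@differentiableZl _ _ _ id).
apply: DeriveDef; first exact/derivable1_diffP.
by rewrite deriveE// (@diffZl _ _ _ id)// -deriveE// derive_id scale1r.
Qed.

Definition lipfun (V : normedModType R) (f : V -> R) (L : R) :=
  forall x y, `|f x - f y| <= L * `|x - y|.

Lemma lipfun_continuous (V : normedModType R) (f : V -> R) (L : R) :
  lipfun f L -> continuous f.
Proof.
move=> lf x; apply/cvgrPdist_lt => e e0; near=> y.
apply: le_lt_trans (lf x y) _.
have L1 : 0 < `|L| + 1 by rewrite ltr_wpDl.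
apply: (@le_lt_trans _ _ ((`|L| + 1) * `|x - y|)).
  by rewrite ler_wpM2r// (le_trans (ler_norm _))// lerDl.
rewrite -ltr_pdivlMl//.
near: y; apply/nbhs_normP; exists ((`|L| + 1)^-1 * e) => //=.
by rewrite mulr_gt0// invr_gt0.
Unshelve. all: by end_near. Qed.

Lemma lipfun_coord n (b : 'rV[R]_n -> 'rV[R]_n) (L : R) i :
  (forall x y, `|b x - b y| <= L * `|x - y|) -> lipfun (fun x => b x 0 i) L.
Proof.
move=> lb x y; apply: le_trans (lb x y).
by have := normr_coord_le (b x - b y) i; rewrite !mxE.
Qed.

Lemma lipfun_partial n (f : 'rV[R]_n -> R) (M : R) :
  (forall x, differentiable f x) ->
  (forall i x, `|'D_(delta_mx 0 i) f x| <= M) -> lipfun f (n%:R * M).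
Proof.
move=> df fM x y.
have dfs s : is_derive s (1 : R) (fun s => f (y + s *: (x - y)))
    (\sum_i (x - y) 0 i * 'D_(delta_mx 0 i) f (y + s *: (x - y))).
  exact: (@is_derive_curve _ f _ s _ (df _) (is_derive_line _ _ _)).
have [c _] := MVT_global 0 1 dfs.
rewrite scale1r scale0r addr0 (addrC y) subrK subr0 mulr1 => ->.
rewrite -mulrA [M * _]mulrC; apply: normr_sum_le => i.
by rewrite normrM ler_pM// normr_coord_le.
Qed.

Lemma derive_seq (V : normedModType R) (f : V -> R) (x e : V) (l : R)
    (u : nat -> R) :
  is_derive x e f l -> (forall k, u k != 0) -> u k @[k --> \oo] --> 0 ->
  (u k)^-1 * (f (x + u k *: e) - f x) @[k --> \oo] --> l.
Proof.
move=> [/cvg_ex[/= l' hl'] dl] u0 uc.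
have -> : l = l' by rewrite -dl; apply: cvg_lim => //; exact: hl'.
move/cvgr_dnbhsP : hl' => /(_ u (conj u0 uc)).
by under [in X in X -> _]eq_fun do rewrite [_ + x]addrC.
Qed.

(** Limits under an integral sign are taken along this sequence of steps, since
    the dominated convergence theorem is about sequences. *)
Definition invS (k : nat) : R := k.+1%:R^-1.

Lemma invS_gt0 k : 0 < invS k.
Proof. by rewrite invr_gt0. Qed.

Lemma cvg_invS : invS k @[k --> \oo] --> 0.
Proof. exact: cvg_harmonic. Qed.

End calculus.

Section integration_by_parts.
Context {R : realType}.
Implicit Types (n : nat).

Lemma measurable_derive n (f f' : 'rV[R]_n -> R) (e : 'rV[R]_n) :
  continuous f -> (forall x, is_derive x e f (f' x)) ->
  measurable_fun [set: borel n] (f' : borel n -> measurableTypeR R).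
Proof.
move=> cf df.
pose F k (x : 'rV[R]_n) := (invS k)^-1 * (f (x + invS k *: e) - f x).
apply: (@measurable_fun_cvg _ (borel n) R setT (F : nat -> borel n -> R)) => [k|x _].
  apply: measurable_funM => //; apply: measurable_funB.
    by apply: measurable_cont; exact: continuous_translate.
  exact: measurable_cont.
by apply: derive_seq cvg_invS => // k; rewrite gt_eqF// invS_gt0.
Qed.

Lemma lipfun_derive_le (V : normedModType R) (f : V -> R) (x e : V) (L l : R) :
  lipfun f L -> is_derive x e f l -> `|l| <= L * `|e|.
Proof.
move=> lf df.
have u0 k : invS k != 0 :> R by rewrite gt_eqF// invS_gt0.
have h := derive_seq df u0 cvg_invS.
apply: (cvgr_to_le (cvg_norm h)); near=> k.
rewrite normrM normfV (gtr0_norm (invS_gt0 k)) ler_pdivrMl ?invS_gt0//.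
rewrite (le_trans (lf _ _))// addrC addKr normrZ (gtr0_norm (invS_gt0 k)).
by rewrite mulrCA.
Unshelve. all: by end_near. Qed.

(** A translation by - h e in the integral moves the difference quotient of f
    onto g. *)
Lemma periodic_integration_by_parts n (f g f' g' : 'rV[R]_n -> R)
    (e : 'rV[R]_n) (Lf Lg : R) :
  Defs.periodic f -> Defs.periodic g -> lipfun f Lf -> lipfun g Lg ->
  (forall x, is_derive x e f (f' x)) -> (forall x, is_derive x e g (g' x)) ->
  \int[lebesgueY n]_x (f' x * g x) = - \int[lebesgueY n]_x (f x * g' x).
Proof.
move=> pf pg lf lg df dg.
have cf := lipfun_continuous lf; have cg := lipfun_continuous lg.
have [Mf Mf0 fM] := periodic_bounded cf pf.
have [Mg Mg0 gM] := periodic_bounded cg pg.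
have mf := measurable_cont cf; have mg := measurable_cont cg.
have mf' := measurable_derive cf df; have mg' := measurable_derive cg dg.
have cfh h : continuous (fun x : 'rV[R]_n => f (x + h *: e)).
  exact: continuous_translate.
have cgh h : continuous (fun x : 'rV[R]_n => g (x - h *: e)).
  exact: continuous_translate.
have mfh h := measurable_cont (cfh h); have mgh h := measurable_cont (cgh h).
have u0 k : invS k != 0 :> R by rewrite gt_eqF// invS_gt0.
pose F k (x : 'rV[R]_n) := (invS k)^-1 * (f (x + invS k *: e) - f x) * g x.
pose G k (x : 'rV[R]_n) := f x * ((- invS k)^-1 * (g (x - invS k *: e) - g x)).
have intE k : \int[lebesgueY n]_x F k x = - \int[lebesgueY n]_x G k x.
  have integ (h1 h2 : 'rV[R]_n -> R) : continuous h1 -> continuous h2 ->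
    (forall x, `|h1 x| <= Mf) -> (forall x, `|h2 x| <= Mg) ->
    (lebesgueY n).-integrable [set: borel n] (EFin \o (fun x => h1 x * h2 x)).
    move=> c1 c2 b1 b2; apply: (@bounded_integrable _ _ _ _ _ _ (Mf * Mg)) => //.
      by apply: measurable_funM; exact: measurable_cont.
    by move=> x; rewrite normrM ler_pM.
  pose I0 := \int[lebesgueY n]_x (f x * g x).
  have -> : \int[lebesgueY n]_x F k x =
      (invS k)^-1 * (\int[lebesgueY n]_x (f (x + invS k *: e) * g x) - I0).
    rewrite -RintegralB//; [|exact: integ|exact: integ].
    rewrite -RintegralZl//; first by apply: eq_Rintegral => x _; rewrite /F; ring.
    by apply: integrableB_fun => //; exact: integ.
  have -> : \int[lebesgueY n]_x G k x =
      (- invS k)^-1 * (\int[lebesgueY n]_x (f x * g (x - invS k *: e)) - I0).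
    rewrite -RintegralB//; [|exact: integ|exact: integ].
    rewrite -RintegralZl//; first by apply: eq_Rintegral => x _; rewrite /G; ring.
    by apply: integrableB_fun => //; exact: integ.
  rewrite -(@lebesgueY_translation _ n (fun x => f x * g (x - invS k *: e))
      (invS k *: e)).
  - by under [in RHS]eq_Rintegral do rewrite addrK; rewrite invrN mulNr opprK.
  - move=> x; apply: continuousM; [exact: cf|exact: cgh].
  - move=> x k'; rewrite pf; congr (_ * _).
    by rewrite addrAC pg.
have hF : \int[lebesgueY n]_x F k x @[k --> \oo] --> \int[lebesgueY n]_x (f' x * g x).
  apply: (@Rintegral_cvg _ _ _ _ _ _ (cst (Lf * `|e| * Mg))).
  - move=> k; apply: measurable_funM => //; apply: measurable_funM => //.
    by apply: measurable_funB => //; exact: mfh.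
  - exact: measurable_funM.
  - exact: (@bounded_integrable _ _ _ _ _ _ `|Lf * `|e| * Mg|).
  - apply: aeW => x; apply: cvgMr_tmp; exact: derive_seq cvg_invS.
  - apply: aeW => x k; rewrite /F normrM ler_pM//.
    rewrite normrM normfV (gtr0_norm (invS_gt0 k)) ler_pdivrMl ?invS_gt0//.
    rewrite (le_trans (lf _ _))// addrC addKr normrZ (gtr0_norm (invS_gt0 k)).
    by rewrite mulrCA.
have hG : \int[lebesgueY n]_x G k x @[k --> \oo] --> \int[lebesgueY n]_x (f x * g' x).
  apply: (@Rintegral_cvg _ _ _ _ _ _ (cst (Mf * (Lg * `|e|)))).
  - move=> k; apply: measurable_funM => //; apply: measurable_funM => //.
    by apply: measurable_funB => //; exact: mgh.
  - exact: measurable_funM.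
  - exact: (@bounded_integrable _ _ _ _ _ _ `|Mf * (Lg * `|e|)|).
  - apply: aeW => x; apply: cvgMl_tmp.
    have v0 k : - invS k != 0 :> R by rewrite oppr_eq0.
    have vc : - invS k @[k --> \oo] --> (0 : R).
      by rewrite -oppr0; apply: cvgN; exact: cvg_invS.
    have := derive_seq (dg x) v0 vc.
    by under eq_fun do rewrite scaleNr.
  - apply: aeW => x k; rewrite /G normrM ler_pM//.
    rewrite normrM normfV normrN (gtr0_norm (invS_gt0 k)) ler_pdivrMl ?invS_gt0//.
    rewrite (le_trans (lg _ _))// addrC addKr normrN normrZ (gtr0_norm (invS_gt0 k)).
    by rewrite mulrCA.
rewrite -(cvg_lim (@Rhausdorff R) hF); apply: cvg_lim => //.
rewrite (_ : (fun k => _) = (fun k => - \int[lebesgueY n]_x G k x)).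
  exact: cvgN.
exact/funext.
Qed.

End integration_by_parts.

Section finite_sums.
Context {R : realType} d (T : measurableType d).
Variable mu : {measure set T -> \bar R}.

Lemma integrable_fun_sum (I : Type) (s : seq I) (D : set T) (f : I -> T -> R) :
  measurable D -> (forall i, mu.-integrable D (EFin \o f i)) ->
  mu.-integrable D (EFin \o (fun x => \sum_(i <- s) f i x)).
Proof.
move=> mD fi.
rewrite (_ : EFin \o _ = (fun x => \sum_(i <- s) (EFin \o f i) x)%E).
  exact: integrable_sum.
by apply/funext => x /=; rewrite sumEFin.
Qed.

Lemma Rintegral_fun_sum (I : Type) (s : seq I) (D : set T) (f : I -> T -> R) :
  measurable D -> (forall i, mu.-integrable D (EFin \o f i)) ->
  \int[mu]_(x in D) (\sum_(i <- s) f i x) =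
  \sum_(i <- s) \int[mu]_(x in D) f i x.
Proof.
move=> mD fi; elim: s => [|i s IH].
  rewrite big_nil -[RHS](mul0r (fine (mu D))) -Rintegral_cst//.
  by apply: eq_Rintegral => x _; rewrite big_nil.
rewrite big_cons -IH -RintegralD//; last exact: integrable_fun_sum.
by apply: eq_Rintegral => x _; rewrite big_cons.
Qed.

End finite_sums.

(** * Solenoidal fields and quadratic Taylor bounds *)

Section divergence_free.
Context {R : realType}.
Implicit Types (n : nat).

(** Integration by parts moves the derivatives onto g, where they add up to its
    divergence. *)
Lemma divergence_free_orthogonal n (g : 'rV[R]_n -> 'rV[R]_n)
    (dg dP : 'I_n -> 'rV[R]_n -> R) (P : 'rV[R]_n -> R) (Lg LP : R) :
  Defs.periodic g -> (forall i, lipfun (fun x => g x 0 i) Lg) ->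
  (forall i x, is_derive x (delta_mx 0 i) (fun x => g x 0 i) (dg i x)) ->
  (forall x, \sum_i dg i x = 0) ->
  Defs.periodic P -> lipfun P LP ->
  (forall i x, is_derive x (delta_mx 0 i) P (dP i x)) ->
  \int[lebesgueY n]_x (\sum_i dP i x * g x 0 i) = 0.
Proof.
move=> pg lg dgE div pP lP dPE.
have cP := lipfun_continuous lP.
have pgi i : Defs.periodic (fun x => g x 0 i) by move=> x k; rewrite pg.
have cg i := lipfun_continuous (lg i).
have mP := measurable_cont cP.
have [M M0 PM] := periodic_bounded cP pP.
have intdP i : (lebesgueY n).-integrable [set: borel n]
    (EFin \o (fun x => dP i x * g x 0 i)).
  have [Mi Mi0 gMi] := periodic_bounded (cg i) (pgi i).
  apply: (@bounded_integrable _ _ _ _ _ _ (LP * `|delta_mx 0 i : 'rV[R]_n| * Mi)) => //.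
    apply: measurable_funM; last exact: (measurable_cont (cg i)).
    exact: measurable_derive (dPE i).
  move=> x; rewrite normrM ler_pM//.
  exact: lipfun_derive_le (dPE i x).
have intdg i : (lebesgueY n).-integrable [set: borel n]
    (EFin \o (fun x => P x * dg i x)).
  apply: (@bounded_integrable _ _ _ _ _ _ (M * (Lg * `|delta_mx 0 i : 'rV[R]_n|))) => //.
    apply: measurable_funM => //.
    exact: measurable_derive (dgE i).
  move=> x; rewrite normrM ler_pM//.
  exact: lipfun_derive_le (dgE i x).
rewrite Rintegral_fun_sum//.
under eq_bigr do rewrite (periodic_integration_by_parts pP (pgi _) lP (lg _) (dPE _) (dgE _)).
rewrite sumrN -Rintegral_fun_sum// [X in - X](_ : _ = 0) ?oppr0//.
rewrite -[RHS](Rintegral_prob_cst (lebesgueY n)).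
by apply: eq_Rintegral => x _; rewrite -mulr_sumr div mulr0.
Qed.

(** The gradient G is encoded by a quadratic Taylor bound, uniform in x: the
    bound passes through convolutions, and hence spares differentiating under
    the integral sign. *)
Definition quad_taylor n (f : 'rV[R]_n -> R) (G : 'I_n -> 'rV[R]_n -> R) (C : R) :=
  forall x h, `|f (x + h) - f x - \sum_i h 0 i * G i x| <= C * `|h| ^+ 2.

Lemma quad_taylor_diff n (f : 'rV[R]_n -> R) G C : quad_taylor f G C ->
  forall x, differentiable f x /\ 'd f x = (fun v => \sum_i v 0 i * G i x) :> (_ -> _).
Proof.
move=> fG x.
pose df (v : 'rV[R]_n) : R := \sum_i v 0 i * G i x.
have ldf : linear df.
  move=> a u v; transitivity (a * df u + df v) => //.
  rewrite /df mulr_sumr -big_split/=.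
  by apply: eq_bigr => i _; rewrite !mxE; ring.
pose L := HB.pack_for {linear 'rV[R]_n -> R} df (GRing.isLinear.Build _ _ _ _ _ ldf).
have cL : continuous L.
  apply: (@lipfun_continuous _ _ L (\sum_i `|G i x|)) => u v.
  rewrite -linearB [L _]/(df _) /df mulr_suml.
  apply: le_trans (ler_norm_sum _ _ _) _; apply: ler_sum => i _.
  by rewrite normrM mulrC ler_wpM2l// normr_coord_le.
have fL : f \o shift x = cst (f x) + L +o_ 0 id.
  apply/eqaddoP => e e0.
  have C1 : 0 < `|C| + 1 by rewrite ltr_wpDl.
  have small : \forall h \near nbhs (0 : 'rV[R]_n), `|h| <= (`|C| + 1)^-1 * e.
    have c0 : 0 < (`|C| + 1)^-1 * e by rewrite mulr_gt0// invr_gt0.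
    exact: (@pseudometric_normed_Zmodule.nbhs0_le _ 'rV[R]_n).
  near=> h.
  rewrite /= !fctE/= (_ : _ - _ = f (x + h) - f x - df h); last first.
    by rewrite /L/= opprD addrA [h + x]addrC.
  apply: le_trans (fG x h) _.
  rewrite expr2 mulrA ler_wpM2r//.
  apply: (@le_trans _ _ ((`|C| + 1) * `|h|)).
    by rewrite ler_wpM2r// (le_trans (ler_norm _))// lerDl.
  rewrite -ler_pdivlMl//.
  by near: h; exact: small.
have dE := diff_unique cL fL.
split => //; apply/diff_locallyP; rewrite dE; split => //.
Unshelve. all: by end_near. Qed.

Lemma quad_taylor_is_derive n (f : 'rV[R]_n -> R) G C x i : quad_taylor f G C ->
  is_derive x (delta_mx 0 i) f (G i x).
Proof.
move=> fG; have [df dE] := quad_taylor_diff fG x.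
apply: DeriveDef; first exact: diff_derivable.
rewrite deriveE// dE (bigD1 i)//= big1 ?addr0.
  by rewrite mxE !eqxx mul1r.
by move=> j ji; rewrite mxE (negPf ji) andbF mul0r.
Qed.

(** With a step of length 1, the Taylor bound controls the gradient by the
    oscillation of f. *)
Lemma quad_taylor_lipfun n (f : 'rV[R]_n -> R) G C M : quad_taylor f G C ->
  (forall x, `|f x| <= M) -> lipfun f (n%:R * (`|C| + (M + M))).
Proof.
move=> fG fM; apply: lipfun_partial => [x|i x].
  by have [] := quad_taylor_diff fG x.
have [_ ->] := quad_taylor_is_derive x i fG.
have := fG x (delta_mx 0 i).
rewrite (bigD1 i)//= big1 ?addr0 => [|j ji]; last first.
  by rewrite mxE (negPf ji) andbF mul0r.
rewrite mxE !eqxx mul1r => h.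
have -> : G i x = (f (x + delta_mx 0 i) - f x) -
  (f (x + delta_mx 0 i) - f x - G i x) by ring.
rewrite addrC; apply: le_trans (ler_normD _ _) _; apply: lerD.
  rewrite normrN; apply: le_trans h _; apply: le_trans (ler_norm _) _.
  rewrite normrM ler_piMr// normrX normr_id exprn_ile1//.
  exact: normr_delta_mx_le.
by apply: le_trans (ler_normB _ _) _; exact: lerD.
Qed.

End divergence_free.

(** * Mollification of periodic functions *)

Section kernel.
Context {R : realType}.
Implicit Types (n : nat).

Lemma taylor_cos (x r : R) : `|cos (x + r) - cos x + sin x * r| <= r ^+ 2.
Proof.
have dsin (a b : R) : `|sin a - sin b| <= `|a - b|.
  have [c _ ->] := MVT_global b a (fun x => is_derive_sin x).
  by rewrite normrM ler_piMl// cos_max.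
have [c] := MVT_global x (x + r) (fun x => is_derive_cos x).
have -> : x + r - x = r by ring.
move=> cr ->; rewrite -mulrDl normrM addrC -real_normK ?num_real// expr2.
by rewrite ler_wpM2r// (le_trans (dsin _ _))// distrC.
Qed.

Lemma taylor_sqr_pos (s r : R) :
  `|Num.max 0 (s + r) ^+ 2 - Num.max 0 s ^+ 2 - Num.max 0 s *+ 2 * r| <= r ^+ 2.
Proof.
rewrite ler_norml mulr2n.
by case: (leP 0 (s + r)) => h1; case: (leP 0 s) => h2; apply/andP; split; nra.
Qed.

Let om : R := pi *+ 2.

Let om_gt0 : 0 < om.
Proof. by rewrite /om mulr2n addr_gt0 ?pi_gt0. Qed.

Lemma cosD_int (x : R) (k : int) : cos (om * (x + k%:~R)) = cos (om * x).
Proof.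
have hn (m : nat) y : cos (om * (y + m%:R)) = cos (om * y).
  elim: m y => [|m IH] y; first by rewrite addr0.
  by rewrite -natr1 addrA mulrDr mulr1 cosD2pi.
case: k => m; first exact: hn.
by rewrite NegzE mulrNz -[in RHS](subrK m.+1%:R x) hn.
Qed.

(** Translating z by an integer into [- 1 / 2, 1 / 2] leaves the cosine unchanged
    and reduces the claim to the monotonicity of cos on [0, pi]. *)
Lemma cos_near_int (z t : R) : 0 < t -> t <= 2^-1 ->
  cos (om * t) < cos (om * z) -> exists k : int, `|z - k%:~R| <= t.
Proof.
move=> t0 t12 ctz; exists (Num.floor (z + 2^-1)).
set k := Num.floor _; have /andP[k1 k2] := floor_itv (z + 2^-1).
rewrite -/k intrD1 in k1 k2.
have r12 : `|z - k%:~R| <= 2^-1 by rewrite ler_norml; apply/andP; split; lra.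
rewrite leNgt; apply/negP => tr; move: ctz; rewrite ltNge => /negP; apply.
have -> : cos (om * z) = cos (om * `|z - k%:~R|).
  have -> : om * `|z - k%:~R| = `|om * (z - k%:~R)|.
    by rewrite normrM (gtr0_norm om_gt0).
  rewrite cos_norm.
  by rewrite -[in LHS](subrK k%:~R z) cosD_int.
apply/ltW; rewrite ltr_cos ?in_itv/=.
- by rewrite ltr_pM2l.
- by apply/andP; split; rewrite /om; have := @pi_gt0 R; nra.
- have := normr_ge0 (z - k%:~R).
  by move=> h0; apply/andP; split; rewrite /om; have := @pi_gt0 R; nra.
Qed.

(** The bump is the square of the positive part of a trigonometric polynomial
    which is positive near the lattice only. It is periodic by construction, and
    the square turns the positive part into a function with a quadratic Taylor
    bound. *)
Definition bump_arg n (t : R) (z : 'rV[R]_n) : R :=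
  \sum_i (cos (om * z 0 i) - 1) + (1 - cos (om * t)).

Definition bump n (t : R) (z : 'rV[R]_n) : R := Num.max 0 (bump_arg t z) ^+ 2.

Definition bump_grad n (t : R) (i : 'I_n) (z : 'rV[R]_n) : R :=
  Num.max 0 (bump_arg t z) *+ 2 * (- om * sin (om * z 0 i)).

Lemma bump_arg_le n t (z : 'rV[R]_n) : bump_arg t z <= 1 - cos (om * t).
Proof.
rewrite /bump_arg gerDr; apply: sumr_le0 => i _.
by rewrite subr_le0 cos_le1.
Qed.

Lemma bump_arg_pos_le n t (z : 'rV[R]_n) : 0 <= Num.max 0 (bump_arg t z) <= 2.
Proof.
rewrite le_max lexx/= ge_max ler0n/= (le_trans (bump_arg_le _ _))//.
by have := cos_geN1 (om * t); lra.
Qed.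

(** Every term of the sum is nonpositive, so that where the bump is nonzero none
    of them is below cos (2 pi t) - 1. *)
Lemma bump_support n t (z : 'rV[R]_n) : 0 < t -> t <= 2^-1 ->
  bump t z != 0 -> exists k : 'rV[int]_n, `|z - map_mx intr k| <= t.
Proof.
move=> t0 t12; rewrite /bump; case: (leP (bump_arg t z) 0) => [_|q0 _].
  by rewrite expr0n eqxx.
have hi i : exists k : int, `|z 0 i - k%:~R| <= t.
  apply: cos_near_int => //; move: q0; rewrite /bump_arg (bigD1 i)//=.
  have : \sum_(j < n | j != i) (cos (om * z 0 j) - 1) <= 0.
    by apply: sumr_le0 => j _; rewrite subr_le0 cos_le1.
  lra.
have [k hk] := choice hi.
exists (\row_i k i); apply: normr_row_le => [|i]; first exact: ltW.
by rewrite !mxE.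
Qed.

Lemma bump_taylor n t :
  quad_taylor (@bump n t) (@bump_grad n t) ((n%:R * om) ^+ 2 + 4 * n%:R * om ^+ 2).
Proof.
move=> z h; set m := Num.max 0 (bump_arg t z).
pose D := bump_arg t (z + h) - bump_arg t z.
pose D1 := \sum_i h 0 i * (- om * sin (om * z 0 i)).
have DE : D = \sum_i (cos (om * z 0 i + om * h 0 i) - cos (om * z 0 i)).
  rewrite /D /bump_arg opprD addrACA subrr addr0 -sumrB; apply: eq_bigr => i _.
  by rewrite mxE mulrDr; ring.
have hD1 : `|D - D1| <= n%:R * (om ^+ 2 * `|h| ^+ 2).
  rewrite DE -sumrB; apply: normr_sum_le => i.
  have -> : cos (om * z 0 i + om * h 0 i) - cos (om * z 0 i) -
      h 0 i * (- om * sin (om * z 0 i)) =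
    cos (om * z 0 i + om * h 0 i) - cos (om * z 0 i) +
      sin (om * z 0 i) * (om * h 0 i) by ring.
  apply: le_trans (taylor_cos _ _) _.
  rewrite exprMn ler_wpM2l ?sqr_ge0// -real_normK ?num_real//.
  by rewrite lerXn2r ?nnegrE// normr_coord_le.
have hD : `|D| <= n%:R * om * `|h|.
  rewrite DE -mulrA; apply: normr_sum_le => i.
  have [c _] := MVT_global (om * z 0 i) (om * z 0 i + om * h 0 i)
    (fun x => is_derive_cos x).
  have -> : om * z 0 i + om * h 0 i - om * z 0 i = om * h 0 i by ring.
  move=> ->.
  rewrite normrM normrN normrM (gtr0_norm om_gt0).
  rewrite -[leRHS]mul1r ler_pM ?mulr_ge0 ?(ltW om_gt0) ?normr_coord_le//.
    by rewrite ler_norml sin_geN1 sin_le1.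
  by rewrite ler_wpM2l ?(ltW om_gt0)// normr_coord_le.
have -> : bump t (z + h) - bump t z - \sum_i h 0 i * bump_grad t i z =
    (Num.max 0 (bump_arg t z + D) ^+ 2 - m ^+ 2 - m *+ 2 * D) +
    m *+ 2 * (D - D1).
  have -> : bump_arg t z + D = bump_arg t (z + h) by rewrite /D addrC subrK.
  rewrite [_ *+ 2 * (D - D1)]mulrBr addrA subrK /D1 mulr_sumr; congr (_ - _); apply: eq_bigr => i _.
  by rewrite /bump_grad -/m mulrCA.
apply: le_trans (ler_normD _ _) _.
rewrite [leRHS]mulrDl; apply: lerD.
  apply: le_trans (taylor_sqr_pos _ _) _.
  rewrite -exprMn -real_normK ?num_real//.
  by rewrite lerXn2r ?nnegrE// !mulr_ge0// ltW.
have /andP[m0 m2] := bump_arg_pos_le t z.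
rewrite normrM.
have -> : 4 * n%:R * om ^+ 2 * `|h| ^+ 2 =
  (2 *+ 2 : R) * (n%:R * (om ^+ 2 * `|h| ^+ 2)) by ring.
apply: ler_pM => //.
by rewrite ger0_norm ?mulrn_wge0// lerMn2r m2.
Qed.

Lemma bump_periodic n t : Defs.periodic (@bump n t).
Proof.
move=> z k; rewrite /bump /bump_arg.
under eq_bigr do rewrite !mxE cosD_int.
by [].
Qed.

Lemma continuous_bump n t : continuous (@bump n t).
Proof.
move=> z; have [dz _] := quad_taylor_diff (@bump_taylor n t) z.
exact: differentiable_continuous.
Qed.

Lemma bump_grad_bounded n t (i : 'I_n) z : `|bump_grad t i z| <= 4 * om.
Proof.
have /andP[m0 m2] := bump_arg_pos_le t z.
rewrite /bump_grad normrM ger0_norm ?mulrn_wge0//.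
rewrite normrM normrN (gtr0_norm om_gt0).
have hs : `|sin (om * z 0 i)| <= 1 by rewrite ler_norml sin_geN1 sin_le1.
have -> : 4 * om = (2 *+ 2 : R) * (om * 1) by ring.
apply: ler_pM; rewrite ?mulrn_wge0 ?mulr_ge0 ?(ltW om_gt0) ?lerMn2r ?m2//.
by rewrite ler_wpM2l// ltW.
Qed.

(** The bump is positive at 0, hence bounded below on a small cube. *)
Lemma bump_integral_gt0 n t : 0 < t -> t <= 2^-1 ->
  0 < \int[lebesgueY n]_z bump t z.
Proof.
move=> t0 t12.
have b0 : 0 < bump t (0 : 'rV[R]_n).
  rewrite /bump exprn_gt0// lt_max; apply/orP; right.
  rewrite /bump_arg big1 ?add0r => [|i _]; last by rewrite mxE mulr0 cos0 subrr.
  rewrite subr_gt0 -[ltRHS]cos0 ltr_cos ?in_itv/= ?mulr_gt0//.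
    by rewrite lexx pi_ge0.
  by apply/andP; split; rewrite /om; have := @pi_gt0 R; nra.
have b02 : 0 < bump t (0 : 'rV[R]_n) / 2 by rewrite divr_gt0.
have /cvgrPdist_lt/(_ _ b02)/nbhs_ballP[e /= e0 be] := @continuous_bump n t 0.
pose r := Num.min e 1.
have r0 : 0 < r by rewrite lt_min e0 ltr01.
have r1 : r <= 1 by rewrite ge_min lexx orbT.
pose A := [set z : 'rV[R]_n | forall i, 0 <= z 0 i < r].
have mA : measurable (A : set (borel n)) by exact: measurable_box.
have bA z : A z -> bump t (0 : 'rV[R]_n) / 2 <= bump t z.
  move=> Az; have /be : ball (0 : 'rV[R]_n) e z.
    apply/ball_rV; split => // j; rewrite mxE sub0r normrN.
    have /andP[z0 zr] := Az j.
    by rewrite ger0_norm// (lt_le_trans zr)// ge_min lexx.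
  move=> /= hb; have := le_lt_trans (ler_norm _) hb.
  by move: (bump t 0) (bump t z) => p q; lra.
have b4 z : `|@bump n t z| <= 4.
  have /andP[m0 m2] := bump_arg_pos_le t z.
  by rewrite normrX ger0_norm// expr2 (_ : 4 = 2 * 2) ?ler_pM//; ring.
pose B := bump t (0 : 'rV[R]_n) / 2 * r ^+ n.
apply: (@lt_le_trans _ _ B).
  by apply: mulr_gt0 => //; exact: exprn_gt0.
have -> : B =
    \int[lebesgueY n]_(z in A) (bump t (0 : 'rV[R]_n) / 2).
  by rewrite Rintegral_cst// [X in fine X]lebesgueY_box ?r1 ?(ltW r0).
have mb := measurable_cont (@continuous_bump n t).
rewrite Rintegral_mkcond; apply: le_Rintegral => //.
- rewrite -restrict_EFin; apply/(integrable_mkcond _ mA).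
  exact: (@bounded_integrable _ _ _ _ _ _ `|bump t (0 : 'rV[R]_n) / 2|).
- exact: (@bounded_integrable _ _ _ _ _ _ 4).
- move=> z _; rewrite patchE; case: ifPn => [|_]; first by rewrite inE => /bA.
  exact: sqr_ge0.
Qed.

End kernel.

Section mollification.
Context {R : realType}.
Implicit Types (n : nat).

(** The bounds B and C depend on the width t in an unspecified way: they only
    occur next to a step that tends to 0 while t is fixed. *)
Record mollifier n (t : R) (K : 'rV[R]_n -> R) (G : 'I_n -> 'rV[R]_n -> R)
    (B C : R) : Prop := Mollifier {
  mollifier_ge0 : forall z, 0 <= K z ;
  mollifier_continuous : continuous K ;
  mollifier_periodic : Defs.periodic K ;
  mollifier_integral : \int[lebesgueY n]_z K z = 1 ;
  mollifier_support : forall z, K z != 0 ->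
    exists k : 'rV[int]_n, `|z - map_mx intr k| <= t ;
  mollifier_grad_le : forall i z, `|G i z| <= B ;
  mollifier_taylor : quad_taylor K G C }.

Lemma exists_mollifier n (t : R) : 0 < t ->
  exists K G B C, @mollifier n t K G B C.
Proof.
move=> t0; pose s := Num.min t 2^-1.
have s0 : 0 < s by rewrite lt_min t0 invr_gt0 ltr0n.
have s12 : s <= 2^-1 by rewrite /s ge_min lexx orbT.
have := @bump_integral_gt0 R n s s0 s12.
set I := \int[_]_z _ => I0.
have I'0 : 0 <= I^-1 by rewrite invr_ge0 ltW.
pose om : R := pi *+ 2.
exists (fun z => I^-1 * bump s z), (fun i z => I^-1 * bump_grad s i z),
  (I^-1 * (4 * om)), (I^-1 * ((n%:R * om) ^+ 2 + 4 * n%:R * om ^+ 2)).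
have mb := measurable_cont (@continuous_bump R n s).
have [M M0 bM] := periodic_bounded (@continuous_bump R n s) (@bump_periodic R n s).
split.
- by move=> z; rewrite mulr_ge0// sqr_ge0.
- apply: (@continuous_compose _ _ _ (bump s) ( *%R I^-1)).
    exact: continuous_bump.
  exact: mulrl_continuous.
- by move=> z k; rewrite bump_periodic.
- rewrite RintegralZl ?mulVf ?gt_eqF//.
  exact: (@bounded_integrable _ _ _ _ _ _ M).
- move=> z; rewrite mulf_eq0 negb_or => /andP[_ bz].
  have [k hk] := bump_support s0 s12 bz; exists k.
  by rewrite (le_trans hk)// ge_min lexx.
- move=> i z; rewrite normrM (ger0_norm I'0) ler_wpM2l//.
  exact: bump_grad_bounded.
- move=> z h.
  have -> : I^-1 * bump s (z + h) - I^-1 * bump s z -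
      \sum_i h 0 i * (I^-1 * bump_grad s i z) =
    I^-1 * (bump s (z + h) - bump s z - \sum_i h 0 i * bump_grad s i z).
    rewrite !mulrBr mulr_sumr; congr (_ - _).
    by apply: eq_bigr => i _; rewrite mulrCA.
  by rewrite normrM (ger0_norm I'0) -[leRHS]mulrA ler_wpM2l// bump_taylor.
Qed.

Definition conv n (K v : 'rV[R]_n -> R) (x : 'rV[R]_n) : R :=
  \int[lebesgueY n]_z (K z * v (x + z)).

Section fixed_mollifier.
Context n (t : R) (K : 'rV[R]_n -> R) (G : 'I_n -> 'rV[R]_n -> R) (B C : R).
Hypothesis mK : mollifier t K G B C.

Let cK := mollifier_continuous mK.
Let pK := mollifier_periodic mK.
Let measK := measurable_cont cK.

Lemma mollifier_integrable (f : 'rV[R]_n -> R) (M : R) :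
  measurable_fun [set: borel n] (f : borel n -> R) -> (forall z, `|f z| <= M) ->
  (lebesgueY n).-integrable [set: borel n] (EFin \o (fun z => K z * f z)).
Proof.
move=> mf fM; have [N N0 KN] := periodic_bounded cK pK.
apply: (@bounded_integrable _ _ _ _ _ _ (N * M)) => //.
  exact: measurable_funM.
by move=> x; rewrite normrM ler_pM.
Qed.

Let iK : (lebesgueY n).-integrable [set: borel n] (EFin \o K).
Proof.
have [N N0 KN] := periodic_bounded cK pK.
exact: (@bounded_integrable _ _ _ _ _ _ N).
Qed.

Lemma mollifier_average_le (f : 'rV[R]_n -> R) (M N : R) :
  measurable_fun [set: borel n] (f : borel n -> R) -> (forall z, `|f z| <= M) ->
  (forall z, K z != 0 -> `|f z| <= N) ->
  `|\int[lebesgueY n]_z (K z * f z)| <= N.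
Proof.
move=> mf fM fN; have fi := mollifier_integrable mf fM.
apply: le_trans (le_normr_Rintegral _ fi) _ => //.
rewrite -[leRHS]mulr1 -(mollifier_integral mK) -RintegralZl//.
apply: le_Rintegral => //.
- rewrite (_ : _ \o _ = EFin \o (fun z => K z * `|f z|)); last first.
    by apply/funext => z /=; rewrite normrM (ger0_norm (mollifier_ge0 mK z)).
  apply: (@mollifier_integrable _ M); first exact: measurableT_comp.
  by move=> z; rewrite normr_id.
- rewrite (_ : _ \o _ = EFin \o (fun z => K z * N)); last first.
    by apply/funext => z /=; rewrite mulrC.
  exact: (@mollifier_integrable (cst N) `|N|).
- move=> z _; rewrite normrM (ger0_norm (mollifier_ge0 mK z)) mulrC.
  have [->|Kz] := eqVneq (K z) 0; first by rewrite !mulr0.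
  by rewrite ler_wpM2r ?fN// (mollifier_ge0 mK).
Qed.

Section conv.
Variables (v : 'rV[R]_n -> R) (M : R).
Hypotheses (cv : continuous v) (pv : Defs.periodic v).
Hypothesis vM : forall x, `|v x| <= M.

Let mv := measurable_cont cv.

Let cvx (x : 'rV[R]_n) : continuous (fun z : 'rV[R]_n => v (x + z)).
Proof. by under eq_fun do rewrite addrC; exact: continuous_translate. Qed.

Let mvx (x : 'rV[R]_n) :
  measurable_fun [set: borel n] ((fun z : 'rV[R]_n => v (x + z)) : borel n -> R).
Proof. by apply: measurable_cont; exact: cvx. Qed.

Let ccK (x : 'rV[R]_n) : continuous (fun z : 'rV[R]_n => K (z - x)).
Proof. exact: continuous_translate. Qed.

Let mcK (x : 'rV[R]_n) :
  measurable_fun [set: borel n] ((fun z : 'rV[R]_n => K (z - x)) : borel n -> R).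
Proof. by apply: measurable_cont; exact: ccK. Qed.

(** The point x moves from v to the kernel, so that conv K v inherits the Taylor
    bound of K. *)
Lemma conv_shift x : conv K v x = \int[lebesgueY n]_z (K (z - x) * v z).
Proof.
rewrite -(@lebesgueY_translation _ n (fun z => K (z - x) * v z) x).
- by apply: eq_Rintegral => z _; rewrite addrK addrC.
- by move=> z; apply: continuousM; [exact: ccK|exact: cv].
- by move=> z k; rewrite pv addrAC pK.
Qed.

Definition conv_grad i (x : 'rV[R]_n) := \int[lebesgueY n]_z (- G i (z - x) * v z).

Let mG i (x : 'rV[R]_n) :
  measurable_fun [set: borel n] ((fun z : 'rV[R]_n => G i (z - x)) : borel n -> R).
Proof.
apply: (@measurable_derive _ n (fun z : 'rV[R]_n => K (z - x))
  (fun z : 'rV[R]_n => G i (z - x)) (delta_mx 0 i)); first exact: ccK.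
move=> z; have [dK dE] := quad_taylor_diff (mollifier_taylor mK) (z - x).
have : quad_taylor (fun z : 'rV[R]_n => K (z - x)) (fun i (z : 'rV[R]_n) => G i (z - x)) C.
  by move=> y h; rewrite (addrAC y h); exact: (mollifier_taylor mK).
exact: quad_taylor_is_derive.
Qed.

Lemma conv_taylor : quad_taylor (conv K v) conv_grad (C * M).
Proof.
have [N N0 KN] := periodic_bounded cK pK.
have iKv (x : 'rV[R]_n) : (lebesgueY n).-integrable [set: borel n]
    (EFin \o (fun z => K (z - x) * v z)).
  apply: (@bounded_integrable _ _ _ _ _ _ (N * M)) => //.
    by apply: measurable_funM => //; exact: mcK.
  by move=> z; rewrite normrM ler_pM.
have iG i (x : 'rV[R]_n) : (lebesgueY n).-integrable [set: borel n]
    (EFin \o (fun z => - G i (z - x) * v z)).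
  apply: (@bounded_integrable _ _ _ _ _ _ (B * M)) => //.
    by apply: measurable_funM => //; apply: measurableT_comp => //; exact: mG.
  by move=> z; rewrite normrM normrN ler_pM// (mollifier_grad_le mK).
have ihG i (x h : 'rV[R]_n) : (lebesgueY n).-integrable [set: borel n]
    (EFin \o (fun z => h 0 i * (- G i (z - x) * v z))).
  rewrite /comp; under eq_fun do rewrite EFinM.
  by apply: integrableZl => //; exact: iG.
move=> x h; rewrite !conv_shift -RintegralB//.
have -> : \sum_i h 0 i * conv_grad i x =
    \int[lebesgueY n]_z \sum_i h 0 i * (- G i ((z : 'rV[R]_n) - x) * v z).
  rewrite Rintegral_fun_sum//.
  by apply: eq_bigr => i _; rewrite /conv_grad RintegralZl.
rewrite -RintegralB//; last 2 first.
- exact: integrableB_fun.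
- exact: integrable_fun_sum.
pose F (z : 'rV[R]_n) := K (z - (x + h)) * v z - K (z - x) * v z -
  \sum_i h 0 i * (- G i (z - x) * v z).
have FE z : F z = (K (z - x + - h) - K (z - x) -
    \sum_i (- h) 0 i * G i (z - x)) * v z.
  rewrite /F opprD addrA !mulrBl mulr_suml; congr (_ - _).
  by apply: eq_bigr => i _; rewrite mxE; ring.
rewrite -/F; apply: normr_Rintegral_le.
  apply: measurable_funB.
    by apply: measurable_funB; apply: measurable_funM => //;
      exact: mcK.
  apply: measurable_sum => i; apply: measurable_funM => //.
  by apply: measurable_funM => //; apply: measurableT_comp => //; exact: mG.
move=> z; rewrite -/(F z) FE normrM mulrAC ler_pM//.
by rewrite -(normrN h) (mollifier_taylor mK).
Qed.

Lemma conv_continuous : continuous (conv K v).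
Proof.
by move=> x; have [+ _] := quad_taylor_diff conv_taylor x; exact: differentiable_continuous.
Qed.

Lemma conv_periodic : Defs.periodic (conv K v).
Proof.
by move=> x k; apply: eq_Rintegral => z _; rewrite addrAC pv.
Qed.

Lemma convB_le x y (N : R) :
  (forall z, K z != 0 -> `|v (x + z) - v (y + z)| <= N) ->
  `|conv K v x - conv K v y| <= N.
Proof.
move=> h; rewrite /conv -RintegralB//; [|exact: mollifier_integrable..].
under eq_Rintegral do rewrite -mulrBr.
apply: (@mollifier_average_le (fun z => v (x + z) - v (y + z)) (M + M)) => //.
  exact: measurable_funB.
by move=> z; apply: le_trans (ler_normB _ _) _; exact: lerD.
Qed.

Lemma conv_lip L : lipfun v L -> lipfun (conv K v) L.
Proof.
move=> lv x y; apply: convB_le => z _; apply: le_trans (lv _ _) _.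
by rewrite opprD addrACA subrr addr0.
Qed.

Lemma conv_close x (e : R) :
  (forall y, `|y| <= t -> `|v (x + y) - v x| <= e) -> `|conv K v x - v x| <= e.
Proof.
move=> h.
have -> : v x = \int[lebesgueY n]_z (K z * v x).
  by rewrite RintegralZr ?(mollifier_integral mK) ?mul1r//.
rewrite /conv -RintegralB//; last 2 first.
- exact: mollifier_integrable.
- exact: (@mollifier_integrable (fun=> v x) M).
under eq_Rintegral do rewrite -mulrBr.
apply: (@mollifier_average_le (fun z => v (x + z) - v x) (M + M)) => //.
- exact: measurable_funB.
- by move=> z; apply: le_trans (ler_normB _ _) _; exact: lerD.
move=> z /(mollifier_support mK)[k hk].
by have := h _ hk; rewrite addrA periodic_shift.
Qed.

(** Fubini and the translation invariance of the integral of v. *)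
Lemma conv_mean : \int[lebesgueY n]_x conv K v x = \int[lebesgueY n]_x v x.
Proof.
have [N N0 KN] := periodic_bounded cK pK.
pose plus (p : borel n * borel n) : borel n :=
  (p.1 : 'rV[R]_n) + (p.2 : 'rV[R]_n).
have mplus : measurable_fun [set: borel n * borel n] plus.
  apply: measurable_rV => i.
  rewrite (_ : (fun _ => _) = (fun p : borel n * borel n =>
    (p.1 : 'rV[R]_n) 0 i + (p.2 : 'rV[R]_n) 0 i)); last first.
    by apply/funext => p; rewrite mxE.
  apply: measurable_funD.
    exact: (measurableT_comp (measurable_coord i) measurable_fst).
  exact: (measurableT_comp (measurable_coord i) measurable_snd).
pose F (p : borel n * borel n) : R :=
  K p.2 * v (plus p).
rewrite /conv (@Rintegral_fubini _ _ _ _ _ _ _ F (N * M)).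
- transitivity (\int[lebesgueY n]_z (K z * \int[lebesgueY n]_x v x)).
    apply: eq_Rintegral => z _.
    rewrite -(lebesgueY_translation z cv pv) -RintegralZl//.
    apply: (@bounded_integrable _ _ _ _ _ _ M) => //.
    by apply: measurable_cont; exact: continuous_translate.
  by rewrite RintegralZr ?(mollifier_integral mK) ?mul1r//.
- apply: measurable_funM; first exact: measurableT_comp.
  exact: measurableT_comp.
- by move=> p; rewrite /F normrM ler_pM.
Qed.

End conv.
End fixed_mollifier.
End mollification.

(** * Flux of a Lipschitz function along a solenoidal field *)

Section flux.
Context {R : realType}.

(** For a differentiable v this is divergence_free_orthogonal; here v is only
    Lipschitz. Averaging the difference quotients of v along g against a kernel
    of width t preserves their integrals, and turns them, up to an error
    Lv * Lg * t due to the variation of g at the scale t, into the difference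
    quotients of the mollification of v. The mollification is differentiable, so
    these tend, for fixed t, to a function of integral 0. It remains to let t
    tend to 0. *)
Lemma divergence_free_flux n (g : 'rV[R]_n -> 'rV[R]_n)
    (dg : 'I_n -> 'rV[R]_n -> R) (v w : 'rV[R]_n -> R) (Lg Lv : R) :
  Defs.periodic g -> 0 <= Lg -> (forall x y, `|g x - g y| <= Lg * `|x - y|) ->
  (forall i x, is_derive x (delta_mx 0 i) (fun x => g x 0 i) (dg i x)) ->
  (forall x, \sum_i dg i x = 0) ->
  Defs.periodic v -> 0 <= Lv -> lipfun v Lv ->
  measurable_fun [set: borel n] (w : borel n -> R) ->
  {ae lebesgueY n, forall x : 'rV[R]_n,
    (invS k)^-1 * (v (x + invS k *: g x) - v x) @[k --> \oo] --> w x} ->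
  \int[lebesgueY n]_x w x = 0.
Proof.
move=> pg Lg0 lg dgE div pv Lv0 lv mw vw.
have lgi i : lipfun (fun x => g x 0 i) Lg by exact: lipfun_coord.
have [Mg Mg0 gM] : exists2 M, 0 <= M & forall x, `|g x| <= M.
  have [||M M0 gM] := @periodic_bounded R n (fun x => `|g x|).
  - apply: (@lipfun_continuous _ _ _ Lg) => x y.
    exact: le_trans (ler_dist_dist _ _) (lg x y).
  - by move=> x k; rewrite pg.
  by exists M => // x; rewrite -normr_id.
have cv := lipfun_continuous lv.
have [Mv Mv0 vM] := periodic_bounded cv pv.
have s0 k : 0 < invS k :> R by exact: invS_gt0.
pose H k (x : 'rV[R]_n) := (invS k)^-1 * (v (x + invS k *: g x) - v x).
have lH k : lipfun (H k) ((invS k)^-1 * (Lv * (1 + invS k * Lg) + Lv)).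
  move=> x y; rewrite /H -mulrBr normrM (gtr0_norm (_ : 0 < (invS k)^-1)); last first.
    by rewrite invr_gt0.
  rewrite -mulrA ler_wpM2l ?invr_ge0 ?(ltW (s0 k))//.
  have -> : v (x + invS k *: g x) - v x - (v (y + invS k *: g y) - v y) =
    (v (x + invS k *: g x) - v (y + invS k *: g y)) - (v x - v y) by ring.
  apply: le_trans (ler_normB _ _) _; rewrite mulrDl; apply: lerD; last exact: lv.
  apply: le_trans (lv _ _) _; rewrite -mulrA ler_wpM2l//.
  rewrite opprD addrACA -scalerBr; apply: le_trans (ler_normD _ _) _.
  rewrite mulrDl mul1r lerD2l normrZ (gtr0_norm (s0 k)) -mulrA.
  by rewrite ler_wpM2l// ltW.
have pH k : Defs.periodic (H k).
  by move=> x j; rewrite /H pg addrAC !pv.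
have cH k := lipfun_continuous (lH k).
have mH k := measurable_cont (cH k).
have HM k x : `|H k x| <= Lv * Mg.
  rewrite /H normrM normfV (gtr0_norm (s0 k)) ler_pdivrMl//.
  apply: le_trans (lv _ _) _; rewrite addrC addKr normrZ (gtr0_norm (s0 k)).
  by rewrite mulrCA ler_wpM2l ?(ltW (s0 k))// ler_wpM2l.
have hF : \int[lebesgueY n]_x H k x @[k --> \oo] --> \int[lebesgueY n]_x w x.
  apply: (@Rintegral_cvg _ _ _ _ _ _ (cst (Lv * Mg))) => //.
  - exact: (@bounded_integrable _ _ _ _ _ _ `|Lv * Mg|).
  - by apply: aeW => x k; exact: HM.
have bound t : 0 < t -> exists C, forall k,
    `|\int[lebesgueY n]_x H k x| <= Lv * Lg * t + C * invS k.
  move=> t0; have [K [G [B [C mK]]]] := @exists_mollifier R n t t0.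
  pose V := conv K v; pose GV := conv_grad G v.
  have tV : quad_taylor V GV (C * Mv) by exact: (conv_taylor mK).
  have lV : lipfun V Lv by exact: (conv_lip mK).
  have pV : Defs.periodic V by exact: conv_periodic.
  have dV i x : is_derive x (delta_mx 0 i) V (GV i x).
    exact: quad_taylor_is_derive tV.
  have mGV i : measurable_fun [set: borel n] (GV i : borel n -> R).
    exact: (measurable_derive (lipfun_continuous lV) (dV i)).
  pose S (x : 'rV[R]_n) := \sum_i GV i x * g x 0 i.
  have S0 : \int[lebesgueY n]_x S x = 0.
    exact: (divergence_free_orthogonal pg lgi dgE div pV lV dV).
  have mS : measurable_fun [set: borel n] (S : borel n -> R).
    apply: measurable_sum => i; apply: measurable_funM => //.
    exact: (measurable_cont (lipfun_continuous (lgi i))).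
  exists (`|C * Mv| * Mg ^+ 2) => k.
  pose A x := (invS k)^-1 * (V (x + invS k *: g x) - V x).
  (* the Taylor bound of the mollification V, for the step invS k *: g x *)
  have AS x : `|A x - S x| <= `|C * Mv| * Mg ^+ 2 * invS k.
    have := tV x (invS k *: g x).
    have -> : \sum_i (invS k *: g x) 0 i * GV i x = invS k * S x.
      by rewrite mulr_sumr; apply: eq_bigr => i _; rewrite mxE mulrAC mulrA.
    have -> : A x - S x =
        (invS k)^-1 * (V (x + invS k *: g x) - V x - invS k * S x).
      by rewrite [RHS]mulrBr mulKf// gt_eqF.
    move=> h; rewrite normrM normfV (gtr0_norm (s0 k)) ler_pdivrMl//.
    apply: le_trans h _; rewrite normrZ (gtr0_norm (s0 k)) exprMn.
    have -> : invS k * (`|C * Mv| * Mg ^+ 2 * invS k) =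
      `|C * Mv| * (invS k ^+ 2 * Mg ^+ 2) by ring.
    apply: (@le_trans _ _ (`|C * Mv| * (invS k ^+ 2 * `|g x| ^+ 2))).
      by rewrite ler_wpM2r ?ler_norm// mulr_ge0// sqr_ge0.
    by rewrite ler_wpM2l// ler_wpM2l ?sqr_ge0// lerXn2r ?nnegrE.
  (* in the average of H k, g is evaluated at x + z, in A at x; the two points are
     t-close modulo the lattice on the support of K *)
  have HA x : `|conv K (H k) x - A x| <= Lv * Lg * t.
    pose y := x + invS k *: g x.
    pose D z := H k (x + z) - (invS k)^-1 * (v (y + z) - v (x + z)).
    have cvx (z : 'rV[R]_n) : continuous (fun z' : 'rV[R]_n => v (z + z')).
      by under eq_fun do rewrite addrC; exact: continuous_translate.
    have mvx z := measurable_cont (cvx z).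
    have mHx : measurable_fun [set: borel n] ((fun z => H k (x + z)) : borel n -> R).
      apply: measurable_cont.
      by under eq_fun do rewrite addrC; exact: continuous_translate.
    have mq : measurable_fun [set: borel n]
        ((fun z => (invS k)^-1 * (v (y + z) - v (x + z))) : borel n -> R).
      by apply: measurable_funM => //; apply: measurable_funB; exact: mvx.
    have Dle z : `|D z| <= Lv * `|g (x + z) - g x|.
      have -> : D z = (invS k)^-1 * (v (x + z + invS k *: g (x + z)) - v (y + z)).
        by rewrite /D /H; ring.
      rewrite normrM normfV (gtr0_norm (s0 k)) ler_pdivrMl//.
      apply: le_trans (lv _ _) _; rewrite /y.
      have -> : x + z + invS k *: g (x + z) - (x + invS k *: g x + z) =
          invS k *: (g (x + z) - g x).
        by rewrite scalerBr [x + _ + z]addrAC opprD addrACA subrr add0r.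
      by rewrite normrZ (gtr0_norm (s0 k)) mulrCA.
    have -> : conv K (H k) x - A x = \int[lebesgueY n]_z (K z * D z).
      have -> : A x = \int[lebesgueY n]_z
          (K z * ((invS k)^-1 * (v (y + z) - v (x + z)))).
        have iK z : (lebesgueY n).-integrable [set: borel n]
            (EFin \o (fun z' => K z' * v (z + z'))).
          by apply: (mollifier_integrable mK (mvx z)) => z'; exact: vM.
        rewrite /A /V /conv -/y -RintegralB// -RintegralZl//.
          by apply: eq_Rintegral => z _; rewrite -mulrBr mulrCA.
        exact: integrableB_fun.
      rewrite /conv -RintegralB//.
      - by apply: eq_Rintegral => z _; rewrite -mulrBr.
      - exact: (mollifier_integrable mK mHx).
      - apply: (mollifier_integrable mK mq (M := (invS k)^-1 * (Mv + Mv))) => z.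
        rewrite normrM normfV (gtr0_norm (s0 k)) ler_wpM2l ?invr_ge0 ?(ltW (s0 k))//.
        by apply: le_trans (ler_normB _ _) _; exact: lerD.
    apply: (mollifier_average_le mK (M := Lv * (Mg + Mg))).
    - exact: measurable_funB.
    - move=> z; apply: le_trans (Dle z) _; rewrite ler_wpM2l//.
      by apply: le_trans (ler_normB _ _) _; exact: lerD.
    - move=> z /(mollifier_support mK)[j hj].
      apply: le_trans (Dle z) _; rewrite -mulrA ler_wpM2l//.
      rewrite -(periodic_shift j pg (x + z)); apply: le_trans (lg _ _) _.
      have -> : x + z - map_mx intr j - x = z - map_mx intr j.
        by rewrite [x + z]addrC addrAC addrK.
      by rewrite ler_wpM2l.
  have mC : measurable_fun [set: borel n] (conv K (H k) : borel n -> R).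
    by apply: measurable_cont; exact: (conv_continuous mK (cH k) (pH k) (HM k)).
  have SM x : `|S x| <= n%:R * (Lv * Mg).
    apply: normr_sum_le => i; rewrite normrM ler_pM//.
      apply: le_trans (lipfun_derive_le lV (dV i x)) _.
      by rewrite ler_piMr// normr_delta_mx_le.
    exact: le_trans (normr_coord_le _ _) (gM x).
  have CM x : `|conv K (H k) x| <= Lv * Mg.
    apply: (mollifier_average_le mK (f := fun z => H k (x + z)) (M := Lv * Mg)) => //.
    apply: measurable_cont.
    by under eq_fun do rewrite addrC; exact: continuous_translate.
  rewrite -(conv_mean mK (cH k) (pH k) (HM k)) -[X in `|X|]subr0 -S0 -RintegralB//.
  - apply: normr_Rintegral_le => [|x]; first exact: measurable_funB.
    have -> : conv K (H k) x - S x = (conv K (H k) x - A x) + (A x - S x) by ring.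
    by apply: le_trans (ler_normD _ _) _; exact: lerD.
  - exact: (@bounded_integrable _ _ _ _ _ _ (Lv * Mg)).
  - exact: (@bounded_integrable _ _ _ _ _ _ (n%:R * (Lv * Mg))).
have wle t : 0 < t -> `|\int[lebesgueY n]_x w x| <= Lv * Lg * t.
  move=> t0; have [C HC] := bound t t0.
  rewrite -[leLHS]subr0.
  have h1 : `|\int[lebesgueY n]_x H k x| - C * invS k @[k --> \oo] -->
      `|\int[lebesgueY n]_x w x| - 0.
    apply: cvgB; first exact: cvg_norm.
    by rewrite -(mulr0 C); apply: cvgMl_tmp; exact: cvg_invS.
  by apply: (cvgr_to_le h1); near=> k; rewrite lerBlDr.
apply/eqP; rewrite -normr_le0; apply/ler_addgt0Pr => e e0; rewrite add0r.
have L1 : 0 < Lv * Lg + 1 by rewrite ltr_wpDl// mulr_ge0.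
apply: le_trans (wle (e / (Lv * Lg + 1)) _) _; first by rewrite divr_gt0.
rewrite mulrA ler_pdivrMr// [leRHS]mulrC ler_wpM2r ?(ltW e0)//.
by rewrite lerDl.
Unshelve. all: by end_near. Qed.

End flux.

(** * Flows of Lipschitz fields *)

Section flow.
Context {R : realType}.

(** E t * exp (- K t) is nonincreasing, and E t * exp (K t) nondecreasing. *)
Lemma gronwall (E e : R -> R) (K : R) :
  (forall t : R, is_derive t (1 : R) E (e t)) -> (forall t, `|e t| <= K * E t) ->
  forall t, E t <= expR (K * `|t|) * E 0.
Proof.
move=> dE eE t.
have dF (c s : R) : is_derive s (1 : R) (fun s => E s * expR (c * s))
    ((e s + c * E s) * expR (c * s)).
  have dc : is_derive s (1 : R) (fun s => expR (c * s)) (expR (c * s) * c).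
    apply: (@is_derive1_comp _ expR (fun s => c * s)).
    have h := @is_deriveZ _ _ _ (id : R -> R) c s 1 1 (is_derive_id s 1).
    by move: h; rewrite /GRing.scale/= mulr1.
  have h := @is_deriveM _ _ E (fun s => expR (c * s)) s 1 _ _ (dE s) dc.
  by apply: (is_derive_eq h); rewrite /GRing.scale/=; ring.
have hE s := ler_normlP _ _ (eE s).
have [t0|/ltW t0] := leP 0 t.
  have [c _] := MVT_global 0 t (dF (- K)).
  rewrite mulr0 expR0 mulr1 subr0 => Ft.
  have : E t * expR (- K * t) <= E 0.
    rewrite -subr_le0 Ft; apply: mulr_le0_ge0 => //.
    apply: mulr_le0_ge0; last exact: expR_ge0.
    by have [_] := hE c; rewrite mulNr subr_le0.
  by rewrite mulNr expRN ler_pdivrMr ?expR_gt0// ger0_norm// mulrC.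
have [c _] := MVT_global t 0 (dF K).
rewrite mulr0 expR0 mulr1 sub0r => Ft.
have : E t * expR (K * t) <= E 0.
  rewrite -subr_ge0 Ft; apply: mulr_ge0; last by rewrite oppr_ge0.
  apply: mulr_ge0; last exact: expR_ge0.
  by have [+ _] := hE c; lra.
by rewrite -ler_pdivlMr ?expR_gt0// -expRN ler0_norm// mulrN mulrC.
Qed.

Lemma sqr_normr_le_sum n (x : 'rV[R]_n) : `|x| ^+ 2 <= \sum_i x 0 i ^+ 2.
Proof.
have S0 : 0 <= \sum_i x 0 i ^+ 2 by apply: sumr_ge0 => i _; exact: sqr_ge0.
rewrite -[leRHS]sqr_sqrtr// lerXn2r ?nnegrE ?sqrtr_ge0//.
apply: normr_row_le => [|i]; first exact: sqrtr_ge0.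
rewrite -sqrtr_sqr ler_wsqrtr// (bigD1 i)//= lerDl.
by apply: sumr_ge0 => j _; exact: sqr_ge0.
Qed.

Lemma sum_sqr_le_normr n (x : 'rV[R]_n) : \sum_i x 0 i ^+ 2 <= n%:R * `|x| ^+ 2.
Proof.
apply: le_trans (ler_norm _) _; apply: normr_sum_le => i.
by rewrite normrX lerXn2r ?nnegrE// normr_coord_le.
Qed.

Definition trajectory n (b : 'rV[R]_n -> 'rV[R]_n) (phi : R -> 'rV[R]_n) :=
  forall t : R, is_derive t (1 : R) phi (b (phi t)).

Lemma trajectory_shift n (b : 'rV[R]_n -> 'rV[R]_n) phi (s : R) :
  trajectory b phi -> trajectory b (fun t => phi (t + s)).
Proof.
move=> hphi t; have [/derivable1_diffP dphi dphiE] := hphi (t + s).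
have [/derivable1_diffP dsh dshE] := is_derive_shift t (1 : R) s.
have dps : differentiable (phi \o shift s) t by exact: differentiable_comp.
apply: DeriveDef; first exact/derivable1_diffP.
rewrite (deriveE _ dps) diff_comp//= -(deriveE _ dsh) dshE -dphiE.
by rewrite deriveE.
Qed.

Lemma trajectory_translate n (b : 'rV[R]_n -> 'rV[R]_n) phi (k : 'rV[R]_n) :
  (forall x, b (x + k) = b x) ->
  trajectory b phi -> trajectory b (fun t => phi t + k).
Proof.
move=> bk hphi t; rewrite bk.
have := @is_deriveD _ _ _ phi (cst k) t 1 _ _ (hphi t) (is_derive_cst k t 1).
by rewrite addr0.
Qed.

Section lipschitz_field.
Context n (b : 'rV[R]_n -> 'rV[R]_n) (L : R).
Hypothesis L0 : 0 <= L.
Hypothesis lb : forall x y, `|b x - b y| <= L * `|x - y|.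

(** The Gronwall lemma is applied to the squared Euclidean distance, which, unlike
    the sup norm, is differentiable. *)
Lemma trajectory_dist phi chi (t : R) : trajectory b phi -> trajectory b chi ->
  `|phi t - chi t| ^+ 2 <=
  expR (n%:R * (L *+ 2) * `|t|) * (n%:R * `|phi 0 - chi 0| ^+ 2).
Proof.
move=> hphi hchi.
pose d t := phi t - chi t.
pose E t := \sum_i d t 0 i ^+ 2.
have dd t' : is_derive t' (1 : R) d (b (phi t') - b (chi t')).
  exact: is_deriveB.
have dE t' : is_derive t' (1 : R) E
    (\sum_i (b (phi t') - b (chi t')) 0 i * d t' 0 i *+ 2).
  have -> : E = \sum_i (fun t => d t 0 i ^+ 2).
    by apply/funext => s; rewrite /E fct_sumE.
  apply: is_derive_sum => i.
  have h := is_derive_coord i (dd t').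
  have h2 := @is_deriveM _ _ _ _ t' 1 _ _ h h.
  rewrite (_ : (fun t => d t 0 i ^+ 2) = (fun t => d t 0 i) * (fun t => d t 0 i)).
    by apply: (is_derive_eq h2); rewrite /GRing.scale/=; ring.
  by apply/funext => s; rewrite expr2.
apply: le_trans (sqr_normr_le_sum _) _.
have eE t' : `|\sum_i (b (phi t') - b (chi t')) 0 i * d t' 0 i *+ 2| <=
    n%:R * (L *+ 2) * E t'.
  apply: (@le_trans _ _ (n%:R * (L *+ 2 * `|d t'| ^+ 2))); last first.
    rewrite -mulrA ler_wpM2l//.
    by rewrite ler_wpM2l ?mulrn_wge0// sqr_normr_le_sum.
  apply: normr_sum_le => i.
  rewrite normrMn normrM mulrnAl lerMn2r /= expr2 mulrA ler_pM//.
    exact: le_trans (normr_coord_le _ _) (lb _ _).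
  exact: normr_coord_le.
apply: le_trans (gronwall dE eE t) _.
by rewrite ler_wpM2l ?expR_ge0// sum_sqr_le_normr.
Qed.

Lemma trajectory_unique phi chi : trajectory b phi -> trajectory b chi ->
  phi 0 = chi 0 -> phi = chi.
Proof.
move=> hphi hchi h0; apply/funext => t; apply/eqP; rewrite -subr_eq0 -normr_eq0.
rewrite -sqrf_eq0 eq_le sqr_ge0 andbT.
apply: le_trans (trajectory_dist t hphi hchi) _.
by rewrite h0 subrr normr0 expr0n/= !mulr0.
Qed.

Section flow.
Variable X : R -> 'rV[R]_n -> 'rV[R]_n.
Hypothesis hX : is_flow b X.

Lemma flow0 x : X 0 x = x.
Proof. by have [] := hX x. Qed.

Lemma flow_trajectory x : trajectory b (X ^~ x).
Proof. by have [] := hX x. Qed.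

Lemma flowD s t x : X (s + t) x = X s (X t x).
Proof.
have := @trajectory_unique (fun s => X (s + t) x) (X ^~ (X t x)).
move=> /(_ (trajectory_shift t (@flow_trajectory x)) (@flow_trajectory _)).
by rewrite add0r flow0 => /(_ erefl)/(congr1 (@^~ s)).
Qed.

Lemma flow_stationary x t : b x = 0 -> X t x = x.
Proof.
move=> bx; have hx : trajectory b (cst x).
  by move=> s; rewrite /= bx; exact: is_derive_cst.
have := @trajectory_unique (X ^~ x) (cst x) (@flow_trajectory x) hx.
by rewrite flow0 => /(_ erefl)/(congr1 (@^~ t)).
Qed.

Lemma flow_translate t x (k : 'rV[int]_n) : Defs.periodic b ->
  X t (x + map_mx intr k) = X t x + map_mx intr k.
Proof.
move=> pb.
have := @trajectory_unique (X ^~ (x + map_mx intr k))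
  (fun t => X t x + map_mx intr k) (@flow_trajectory _)
  (trajectory_translate (fun x => pb x k) (@flow_trajectory x)).
by rewrite !flow0 => /(_ erefl)/(congr1 (@^~ t)).
Qed.

Lemma flow_lipschitz t :
  exists2 M, 0 <= M & forall x y, `|X t x - X t y| <= M * `|x - y|.
Proof.
pose c := expR (n%:R * (L *+ 2) * `|t|) * n%:R.
have c0 : 0 <= c by rewrite mulr_ge0 ?expR_ge0.
exists (Num.sqrt c) => [|x y]; first exact: sqrtr_ge0.
rewrite -[leLHS]ger0_norm// -sqrtr_sqr -[in leRHS](ger0_norm (normr_ge0 (x - y))).
rewrite -sqrtr_sqr -sqrtrM// ler_wsqrtr//.
have := trajectory_dist t (@flow_trajectory x) (@flow_trajectory y).
by rewrite !flow0 mulrA.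
Qed.

Lemma flow_displacement Mb t x : (forall x, `|b x| <= Mb) ->
  `|X t x - x| <= Mb * `|t|.
Proof.
move=> bM; have Mb0 : 0 <= Mb := le_trans (normr_ge0 _) (bM x).
apply: normr_row_le => [|i]; first by rewrite mulr_ge0.
have [c _] := MVT_global 0 t (fun t => is_derive_coord i (@flow_trajectory x t)).
rewrite flow0 subr0 !mxE => ->; rewrite normrM ler_wpM2r//.
exact: le_trans (normr_coord_le _ _) (bM _).
Qed.

Lemma flow_taylor Mb t x : (forall x, `|b x| <= Mb) ->
  `|X t x - (x + t *: b x)| <= L * Mb * t ^+ 2.
Proof.
move=> bM; have Mb0 : 0 <= Mb := le_trans (normr_ge0 _) (bM x).
apply: normr_row_le => [|i].
  by rewrite mulr_ge0 ?sqr_ge0// mulr_ge0.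
have [c ct] := MVT_global 0 t (fun t => is_derive_coord i (@flow_trajectory x t)).
rewrite flow0 !subr0 in ct *; rewrite !mxE opprD addrA => ->.
rewrite mulrC -mulrBr normrM -real_normK ?num_real// expr2.
rewrite [leRHS]mulrCA ler_wpM2l//.
apply: (@le_trans _ _ `|b (X c x) - b x|).
  by have := normr_coord_le (b (X c x) - b x) i; rewrite !mxE.
apply: le_trans (lb _ _) _; rewrite -mulrA ler_wpM2l//.
apply: le_trans (flow_displacement c x bM) _.
by rewrite ler_wpM2l.
Qed.

End flow.
End lipschitz_field.
End flow.

(** * Invariance of the density 1 / s for the field s g *)

(** The inverse is the pointwise limit of the continuous functions
    r / (r ^+ 2 + e) as e tends to 0, at r = 0 too since 0^-1 = 0. *)
Lemma measurable_invr (R : realType) d (T : measurableType d) (f : T -> R) :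
  measurable_fun [set: T] f -> measurable_fun [set: T] (fun x => (f x)^-1).
Proof.
move=> mf; pose F (k : nat) (r : R) := r * (r ^+ 2 + invS k)^-1.
have s0 k (r : R) : 0 < r ^+ 2 + invS k by rewrite ltr_wpDl ?sqr_ge0// invS_gt0.
have cF k : continuous (F k).
  move=> r; apply: cvgM; first exact: cvg_id.
  apply: cvgV; first by rewrite gt_eqF.
  by apply: cvgD; [exact: exprn_continuous|exact: cvg_cst].
apply: (@measurable_fun_cvg _ T R setT (fun k x => F k (f x))) => [k|x _].
  apply: measurableT_comp mf; exact: continuous_measurable_fun.
rewrite /F; have [->|fx] := eqVneq (f x) 0.
  by under eq_fun do rewrite mul0r; rewrite invr0; exact: cvg_cst.
have -> : (f x)^-1 = f x * (f x ^+ 2 + 0)^-1.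
  by rewrite addr0 expr2 invfM mulrA mulfV// mul1r.
apply: cvgMl_tmp; apply: cvgV; first by rewrite addr0 sqrf_eq0.
by apply: cvgD; [exact: cvg_cst|exact: cvg_invS].
Qed.

Section invariant_density.
Context {R : realType} (n : nat).
Variables (g b : 'rV[R]_n -> 'rV[R]_n) (dg : 'I_n -> 'rV[R]_n -> R).
Variables (s : 'rV[R]_n -> R) (Lg L Mb : R).
Hypotheses (pg : Defs.periodic g) (Lg0 : 0 <= Lg).
Hypothesis lg : forall x y, `|g x - g y| <= Lg * `|x - y|.
Hypothesis dgE :
  forall i x, is_derive x (delta_mx 0 i) (fun x => g x 0 i) (dg i x).
Hypothesis div : forall x, \sum_i dg i x = 0.
Hypothesis bE : forall x, b x = s x *: g x.
Hypotheses (pb : Defs.periodic b) (L0 : 0 <= L).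
Hypothesis lb : forall x y, `|b x - b y| <= L * `|x - y|.
Hypothesis bM : forall x, `|b x| <= Mb.
Hypothesis ms : measurable_fun [set: borel n] ((fun x => (s x)^-1) : borel n -> R).
Hypothesis int_s : (lebesgueY n).-integrable [set: borel n] (EFin \o (fun x => (s x)^-1)).
Hypothesis s_ge0 : forall x, 0 <= s x.
Hypothesis s_neq0 : {ae lebesgueY n, forall x, s x != 0}.
Variable X : R -> 'rV[R]_n -> 'rV[R]_n.
Hypothesis hX : is_flow b X.

Section test_function.
Variables (psi : 'rV[R]_n -> R) (Lp : R).
Hypotheses (pp : Defs.periodic psi) (Lp0 : 0 <= Lp) (lp : lipfun psi Lp).
Hypothesis dp : forall x, differentiable psi x.

Let cp := lipfun_continuous lp.

Let lv t : exists2 M, 0 <= M & lipfun (fun x => psi (X t x)) M.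
Proof.
have [M M0 XM] := flow_lipschitz L0 lb hX t.
exists (Lp * M) => [|x y]; first exact: mulr_ge0.
by apply: le_trans (lp _ _) _; rewrite -mulrA ler_wpM2l.
Qed.

Let w (t : R) (x : 'rV[R]_n) :=
  \sum_i b (X t x) 0 i * 'D_(delta_mx 0 i) psi (X t x).

Let dv (t : R) x : is_derive t (1 : R) (fun t => psi (X t x)) (w t x).
Proof. exact: (is_derive_curve (dp _) (flow_trajectory hX x t)). Qed.

Let wM t x : `|w t x| <= Lp * Mb.
Proof.
have -> : w t x = 'd psi (X t x) (b (X t x)) by rewrite diff_partial.
have hd : derivable psi (X t x) (b (X t x)) by exact: diff_derivable.
rewrite -deriveE//; apply: le_trans (lipfun_derive_le lp (derivableP hd)) _.
by rewrite ler_wpM2l.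
Qed.

Let mv t : measurable_fun [set: borel n] ((fun x => psi (X t x)) : borel n -> R).
Proof.
by have [M M0 lM] := lv t; apply: measurable_cont; exact: lipfun_continuous lM.
Qed.

Let mw t : measurable_fun [set: borel n] (w t : borel n -> R).
Proof.
pose F k (x : 'rV[R]_n) := (invS k)^-1 * (psi (X (t + invS k) x) - psi (X t x)).
apply: (@measurable_fun_cvg _ (borel n) R setT (F : nat -> borel n -> R)) => [k|x _].
  by apply: measurable_funM => //; apply: measurable_funB; exact: mv.
have h : (invS k)^-1 * (psi (X (t + invS k *: (1 : R)) x) - psi (X t x))
    @[k --> \oo] --> w t x.
  apply: derive_seq (dv t x) _ cvg_invS => k.
  by rewrite gt_eqF// invS_gt0.
rewrite (_ : (fun k => F k x) = (fun k =>
  (invS k)^-1 * (psi (X (t + invS k *: (1 : R)) x) - psi (X t x))))//.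
by apply/funext => k; rewrite /F [invS k *: _]mulr1.
Qed.

(** Where s x > 0, the derivative along g is the derivative along b = s *: g
    divided by s x: w t x * (s x)^-1 is the derivative of psi o X t along g. *)
Let w0 t : \int[lebesgueY n]_x (w t x * (s x)^-1) = 0.
Proof.
have [M M0 lM] := lv t.
apply: (divergence_free_flux (v := fun x => psi (X t x)) pg Lg0 lg dgE div _ M0 lM).
- by move=> x k; rewrite (flow_translate L0 lb hX)// pp.
- exact: measurable_funM.
apply: (@filterS _ _ (ae_filter_ringOfSetsType (lebesgueY n)) _ _ _ s_neq0) => x sx0.
have sx : 0 < s x by rewrite lt_neqAle eq_sym sx0 s_ge0.
(* the step along b that amounts to the step invS k along g *)
pose h k : R := invS k * (s x)^-1.
have h0 k : 0 < h k by rewrite mulr_gt0 ?invS_gt0 ?invr_gt0.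
have hc : h k @[k --> \oo] --> 0.
  by rewrite -(mul0r (s x)^-1); apply: cvgMr_tmp; exact: cvg_invS.
have hb k : h k *: b x = invS k *: g x by rewrite bE scalerA -mulrA mulVf ?mulr1.
have c1 : (h k)^-1 * (psi (X (t + h k *: (1 : R)) x) - psi (X t x)) * (s x)^-1
    @[k --> \oo] --> w t x * (s x)^-1.
  apply: cvgMr_tmp; apply: derive_seq (dv t x) _ hc => k.
  by rewrite gt_eqF.
(* error made in replacing the trajectory by its tangent *)
pose r k := (invS k)^-1 * (psi (X t (x + invS k *: g x)) -
  psi (X (t + h k *: (1 : R)) x)).
have rk k : `|r k| <= M * (L * Mb) * (s x)^-1 * h k.
  rewrite /r normrM normfV (gtr0_norm (invS_gt0 k)) ler_pdivrMl ?invS_gt0//.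
  have -> : t + h k *: (1 : R) = t + h k by rewrite [h k *: _]mulr1.
  rewrite (flowD L0 lb hX); apply: le_trans (lM _ _) _.
  rewrite -hb distrC.
  have -> : invS k * (M * (L * Mb) * (s x)^-1 * h k) = M * (L * Mb * h k ^+ 2).
    by rewrite /h; ring.
  by rewrite ler_wpM2l// (flow_taylor L0 lb hX)//.
have c2 : r k @[k --> \oo] --> 0.
  have c3 : M * (L * Mb) * (s x)^-1 * h k @[k --> \oo] --> 0.
    by rewrite -(mulr0 (M * (L * Mb) * (s x)^-1)); apply: cvgMl_tmp.
  apply: norm_cvg0; apply: squeeze_cvgr (@cvg_cst R 0 nat \oo _) c3.
  by apply: nearW => k; rewrite normr_ge0 rk.
pose c k := (h k)^-1 * (psi (X (t + h k *: (1 : R)) x) - psi (X t x)) * (s x)^-1.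
have c3 : r k + c k @[k --> \oo] --> w t x * (s x)^-1.
  by rewrite -[w t x * _]add0r; apply: cvgD.
have cE k : (invS k)^-1 * (psi (X t (x + invS k *: g x)) - psi (X t x)) =
    r k + c k.
  by rewrite /c /r /h /=; field; rewrite sx0 gt_eqF ?invS_gt0.
by under eq_fun do rewrite cE.
Qed.

(** The time derivative of the left-hand side is the flux w0, which vanishes. *)
Lemma invariant_density_smooth t :
  \int[lebesgueY n]_x (psi (X t x) * (s x)^-1) =
  \int[lebesgueY n]_x (psi x * (s x)^-1).
Proof.
pose F t := \int[lebesgueY n]_x (psi (X t x) * (s x)^-1).
have [Mp Mp0 pM] := periodic_bounded cp pp.
have int_F t' : (lebesgueY n).-integrable [set: borel n]
    (EFin \o (fun x => psi (X t' x) * (s x)^-1)).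
  rewrite /comp; under eq_fun do rewrite mulrC EFinM.
  apply: integrableMl => //.
  by exists Mp; split; [exact: num_real|move=> N MN x _ /=; exact: le_trans (ltW MN)].
have df t' x : is_derive t' (1 : R) (fun t => psi (X t x) * (s x)^-1)
    (w t' x * (s x)^-1).
  have h := @is_deriveM _ _ (fun t => psi (X t x)) (cst (s x)^-1) t' 1 _ _
    (dv t' x) (is_derive_cst _ _ _).
  by apply: (is_derive_eq h); rewrite /GRing.scale/=; ring.
have pE t' x : partial1of2 (fun t x => psi (X t x) * (s x)^-1) t' x =
    w t' x * (s x)^-1.
  by rewrite partial1of2E; have [] := df t' x.
have dF t' : is_derive t' (1 : R) F 0.
  pose Gd (x : 'rV[R]_n) := Lp * Mb * (s x)^-1.
  have I1 : `]t' - 1, t' + 1[%classic t'.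
    by rewrite /= in_itv/=; apply/andP; split; lra.
  have iG : (lebesgueY n).-integrable [set: borel n] (EFin \o Gd).
    by rewrite /comp/Gd; under eq_fun do rewrite EFinM; exact: integrableZl.
  have s'0 x : 0 <= (s x)^-1 by rewrite invr_ge0.
  have Mb0 : 0 <= Mb := le_trans (normr_ge0 _) (bM 0).
  pose f t (x : borel n) := psi (X t x) * (s x)^-1.
  have int_d1 : \int[lebesgueY n]_x partial1of2 f t' x = 0.
    by rewrite -[RHS](w0 t'); apply: eq_Rintegral => x _; exact: pE.
  have dfl : h^-1 *: (F (h + t') - F t') @[h --> 0^'] --> 0.
    have d1f r x : `]t' - 1, t' + 1[%classic r -> [set: borel n] x ->
        derivable (f^~ x) r 1 by move=> _ _; have [] := df r x.
    have G0 x : 0 <= Gd x by rewrite /Gd !mulr_ge0.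
    have fG r x : `]t' - 1, t' + 1[%classic r -> [set: borel n] x ->
        `|partial1of2 f r x| <= Gd x.
      by move=> _ _; rewrite /f pE normrM (ger0_norm (s'0 x)) ler_wpM2r.
    have := @cvg_differentiation_under_integral R _ _ (lebesgueY n)
      f setT measurableT t' (t' - 1) (t' + 1) I1 (fun t _ => int_F t) d1f Gd G0 iG fG.
    by rewrite int_d1.
  have dfl1 : h^-1 *: ((F \o shift t') (h *: (1 : R)) - F t') @[h --> 0^'] --> 0.
    by under eq_fun do rewrite /= [_ *: 1]mulr1.
  apply: DeriveDef; first by apply/cvg_ex; exists 0.
  exact: cvg_lim dfl1.
have [c _] := MVT_global 0 t dF.
rewrite mul0r => /eqP; rewrite subr_eq0 => /eqP; rewrite /F => ->.
by apply: eq_Rintegral => x _; rewrite (flow0 hX).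
Qed.

End test_function.

Lemma measurable_flow t : measurable_fun [set: borel n] (X t : borel n -> borel n).
Proof.
have [M M0 XM] := flow_lipschitz L0 lb hX t.
apply: measurable_rV => i; apply: measurable_cont.
exact: (lipfun_continuous (lipfun_coord i XM)).
Qed.

(** A continuous psi is the limit of its mollifications. *)
Lemma invariant_density t (psi : 'rV[R]_n -> R) :
  continuous psi -> Defs.periodic psi ->
  \int[lebesgueY n]_x (psi (X t x) * (s x)^-1) =
  \int[lebesgueY n]_x (psi x * (s x)^-1).
Proof.
move=> cp pp; have [M M0 pM] := periodic_bounded cp pp.
have : forall k, exists K, exists G, exists B, exists C,
    @mollifier R n (invS k) K G B C.
  by move=> k; exact/exists_mollifier/invS_gt0.
move=> /choice[K /choice[G /choice[B /choice[C mK]]]].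
pose p k := conv (K k) psi.
have pk k x : `|p k x| <= M.
  apply: (mollifier_average_le (mK k) (f := fun z => psi (x + z)) (M := M)) => //.
  apply: measurable_cont.
  by under eq_fun do rewrite addrC; exact: continuous_translate.
have pcvg x : p k x @[k --> \oo] --> psi x.
  apply/cvgrPdist_le => e e0.
  have /cvgrPdist_le/(_ _ e0)/nbhs_ballP[r /= r0 hr] := cp x.
  have small : \forall k \near \oo, invS k < r by apply: (cvgr_lt _ (@cvg_invS R)).
  near=> k; rewrite distrC; apply: (conv_close (mK k) cp pp pM) => y yk.
  rewrite distrC; apply: hr => /=; apply/ball_rV; split => // j.
  rewrite mxE opprD addrA subrr sub0r normrN.
  apply: le_lt_trans (normr_coord_le _ _) _; apply: le_lt_trans yk _.
  by near: k; exact: small.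
have tp k := conv_taylor (mK k) cp pp pM.
have cpk k : continuous (p k) := conv_continuous (mK k) cp pp pM.
have s'0 x : 0 <= (s x)^-1 by rewrite invr_ge0.
have hk k : \int[lebesgueY n]_x (p k (X t x) * (s x)^-1) =
    \int[lebesgueY n]_x (p k x * (s x)^-1).
  apply: (invariant_density_smooth _ _ (quad_taylor_lipfun (tp k) (pk k))).
  - by apply: conv_periodic.
  - by rewrite mulr_ge0// addr_ge0// addr_ge0.
  - by move=> x; have [] := quad_taylor_diff (tp k) x.
have ig : (lebesgueY n).-integrable [set: borel n]
    (EFin \o (fun x => M * (s x)^-1)).
  by rewrite /comp; under eq_fun do rewrite EFinM; exact: integrableZl.
have mp k := measurable_cont (cpk k).
have mpsi := measurable_cont cp.
have mX := measurable_flow t.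
have h1 : \int[lebesgueY n]_x (p k (X t x) * (s x)^-1) @[k --> \oo] -->
    \int[lebesgueY n]_x (psi (X t x) * (s x)^-1).
  apply: (Rintegral_cvg _ _ ig).
  - move=> k; apply: measurable_funM => //.
    exact: (measurableT_comp (mp k) mX).
  - by apply: measurable_funM => //; exact: (measurableT_comp mpsi mX).
  - by apply: aeW => x; apply: cvgMr_tmp; exact: pcvg.
  - by apply: aeW => x k; rewrite normrM (ger0_norm (s'0 x)) ler_wpM2r.
have h2 : \int[lebesgueY n]_x (p k x * (s x)^-1) @[k --> \oo] -->
    \int[lebesgueY n]_x (psi x * (s x)^-1).
  apply: (Rintegral_cvg _ _ ig).
  - by move=> k; apply: measurable_funM => //; exact: mp.
  - exact: measurable_funM.
  - by apply: aeW => x; apply: cvgMr_tmp; exact: pcvg.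
  - by apply: aeW => x k; rewrite normrM (ger0_norm (s'0 x)) ler_wpM2r.
have h1' : \int[lebesgueY n]_x (p k x * (s x)^-1) @[k --> \oo] -->
    \int[lebesgueY n]_x (psi (X t x) * (s x)^-1).
  by under eq_fun do rewrite -hk.
exact: (etrans (esym (cvg_lim (@Rhausdorff R) h1')) (cvg_lim (@Rhausdorff R) h2)).
Unshelve. all: by end_near. Qed.

End invariant_density.

(** * Symmetry of second derivatives, product rules *)

Section schwarz.
Context {R : realType} (n : nat).
Implicit Types (f : 'rV[R]_n -> R).

Lemma is_derive_along_line f (z e : 'rV[R]_n) (s : R) :
  (forall x, differentiable f x) ->
  is_derive s (1 : R) (fun s => f (z + s *: e)) ('D_e f (z + s *: e)).
Proof.
move=> df; rewrite deriveE// diff_partial//.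
exact: (@is_derive_curve _ _ f _ s _ (df _) (is_derive_line _ _ _)).
Qed.

(** The mean value theorem is used twice: in the direction e1 for the increment of
    f along e2, then in the direction e2 for the derivative along e1. *)
Lemma second_difference f (x e1 e2 : 'rV[R]_n) (h : R) :
  (forall x, differentiable f x) -> (forall x, differentiable ('D_e1 f) x) ->
  exists2 y, `|y - x| <= `|h| * (`|e1| + `|e2|) &
    f (x + h *: e1 + h *: e2) - f (x + h *: e1) - (f (x + h *: e2) - f x) =
    h ^+ 2 * 'D_e2 ('D_e1 f) y.
Proof.
move=> df df1.
pose phi (s : R) := f (x + h *: e2 + s *: e1) - f (x + s *: e1).
have dphi (s : R) : is_derive s (1 : R) phi
    ('D_e1 f (x + h *: e2 + s *: e1) - 'D_e1 f (x + s *: e1)).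
  exact: (is_deriveB (is_derive_along_line _ _ _ df) (is_derive_along_line _ _ _ df)).
have [c ch phiE] := MVT_global 0 h dphi.
have [c' ch' fE] := MVT_global 0 h
  (fun t => is_derive_along_line (x + c *: e1) e2 t df1).
rewrite !subr0 in ch ch' phiE fE.
exists (x + c *: e1 + c' *: e2).
  have -> : x + c *: e1 + c' *: e2 - x = c *: e1 + c' *: e2.
    by rewrite -(addrA x) (addrC x) addrK.
  apply: le_trans (ler_normD _ _) _; rewrite !normrZ mulrDr.
  by apply: lerD; rewrite ler_wpM2r.
move: phiE; rewrite /phi !scale0r !addr0 [x + h *: e1 + _]addrAC => ->.
move: fE; rewrite scale0r addr0 [x + c *: e1 + h *: e2]addrAC => ->.
by rewrite expr2 -mulrA mulrC.
Qed.

(** The second difference is symmetric in e1 and e2. *)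
Lemma derive_swap f (x e1 e2 : 'rV[R]_n) :
  (forall x, differentiable f x) -> (forall x, differentiable ('D_e1 f) x) ->
  (forall x, differentiable ('D_e2 f) x) ->
  continuous ('D_e2 ('D_e1 f)) -> continuous ('D_e1 ('D_e2 f)) ->
  'D_e2 ('D_e1 f) x = 'D_e1 ('D_e2 f) x.
Proof.
move=> df df1 df2 c12 c21; apply/eqP; rewrite -subr_eq0 -normr_le0.
apply/ler_addgt0Pr => e e0; rewrite add0r.
have e20 : 0 < e / 2 by rewrite divr_gt0.
have /cvgrPdist_le/(_ _ e20)/nbhs_ballP[r1 /= r10 h1] := c12 x.
have /cvgrPdist_le/(_ _ e20)/nbhs_ballP[r2 /= r20 h2] := c21 x.
pose N := `|e1| + `|e2| + 1.
have N0 : 0 < N by rewrite ltr_wpDl// addr_ge0.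
pose h := Num.min r1 r2 / N / 2.
have m0 : 0 < Num.min r1 r2 by rewrite lt_min r10.
have h0 : 0 < h by rewrite !divr_gt0.
have hN y : `|y - x| <= `|h| * (`|e1| + `|e2|) -> `|x - y| < Num.min r1 r2.
  rewrite distrC => /le_lt_trans; apply.
  apply: (@le_lt_trans _ _ (h * N)).
    by rewrite (gtr0_norm h0) ler_wpM2l ?(ltW h0)// /N lerDl.
  by rewrite /h mulrAC divfK ?gt_eqF// ltr_pdivrMr// ltr_pMr// ltr1n.
have ballP (y : 'rV[R]_n) r : `|x - y| < r -> ball x r y.
  move=> xy; apply/ball_rV; split; first exact: le_lt_trans xy.
  by move=> j; apply: le_lt_trans xy; have := normr_coord_le (x - y) j; rewrite !mxE.
have [y1 /hN y1x E1] := second_difference x e2 h df df1.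
have [y2] := second_difference x e1 h df df2.
rewrite [`|e2| + _]addrC => /hN y2x E2.
have E : 'D_e2 ('D_e1 f) y1 = 'D_e1 ('D_e2 f) y2.
  apply: (@mulfI _ (h ^+ 2)); first by rewrite gt_eqF// exprn_gt0.
  apply: (etrans (esym E1)); apply: etrans E2.
  have sub4 (a b c d : R) : a - b - (c - d) = a - c - (b - d) by ring.
  by rewrite (addrAC x (h *: e2)); exact: sub4.
have sub3 (a b c : R) : a - b = (a - c) - (b - c) by ring.
rewrite (sub3 _ _ ('D_e2 ('D_e1 f) y1)) [in X in _ - X]E.
apply: le_trans (ler_normB _ _) _; rewrite [leRHS]splitr; apply: lerD.
  by apply: h1; apply: ballP; apply: lt_le_trans y1x _; rewrite ge_min lexx.
by apply: h2; apply: ballP; apply: lt_le_trans y2x _; rewrite ge_min lexx orbT.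
Qed.

End schwarz.

Lemma is_derive_prod (R : realType) (V : normedModType R) (I : eqType)
    (s : seq I) (f : I -> V -> R) (df : I -> R) (x e : V) : uniq s ->
  (forall i, is_derive x e (f i) (df i)) ->
  is_derive x e (fun x => \prod_(i <- s) f i x)
    (\sum_(i <- s) df i * \prod_(j <- s | j != i) f j x).
Proof.
move=> + dfE; elim: s => [_|i s IH /= /andP[ins us]].
  rewrite big_nil (_ : (fun x => _) = cst 1); last first.
    by apply/funext => y; rewrite big_nil.
  exact: is_derive_cst.
have h := @is_deriveM _ _ _ _ x e _ _ (dfE i) (IH us).
rewrite (_ : (fun x => _) = f i * (fun x => \prod_(i <- s) f i x)); last first.
  by apply/funext => y; rewrite big_cons.
apply: (is_derive_eq h); rewrite /GRing.scale/= big_cons big_cons eqxx/= addrC.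
congr (_ + _); first rewrite mulrC; last rewrite mulr_sumr.
  congr (_ * _); rewrite [in RHS]big_seq_cond [in LHS]big_seq_cond.
  apply: eq_bigl => j; case: (boolP (j \in s)) => //= js.
  have -> // : j != i by apply: contraNneq ins => <-.
rewrite !big_seq; apply: eq_bigr => j js; rewrite big_cons.
have -> : i != j by apply: contraNneq ins => ->.
by rewrite mulrCA.
Qed.

Lemma is_derive_sum_seq (R : realType) (V : normedModType R) (I : Type)
    (s : seq I) (f : I -> V -> R) (df : I -> R) (x e : V) :
  (forall i, is_derive x e (f i) (df i)) ->
  is_derive x e (fun x => \sum_(i <- s) f i x) (\sum_(i <- s) df i).
Proof.
move=> dfE; elim: s => [|i s IH].
  rewrite big_nil (_ : (fun x => _) = cst 0); first exact: is_derive_cst.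
  by apply/funext => y; rewrite big_nil.
rewrite big_cons (_ : (fun x => _) = f i + (fun x => \sum_(i <- s) f i x)).
  exact: is_deriveD.
by apply/funext => y; rewrite big_cons.
Qed.

Lemma is_derive_scale (R : realType) (V : normedModType R) (c : R) (f : V -> R)
    (x e : V) (l : R) :
  is_derive x e f l -> is_derive x e (fun x => c * f x) (c * l).
Proof.
move=> df; have h := @is_deriveZ _ _ _ f c x e l df.
by apply: (is_derive_eq h).
Qed.

(** * Lipschitz periodic functions *)

Section periodic_lipschitz.
Context {R : realType} (n : nat).
Implicit Types (f : 'rV[R]_n -> R).

Definition periodic_lipschitz f :=
  Defs.periodic f /\ exists2 L, 0 <= L & lipfun f L.

Lemma periodic_lipschitz_bounded f : periodic_lipschitz f ->
  exists2 M, 0 <= M & forall x, `|f x| <= M.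
Proof.
by move=> [pf [L L0 lf]]; apply: periodic_bounded => //; exact: lipfun_continuous lf.
Qed.

Lemma periodic_lipschitz_cst c : periodic_lipschitz (cst c).
Proof.
split=> //; exists 0 => // x y.
by rewrite subrr normr0 mul0r.
Qed.

Lemma periodic_lipschitzD f1 f2 : periodic_lipschitz f1 -> periodic_lipschitz f2 ->
  periodic_lipschitz (fun x => f1 x + f2 x).
Proof.
move=> [p1 [L1 L10 l1]] [p2 [L2 L20 l2]]; split.
  by move=> x k; rewrite p1 p2.
exists (L1 + L2) => [|x y]; first exact: addr_ge0.
rewrite opprD addrACA mulrDl; apply: le_trans (ler_normD _ _) _.
exact: lerD.
Qed.

Lemma periodic_lipschitzM f1 f2 : periodic_lipschitz f1 -> periodic_lipschitz f2 ->
  periodic_lipschitz (fun x => f1 x * f2 x).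
Proof.
move=> h1 h2; have [M1 M10 b1] := periodic_lipschitz_bounded h1.
have [M2 M20 b2] := periodic_lipschitz_bounded h2.
move: h1 h2 => [p1 [L1 L10 l1]] [p2 [L2 L20 l2]]; split.
  by move=> x k; rewrite p1 p2.
exists (M1 * L2 + L1 * M2) => [|x y]; first by rewrite addr_ge0 ?mulr_ge0.
have -> : f1 x * f2 x - f1 y * f2 y =
  f1 x * (f2 x - f2 y) + (f1 x - f1 y) * f2 y by ring.
apply: le_trans (ler_normD _ _) _; rewrite !normrM mulrDl.
apply: lerD; first by rewrite -mulrA ler_pM.
by rewrite mulrAC ler_pM.
Qed.

Lemma periodic_lipschitzZ c f : periodic_lipschitz f ->
  periodic_lipschitz (fun x => c * f x).
Proof. exact: (periodic_lipschitzM (periodic_lipschitz_cst c)). Qed.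

Lemma periodic_lipschitz_sum (I : Type) (s : seq I) (f : I -> 'rV[R]_n -> R) :
  (forall i, periodic_lipschitz (f i)) ->
  periodic_lipschitz (fun x => \sum_(i <- s) f i x).
Proof.
move=> hf; elim: s => [|i s IH].
  rewrite (_ : (fun x => _) = cst 0); first exact: periodic_lipschitz_cst.
  by apply/funext => x; rewrite big_nil.
rewrite (_ : (fun x => _) = (fun x => f i x + \sum_(i <- s) f i x)).
  exact: periodic_lipschitzD.
by apply/funext => x; rewrite big_cons.
Qed.

Lemma periodic_lipschitz_prod (I : Type) (s : seq I) (f : I -> 'rV[R]_n -> R) :
  (forall i, periodic_lipschitz (f i)) ->
  periodic_lipschitz (fun x => \prod_(i <- s) f i x).
Proof.
move=> hf; elim: s => [|i s IH].
  rewrite (_ : (fun x => _) = cst 1); first exact: periodic_lipschitz_cst.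
  by apply/funext => x; rewrite big_nil.
rewrite (_ : (fun x => _) = (fun x => f i x * \prod_(i <- s) f i x)).
  exact: periodic_lipschitzM.
by apply/funext => x; rewrite big_cons.
Qed.

Lemma derive_periodic f (e : 'rV[R]_n) : Defs.periodic f -> Defs.periodic ('D_e f).
Proof.
move=> pf x k; rewrite /derive.
rewrite (_ : (fun h => h^-1 *: ((f \o shift (x + map_mx intr k)) (h *: e) -
    f (x + map_mx intr k))) =
  (fun h => h^-1 *: ((f \o shift x) (h *: e) - f x)))//.
by apply/funext => h /=; rewrite addrA pf pf.
Qed.

Lemma C1_periodic_lipschitz f : Ck_periodic 1 f -> periodic_lipschitz f.
Proof.
move=> [[df cdf] pf]; split => //.
have bd i : exists M, forall x, `|'D_(delta_mx 0 i) f x| <= M.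
  have [M _ fM] := periodic_bounded (cdf i) (derive_periodic (delta_mx 0 i) pf).
  by exists M.
have [M fM] := choice bd.
exists (n%:R * \sum_i `|M i|); first by rewrite mulr_ge0// sumr_ge0.
apply: lipfun_partial => // i x; apply: le_trans (fM i x) _.
apply: le_trans (ler_norm _) _; rewrite (bigD1 i)//= lerDl.
exact: sumr_ge0.
Qed.

Lemma periodic_lipschitz_vector (b : 'rV[R]_n -> 'rV[R]_n) :
  (forall i, periodic_lipschitz (fun x => b x 0 i)) ->
  Defs.periodic b /\
  exists2 L, 0 <= L & forall x y, `|b x - b y| <= L * `|x - y|.
Proof.
move=> hb; split.
  by move=> x k; apply/rowP => i; have [pbi _] := hb i; rewrite pbi.
have : forall i, exists L, 0 <= L /\ lipfun (fun x => b x 0 i) L.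
  by move=> i; have [_ [L L0 lL]] := hb i; exists L.
move=> /choice[L hL].
have S0 : 0 <= \sum_i L i by apply: sumr_ge0 => i _; have [] := hL i.
exists (\sum_i L i) => // x y; apply: normr_row_le => [|i]; first by rewrite mulr_ge0.
rewrite !mxE; have [_ lLi] := hL i; apply: le_trans (lLi x y) _.
rewrite ler_wpM2r// (bigD1 i)//= lerDl.
by apply: sumr_ge0 => j _; have [] := hL j.
Qed.

Lemma periodic_lipschitz_vector_bounded (b : 'rV[R]_n -> 'rV[R]_n) :
  (forall i, periodic_lipschitz (fun x => b x 0 i)) ->
  exists M, forall x, `|b x| <= M.
Proof.
move=> hb; have bB i : exists B, forall x, `|b x 0 i| <= B.
  by have [B B0 bB] := periodic_lipschitz_bounded (hb i); exists B.
have [B bB'] := choice bB.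
exists (\sum_i `|B i|) => x; apply: normr_row_le => [|i]; first exact: sumr_ge0.
apply: le_trans (bB' i x) _; apply: le_trans (ler_norm _) _.
by rewrite (bigD1 i)//= lerDl sumr_ge0.
Qed.

End periodic_lipschitz.

(** * Cross products of gradients are solenoidal *)

Section cross_product.
Context {R : realType}.

(** Selecting the permutations with s 0 = i by an indicator, rather than expanding
    into minors, keeps all the sums over one symmetric group; the cancellation
    below is then a reindexing. *)
Lemma cross_leibniz n (w : 'I_n -> 'rV[R]_n.+1) i :
  cross w 0 i = \sum_(s : 'S_n.+1) (-1) ^+ s *
    ((s ord0 == i)%:R * \prod_k w k 0 (s (lift ord0 k))).
Proof.
rewrite mxE /det_cons -det_tr /determinant; apply: eq_bigr => s _.
congr (_ * _); rewrite big_ord_recl !mxE unlift_none ?mxE ?eqxx/= eq_sym.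
by congr (_ * _); apply: eq_bigr => k _; rewrite !mxE liftK.
Qed.

Lemma det_cons_repeated n (w : 'I_n -> 'rV[R]_n.+1) k : det_cons (w k) w = 0.
Proof.
rewrite /det_cons -det_tr; apply: (@determinant_alternate _ _ _ ord0 (lift ord0 k)).
  exact: neq_lift.
by move=> i; rewrite !mxE unlift_none liftK.
Qed.

Lemma perpE m (w : 'I_m.+1 -> 'rV[R]_m.+2) : perp w = cross w.
Proof.
case: m w => [|m] w //; apply: cross_unique => v.
have l0 : lshift 1 (ord0 : 'I_1) = ord0 :> 'I_2 by exact/val_inj.
have r1 : rshift 1 (ord0 : 'I_1) = lift ord0 ord0 :> 'I_2 by exact/val_inj.
have R00 : Rperp (R:=R) ord0 ord0 = 0.
  by have := @block_mxEul R 1 1 1 1 0 1 (-1) 0 ord0 ord0; rewrite !l0 => E; rewrite /Rperp E !mxE.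
have R01 : Rperp (R:=R) ord0 (lift ord0 ord0) = 1.
  by have := @block_mxEur R 1 1 1 1 0 1 (-1) 0 ord0 ord0; rewrite l0 r1 => E; rewrite /Rperp E !mxE.
have R10 : Rperp (R:=R) (lift ord0 ord0) ord0 = -1.
  by have := @block_mxEdl R 1 1 1 1 0 1 (-1) 0 ord0 ord0; rewrite l0 r1 => E; rewrite /Rperp E !mxE.
have R11 : Rperp (R:=R) (lift ord0 ord0) (lift ord0 ord0) = 0.
  by have := @block_mxEdr R 1 1 1 1 0 1 (-1) 0 ord0 ord0; rewrite !r1 => E; rewrite /Rperp E !mxE.
rewrite /det_cons (expand_det_col _ ord0) /perp !big_ord_recl !big_ord0 !addr0.
rewrite !mxE !big_ord_recl !big_ord0 !addr0 unlift_none R00 R01 R10 R11.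
rewrite /cofactor !det_mx11 !mxE !liftK.
have l10 : lift (lift ord0 ord0) 0 = ord0 :> 'I_2 by exact/val_inj.
have l01 : lift ord0 0 = lift ord0 ord0 :> 'I_2 by exact/val_inj.
rewrite l10 l01 (ord1 0) /= /bump/= expr1 expr0; ring.
Qed.

End cross_product.

Lemma sum_indicator (R : pzRingType) (I : finType) (c : R) (j : I) (F : I -> R) :
  \sum_i c * ((j == i)%:R * F i) = c * F j.
Proof.
rewrite (bigD1 j)//= eqxx mul1r big1 ?addr0// => i ij.
by rewrite eq_sym (negPf ij) mul0r mulr0.
Qed.

(** Exchanging the values of s at 0 and at k + 1 flips the sign of s, fixes the
    factors other than the k-th one, and only swaps the two arguments of A. *)
Lemma piola_cancellation (R : realType) n
    (A : 'I_n.+1 -> 'I_n.+1 -> 'I_n -> R) (B : 'I_n.+1 -> 'I_n -> R) :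
  (forall i j k, A i j k = A j i k) ->
  \sum_i \sum_(s : 'S_n.+1) (-1) ^+ s * ((s ord0 == i)%:R *
    \sum_k A i (s (lift ord0 k)) k *
      \prod_(l | l != k) B (s (lift ord0 l)) l) = 0.
Proof.
move=> symA; rewrite exchange_big/=.
transitivity (\sum_(s : 'S_n.+1) \sum_k (-1) ^+ s *
    (A (s ord0) (s (lift ord0 k)) k *
      \prod_(l | l != k) B (s (lift ord0 l)) l)).
  apply: eq_bigr => s _; rewrite -mulr_sumr.
  exact: (sum_indicator _ _ (fun i => \sum_k A i (s (lift ord0 k)) k *
      \prod_(l | l != k) B (s (lift ord0 l)) l)).
rewrite exchange_big/=; apply: big1 => k _; set T := \sum_(s : _) _.
suff : T = - T by move/eqP; rewrite -subr_eq0 opprK -mulr2n mulrn_eq0/= => /eqP.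
rewrite {1}/T (reindex_inj (mulgI (tperm ord0 (lift ord0 k)))) -sumrN/=.
apply: eq_bigr => s _; rewrite odd_permM odd_tperm neq_lift signr_addb expr1.
rewrite mulN1r mulNr; congr (- (_ * (_ * _))).
  by rewrite !permM tpermL tpermR.
by apply: eq_bigr => l lk; rewrite permM tpermD ?neq_lift// (inj_eq lift_inj) eq_sym.
Qed.

Section piola.
Context {R : realType} (n : nat).
Variable u : 'I_n -> 'rV[R]_n.+1 -> R.
Hypothesis du : forall k x, differentiable (u k) x.
Hypothesis du1 : forall k i x, differentiable ('D_(delta_mx 0 i) (u k)) x.
Hypothesis cu2 : forall k i j,
  continuous ('D_(delta_mx 0 j) ('D_(delta_mx 0 i) (u k))).

Let D i k := 'D_(delta_mx 0 i) (u k).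
Let D2 j i k := 'D_(delta_mx 0 j) (D i k).

Definition cross_grad_derive (i : 'I_n.+1) (x : 'rV[R]_n.+1) : R :=
  \sum_(s : 'S_n.+1) (-1) ^+ s * ((s ord0 == i)%:R *
    \sum_k D2 i (s (lift ord0 k)) k x *
      \prod_(l | l != k) D (s (lift ord0 l)) l x).

Lemma is_derive_cross_grad i x :
  is_derive x (delta_mx 0 i) (fun x => cross (fun k => grad (u k) x) 0 i)
    (cross_grad_derive i x).
Proof.
rewrite (_ : (fun x => _) = (fun x => \sum_(s : 'S_n.+1) (-1) ^+ s *
    ((s ord0 == i)%:R * \prod_k D (s (lift ord0 k)) k x))); last first.
  apply/funext => y; rewrite cross_leibniz; apply: eq_bigr => s _.
  by congr (_ * (_ * _)); apply: eq_bigr => k _; rewrite mxE.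
apply: is_derive_sum_seq => s; apply: is_derive_scale; apply: is_derive_scale.
apply: is_derive_prod; first exact: index_enum_uniq.
by move=> k; apply: derivableP; exact/diff_derivable/du1.
Qed.

Lemma cross_grad_divergence_free x : \sum_i cross_grad_derive i x = 0.
Proof.
rewrite /cross_grad_derive.
apply: (@piola_cancellation _ _ (fun i j k => D2 i j k x) (fun i k => D i k x)).
by move=> i j k; apply: derive_swap => //; exact: cu2.
Qed.

End piola.

(** * Functions with periodic gradient *)

Section periodic_gradient.
Context {R : realType} (n : nat).

Lemma differentiable_rowP m (f : 'rV[R]_n -> 'rV[R]_m) (x : 'rV[R]_n) :
  (forall j, differentiable (fun x => f x 0 j) x) -> differentiable f x.
Proof.
move=> df; rewrite (_ : f = \sum_j (fun x => f x 0 j *: delta_mx 0 j)).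
  by apply: differentiable_sum => j; exact: differentiableZl.
apply/funext => y; rewrite fct_sumE; exact: row_sum_delta.
Qed.

Lemma jacobian_coord m (f : 'rV[R]_n -> 'rV[R]_m) (x : 'rV[R]_n) i j :
  (forall j, differentiable (fun x => f x 0 j) x) ->
  'J f x i j = 'D_(delta_mx 0 i) (fun x => f x 0 j) x.
Proof.
move=> df; have dfx := differentiable_rowP df.
rewrite !mxE deriveE//.
rewrite (@diff_comp _ _ _ _ f (fun N : 'rV[R]_m => N 0 j))//=; last first.
  exact: differentiable_coord.
have lc : linear (fun N : 'rV[R]_m => N 0 j : R) by move=> a u v; rewrite !mxE.
pose L := HB.pack_for {linear 'rV[R]_m -> R} (fun N : 'rV[R]_m => N 0 j : R)
  (GRing.isLinear.Build _ _ _ _ _ lc).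
by rewrite (@diff_lin _ _ _ L)//; exact: coord_continuous.
Qed.

(** By periodicity of the gradient, f (y + k) - f y does not depend on y for k in
    the lattice. *)
Lemma linear_plus_periodic (f : 'rV[R]_n -> R) :
  (forall x, differentiable f x) ->
  (forall i, Defs.periodic ('D_(delta_mx 0 i) f)) ->
  Defs.periodic (fun x => f x - \sum_i x 0 i * (f (delta_mx 0 i) - f 0)).
Proof.
move=> df pdf.
have fD (k : 'rV[int]_n) y :
    f (y + map_mx intr k) - f y = f (map_mx intr k) - f 0.
  set e := map_mx intr k.
  have dd (s : R) : is_derive s (1 : R) (fun s => f (e + s *: y) - f (0 + s *: y)) 0.
    have := is_deriveB (is_derive_along_line e y s df) (is_derive_along_line 0 y s df).
    rewrite (_ : 'D_y f (e + _) = 'D_y f (0 + s *: y)) ?subrr//.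
    have dE z : 'D_y f z = \sum_i y 0 i * 'D_(delta_mx 0 i) f z.
      by rewrite deriveE// diff_partial.
    rewrite (dE (e + _)) (dE (0 + _)); apply: eq_bigr => i _; congr (_ * _).
    by rewrite add0r addrC pdf.
  have [c _] := MVT_global 0 1 dd.
  rewrite !scale1r !scale0r !addr0 add0r mul0r addrC => /eqP.
  by rewrite addrC subr_eq0 (addrC e) => /eqP.
apply: periodic_delta => i x.
have eE : delta_mx 0 i = map_mx intr (delta_mx 0 i : 'rV[int]_n) :> 'rV[R]_n.
  by apply/rowP => j; rewrite !mxE; case: eqP => //= _; case: eqP.
have := fD (delta_mx 0 i) x; rewrite -eE => /eqP; rewrite subr_eq => /eqP ->.
have -> : \sum_j (x + delta_mx 0 i) 0 j * (f (delta_mx 0 j) - f 0) =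
    \sum_j x 0 j * (f (delta_mx 0 j) - f 0) + (f (delta_mx 0 i) - f 0).
  under eq_bigr do rewrite mxE mulrDl.
  rewrite big_split/=; congr (_ + _).
  rewrite (bigD1 i)//= big1 ?addr0 => [|j ji]; first by rewrite mxE !eqxx mul1r.
  by rewrite mxE (negPf ji) andbF mul0r.
ring.
Qed.

(** At a maximum, which exists by periodicity. *)
Lemma periodic_critical_point (f : 'rV[R]_n -> R) :
  (forall x, differentiable f x) -> Defs.periodic f ->
  exists c, forall i, 'D_(delta_mx 0 i) f c = 0.
Proof.
move=> df pf; have cf : continuous f.
  by move=> x; exact: differentiable_continuous.
have [c fc] := periodic_max cf pf; exists c => i.
have h : is_derive c (delta_mx 0 i) f ('D_(delta_mx 0 i) f c).
  by apply: derivableP; exact: diff_derivable.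
have u0 k : invS k != 0 :> R by rewrite gt_eqF// invS_gt0.
have v0 k : - invS k != 0 :> R by rewrite oppr_eq0.
have vc : - invS k @[k --> \oo] --> (0 : R).
  by rewrite -oppr0; apply: cvgN; exact: cvg_invS.
apply/eqP; rewrite eq_le; apply/andP; split.
  apply: (cvgr_to_le (derive_seq h u0 cvg_invS)); near=> k.
  by rewrite mulr_ge0_le0 ?invr_ge0 ?(ltW (invS_gt0 k))// subr_le0.
apply: (cvgr_to_ge (derive_seq h v0 vc)); near=> k.
by rewrite mulr_le0 ?invr_le0 ?oppr_le0 ?(ltW (invS_gt0 k))// subr_le0.
Unshelve. all: by end_near. Qed.

End periodic_gradient.

(** * Straightening of the trajectories *)

Section straightening.
Context {R : realType} (n : nat).
Variables (u1 : 'rV[R]_n.+1 -> R) (u : 'I_n -> 'rV[R]_n.+1 -> R).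
Let U x := row_cons (u1 x) (fun k => u k x).
Hypothesis U_C2 : forall j, Ck 2 (fun x => U x 0 j).
Hypothesis JU_C1 : forall i j, Ck_periodic 1 (fun x => 'J U x i j).
Hypothesis detJ_gt0 : forall x, 0 < \det ('J U x).

Let detJ_neq0 x : \det ('J U x) != 0. Proof. by rewrite gt_eqF. Qed.

Let g x := cross (fun k => grad (u k) x).

Let U0 x : U x 0 ord0 = u1 x. Proof. by rewrite mxE unlift_none. Qed.

Let Uk k x : U x 0 (lift ord0 k) = u k x. Proof. by rewrite mxE liftK. Qed.

Let U0f : (fun x => U x 0 ord0) = u1. Proof. exact/funext. Qed.

Let Ukf k : (fun x => U x 0 (lift ord0 k)) = u k. Proof. exact/funext. Qed.

Let dU j x : differentiable (fun x => U x 0 j) x.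
Proof. by have [] := U_C2 j. Qed.

Let du1 x : differentiable u1 x.
Proof. by have := dU ord0 x; rewrite U0f. Qed.

Let du k x : differentiable (u k) x.
Proof. by have := dU (lift ord0 k) x; rewrite Ukf. Qed.

Let JE i j x : 'J U x i j = 'D_(delta_mx 0 i) (fun x => U x 0 j) x.
Proof. by apply: jacobian_coord => l; exact: dU. Qed.

Let J0 i x : 'J U x i ord0 = 'D_(delta_mx 0 i) u1 x.
Proof. by rewrite JE U0f. Qed.

Let Jk i k x : 'J U x i (lift ord0 k) = 'D_(delta_mx 0 i) (u k) x.
Proof. by rewrite JE Ukf. Qed.

Let lJ i j : periodic_lipschitz (fun x => 'J U x i j).
Proof. exact: C1_periodic_lipschitz. Qed.

Let Jkf i k : (fun x => 'J U x i (lift ord0 k)) = 'D_(delta_mx 0 i) (u k).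
Proof. exact/funext. Qed.

Lemma partial_periodic_lipschitz k i :
  periodic_lipschitz ('D_(delta_mx 0 i) (u k)).
Proof. by rewrite -Jkf. Qed.

Lemma cross_grad_periodic_lipschitz i : periodic_lipschitz (fun x => g x 0 i).
Proof.
rewrite (_ : (fun x => _) = (fun x => \sum_(s : 'S_n.+1) (-1) ^+ s *
    ((s ord0 == i)%:R * \prod_k 'D_(delta_mx 0 (s (lift ord0 k))) (u k) x))).
  apply: periodic_lipschitz_sum => s.
  apply: periodic_lipschitzZ; apply: periodic_lipschitzZ.
  by apply: periodic_lipschitz_prod => k; exact: partial_periodic_lipschitz.
apply/funext => x; rewrite /g cross_leibniz; apply: eq_bigr => s _.
by congr (_ * (_ * _)); apply: eq_bigr => k _; rewrite mxE.
Qed.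

Lemma cross_grad_solenoidal : exists dg : 'I_n.+1 -> 'rV[R]_n.+1 -> R,
  (forall i x, is_derive x (delta_mx 0 i) (fun x => g x 0 i) (dg i x)) /\
  (forall x, \sum_i dg i x = 0).
Proof.
have du2 k i x : differentiable ('D_(delta_mx 0 i) (u k)) x.
  by rewrite -Jkf; have [[]] := JU_C1 i (lift ord0 k).
have cu2 k i j : continuous ('D_(delta_mx 0 j) ('D_(delta_mx 0 i) (u k))).
  by rewrite -Jkf; have [[_ h] _] := JU_C1 i (lift ord0 k); exact: h.
exists (cross_grad_derive u); split=> [i x|x].
  exact: is_derive_cross_grad.
exact: cross_grad_divergence_free.
Qed.

(** The scalar product of v with a cross product is the determinant of the family
    completed by v. *)
Lemma cross_grad_dot1 x :
  \sum_i 'D_(delta_mx 0 i) u1 x * g x 0 i = \det ('J U x).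
Proof.
have := crossP (fun k => grad (u k) x) (grad u1 x).
under eq_bigr do rewrite mxE; move=> ->; congr (\det _).
apply/matrixP => i j; rewrite mxE; case: unliftP => [k ->|->].
  by rewrite mxE Jk.
by rewrite mxE J0.
Qed.

Lemma cross_grad_dot k x : \sum_i 'D_(delta_mx 0 i) (u k) x * g x 0 i = 0.
Proof.
have := crossP (fun k => grad (u k) x) (grad (u k) x).
rewrite (det_cons_repeated (fun k => grad (u k) x)).
by under eq_bigr do rewrite mxE.
Qed.

Lemma det_jacobian_periodic_lipschitz : periodic_lipschitz (fun x => \det ('J U x)).
Proof.
rewrite /determinant.
apply: periodic_lipschitz_sum => s.
apply: periodic_lipschitzZ.
by apply: periodic_lipschitz_prod => k; exact: lJ.
Qed.

(** The linear part of U can only be its increments along the lattice basis. *)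
Definition linear_part : 'M[R]_n.+1 := \matrix_(i, j) (U (delta_mx 0 i) 0 j - U 0 0 j).
Let M := linear_part.

Definition periodic_part j x : R := U x 0 j - (x *m M) 0 j.
Let P := periodic_part.

Let PE j : P j = fun x => U x 0 j - \sum_i x 0 i * (U (delta_mx 0 i) 0 j - U 0 0 j).
Proof.
apply/funext => x; rewrite /P /periodic_part; congr (_ - _); rewrite mxE.
by apply: eq_bigr => i _; rewrite mxE.
Qed.

Lemma periodic_part_periodic j : Defs.periodic (P j).
Proof.
rewrite PE; apply: (@linear_plus_periodic _ _ (fun x => U x 0 j)) => // i.
rewrite (_ : 'D__ _ = (fun x => 'J U x i j)).
  by have [_] := JU_C1 i j.
exact/funext.
Qed.

Let dlin j x : differentiable (fun x : 'rV[R]_n.+1 => (x *m M) 0 j) x.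
Proof.
rewrite (_ : (fun x => _) = \sum_i (fun x : 'rV[R]_n.+1 => x 0 i * M i j)).
  apply: differentiable_sum => i.
  by apply: (@differentiableM _ _ (fun x : 'rV[R]_n.+1 => x 0 i) (cst (M i j)));
    [exact: differentiable_coord|exact: differentiable_cst].
by apply/funext => y; rewrite fct_sumE mxE.
Qed.

Let dlinE i j x :
  is_derive x (delta_mx 0 i) (fun x : 'rV[R]_n.+1 => (x *m M) 0 j) (M i j).
Proof.
have hq : quad_taylor (fun x : 'rV[R]_n.+1 => (x *m M) 0 j) (fun i _ => M i j) 0.
  move=> y h; rewrite mulmxDl mul0r (_ : _ - _ = 0) ?normr0//.
  by rewrite mxE [(h *m M) _ _]mxE addrAC addrK subrr.
exact: quad_taylor_is_derive hq.
Qed.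

Lemma is_derive_periodic_part i j x :
  is_derive x (delta_mx 0 i) (P j) ('J U x i j - M i j).
Proof.
rewrite JE; apply: (is_deriveB _ (dlinE i j x)).
by apply: derivableP; exact: diff_derivable.
Qed.

Lemma differentiable_periodic_part j x : differentiable (P j) x.
Proof. exact: (@differentiableB _ _ _ (fun x => U x 0 j) (fun x => (x *m M) 0 j)). Qed.

Lemma periodic_part_lipschitz j : exists2 L, 0 <= L & lipfun (P j) L.
Proof.
have b i : exists N, forall x, `|'J U x i j - M i j| <= N.
  have [N N0 JN] := periodic_lipschitz_bounded (lJ i j).
  exists (N + `|M i j|) => x; apply: le_trans (ler_normB _ _) _.
  by rewrite lerD2r.
have [N hN] := choice b.
have S0 : 0 <= \sum_i `|N i| by exact: sumr_ge0.
exists (n.+1%:R * \sum_i `|N i|); first by rewrite mulr_ge0.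
apply: lipfun_partial => [x|i x].
  exact: differentiable_periodic_part.
have [_ ->] := is_derive_periodic_part i j x.
apply: le_trans (hN i x) _; apply: le_trans (ler_norm _) _.
by rewrite (bigD1 i)//= lerDl sumr_ge0.
Qed.

(** If M killed v, the combination of the coordinates of U with coefficients v
    would be periodic; v would then be in the kernel of J U at a critical point
    of this combination. *)
Lemma linear_part_unit : M \in unitmx.
Proof.
rewrite unitmxE unitfE -det_tr; apply/negP => /det0P[v v0 vM].
pose h x := \sum_j P j x * v 0 j.
have hE x : h x = \sum_j U x 0 j * v 0 j.
  rewrite /h; under eq_bigr do rewrite /P /periodic_part mulrBl.
  rewrite sumrB -[RHS]subr0; congr (_ - _).
  transitivity ((x *m M *m v^T) 0 0).
    by rewrite [RHS]mxE; apply: eq_bigr => j _; rewrite [v^T _ _]mxE.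
  by rewrite -mulmxA -[M *m _]trmxK trmx_mul trmxK vM trmx0 mulmx0 mxE.
have hp : Defs.periodic h.
  by move=> x k; apply: eq_bigr => j _; rewrite periodic_part_periodic.
have hf : h = \sum_j (fun x => U x 0 j * v 0 j).
  by apply/funext => x; rewrite fct_sumE hE.
have dh x : differentiable h x.
  rewrite hf; apply: differentiable_sum => j.
  by apply: (@differentiableM _ _ (fun x => U x 0 j) (cst (v 0 j))) => //;
    exact: differentiable_cst.
have [c hc] := periodic_critical_point dh hp.
have : v *m ('J U c)^T = 0.
  apply/rowP => i; rewrite !mxE -[RHS](hc i).
  have hd : is_derive c (delta_mx 0 i) h (\sum_j v 0 j * 'J U c i j).
    rewrite (_ : h = fun x => \sum_j v 0 j * U x 0 j).
      apply: is_derive_sum_seq => j; apply: is_derive_scale; rewrite JE.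
      by apply: derivableP; exact: diff_derivable.
    by apply/funext => x; rewrite hE; apply: eq_bigr => j _; rewrite mulrC.
  have [_ ->] := hd.
  by apply: eq_bigr => j _; rewrite mxE.
move=> vJ; have /negP := detJ_neq0 c; apply; rewrite -det_tr; apply/det0P.
by exists v.
Qed.

Let lam := lebesgueY (R := R) n.+1.

Let bounded_lam (f : 'rV[R]_n.+1 -> R) : periodic_lipschitz f ->
  lam.-integrable [set: borel n.+1] (EFin \o f).
Proof.
move=> hf; have [B B0 fB] := periodic_lipschitz_bounded hf.
have [_ [L L0 lf]] := hf.
apply: (@bounded_integrable _ _ _ _ _ _ B) => //.
exact: (measurable_cont (lipfun_continuous lf)).
Qed.

Definition mean_det : R := \int[lam]_x \det ('J U x).

Lemma mean_det_gt0 : 0 < mean_det.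
Proof.
have hd := det_jacobian_periodic_lipschitz; have [pd [L L0 ld]] := hd.
have [c hc] := periodic_min (lipfun_continuous ld) pd.
apply: lt_le_trans (detJ_gt0 c) _.
rewrite -[leLHS](Rintegral_prob_cst lam); apply: le_Rintegral => //.
- exact: (@bounded_integrable _ _ _ _ _ _ `|\det ('J U c)|).
- exact: bounded_lam.
Qed.

Definition mean_cross : 'rV[R]_n.+1 := \row_i \int[lam]_x g x 0 i.

(** The columns of J U are the gradient of u1 and those to which g is
    orthogonal. *)
Lemma jac_dot_cross j x :
  \sum_i 'J U x i j * g x 0 i = (j == ord0)%:R * \det ('J U x).
Proof.
case: (unliftP ord0 j) => [k ->|->].
  rewrite eq_sym (negPf (neq_lift _ _)) mul0r -[RHS](cross_grad_dot k x).
  by apply: eq_bigr => i _; rewrite Jk.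
rewrite eqxx mul1r -cross_grad_dot1.
by apply: eq_bigr => i _; rewrite J0.
Qed.

(** The gradient of the periodic part of U, that is J U - M, is orthogonal to the
    solenoidal field g, and the product of g with J U is known pointwise. *)
Lemma mean_cross_linear_part : mean_cross *m M = mean_det *: delta_mx 0 ord0.
Proof.
apply/rowP => j; rewrite mxE.
have [dg [dgE div]] := cross_grad_solenoidal.
have [pg [Lg Lg0 lg]] := periodic_lipschitz_vector cross_grad_periodic_lipschitz.
have lgi i : lipfun (fun x => g x 0 i) Lg by exact: lipfun_coord.
have [LP LP0 lP] := periodic_part_lipschitz j.
have := divergence_free_orthogonal pg lgi dgE div (periodic_part_periodic j) lP
  (fun i x => is_derive_periodic_part i j x).
have iJ i := bounded_lam (periodic_lipschitzM (lJ i j) (cross_grad_periodic_lipschitz i)).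
have iM i := bounded_lam (periodic_lipschitzZ (M i j) (cross_grad_periodic_lipschitz i)).
under eq_Rintegral do under eq_bigr do rewrite mulrBl.
under eq_Rintegral do rewrite sumrB.
rewrite RintegralB//; [|exact: integrable_fun_sum..].
move/eqP; rewrite subr_eq0 => /eqP.
under [in X in X = _ -> _]eq_Rintegral do rewrite jac_dot_cross.
rewrite RintegralZl//; last exact: (bounded_lam det_jacobian_periodic_lipschitz).
rewrite -/mean_det => E.
rewrite [in RHS]mxE [in RHS]mxE eqxx/= [RHS]mulrC E Rintegral_fun_sum//.
apply: eq_bigr => i _; rewrite RintegralZl//.
  by rewrite [mean_cross _ _]mxE mulrC.
exact: (bounded_lam (cross_grad_periodic_lipschitz i)).
Qed.

(** The direction in which the linear part of U increases u1 at unit rate and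
    leaves the other coordinates unchanged. *)
Definition drift : 'rV[R]_n.+1 := mean_det^-1 *: mean_cross.

Lemma drift_linear_part : drift *m M = delta_mx 0 ord0.
Proof.
rewrite /drift -scalemxAl mean_cross_linear_part scalerA mulVf ?scale1r//.
by rewrite gt_eqF// mean_det_gt0.
Qed.

Lemma drift_neq0 : drift != 0.
Proof.
apply/eqP => d0; have := drift_linear_part; rewrite d0 mul0mx => /rowP/(_ ord0)/eqP.
by rewrite !mxE !eqxx eq_sym oner_eq0.
Qed.

Section trajectory.
Variables (c : 'rV[R]_n.+1 -> R) (phi : R -> 'rV[R]_n.+1).
Hypothesis hphi : trajectory (fun x => c x *: g x) phi.

Lemma is_derive_first_coordinate t :
  is_derive t (1 : R) (fun t => u1 (phi t)) (c (phi t) * \det ('J U (phi t))).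
Proof.
apply: (is_derive_eq (is_derive_curve (du1 _) (hphi t))).
rewrite -cross_grad_dot1 mulr_sumr; apply: eq_bigr => i _.
by rewrite mxE -mulrA [g _ _ _ * _]mulrC.
Qed.

Lemma other_coordinate_constant k t : u k (phi t) = u k (phi 0).
Proof.
have du0 s : is_derive s (1 : R) (fun t => u k (phi t)) 0.
  apply: (is_derive_eq (is_derive_curve (du k _) (hphi s))).
  transitivity (c (phi s) * 0); last exact: mulr0.
  rewrite -[in RHS](cross_grad_dot k (phi s)) mulr_sumr; apply: eq_bigr => i _.
  by rewrite mxE -mulrA [g _ _ _ * _]mulrC.
have [d _] := MVT_global 0 t du0.
by rewrite mul0r => /eqP; rewrite subr_eq0 => /eqP.
Qed.

End trajectory.

Let rowB_E (v w : 'rV[R]_n.+1) j : (v - w) 0 j = v 0 j - w 0 j.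
Proof. by rewrite !mxE. Qed.

(** U moves parallel to the first axis along the trajectory; applying the inverse
    of M leaves the contribution of the periodic part, which is bounded. *)
Lemma trajectory_drift : exists C, forall c phi,
  trajectory (fun x => c x *: g x) phi -> forall t,
  `|phi t - phi 0 - (u1 (phi t) - u1 (phi 0)) *: drift| <= C.
Proof.
have bP j : exists B, forall x, `|P j x| <= B.
  have [L L0 lP] := periodic_part_lipschitz j.
  have [B B0 PB] := periodic_bounded (lipfun_continuous lP) (periodic_part_periodic j).
  by exists B.
have [B PB] := choice bP.
exists (\sum_i \sum_j (B j + B j) * `|invmx M j i|) => c phi hphi t.
pose p x : 'rV[R]_n.+1 := \row_j P j x.
have xM x : x *m M = U x - p x.
  have pE : p x = U x - x *m M.
    by apply/rowP => j; rewrite [LHS]mxE rowB_E.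
  by rewrite pE opprB addrC subrK.
have UE : U (phi t) - U (phi 0) = (u1 (phi t) - u1 (phi 0)) *: delta_mx 0 ord0.
  apply/rowP => j; rewrite rowB_E [RHS]mxE [X in _ * X]mxE eqxx/=.
  case: (unliftP ord0 j) => [k ->|->].
    rewrite !Uk (other_coordinate_constant hphi k t) subrr.
    by rewrite eq_sym (negPf (neq_lift _ _)) mulr0.
  by rewrite !U0 eqxx mulr1.
have E : phi t - phi 0 - (u1 (phi t) - u1 (phi 0)) *: drift =
    (p (phi 0) - p (phi t)) *m invmx M.
  apply: (can_inj (mulmxK linear_part_unit)).
  rewrite mulmxKV ?linear_part_unit// !mulmxBl -scalemxAl drift_linear_part.
  rewrite !xM -UE; apply/rowP => j; rewrite !mxE; ring.
have S0 : 0 <= \sum_i \sum_j (B j + B j) * `|invmx M j i|.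
  apply: sumr_ge0 => i _; apply: sumr_ge0 => j _; apply: mulr_ge0 => //.
  by have := le_trans (normr_ge0 _) (PB j 0) => B0; exact: addr_ge0.
rewrite E; apply: normr_row_le => // i; rewrite mxE.
apply: le_trans (ler_norm_sum _ _ _) _; rewrite [leRHS](bigD1 i)//=.
rewrite -[leLHS]addr0; apply: lerD.
  apply: ler_sum => j _; rewrite normrM ler_wpM2r// !mxE.
  by apply: le_trans (ler_normB _ _) _; exact: lerD.
apply: sumr_ge0 => k _; apply: sumr_ge0 => j _; apply: mulr_ge0 => //.
by have := le_trans (normr_ge0 _) (PB j 0) => B0; exact: addr_ge0.
Qed.

End straightening.

(** * Means of vector fields against invariant measures *)

Section invariant_flux.
Context {R : realType} (n : nat).
Variables (b : 'rV[R]_n -> 'rV[R]_n) (X : R -> 'rV[R]_n -> 'rV[R]_n).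
Variables (Lb Mb : R).
Hypothesis Lb0 : 0 <= Lb.
Hypothesis lb : forall x y, `|b x - b y| <= Lb * `|x - y|.
Hypothesis bM : forall x, `|b x| <= Mb.
Hypothesis hX : is_flow b X.
Variable mu : probability (borel (R:=R) n) R.
Hypothesis mu_inv : invariant_measures X mu.

Lemma invariant_integral t (psi : 'rV[R]_n -> R) :
  continuous psi -> Defs.periodic psi ->
  \int[mu]_x psi (X t x) = \int[mu]_x psi x.
Proof.
move=> cpsi ppsi; have [M M0 psiM] := periodic_bounded cpsi ppsi.
have [muY inv] := mu_inv.
have := inv t psi (conj cpsi ppsi).
have mY := @measurable_Y R n.
have m2 := measurable_cont cpsi.
have m1 : measurable_fun [set: borel n] ((fun x => psi (X t x)) : borel n -> R).
  exact: (measurableT_comp m2 (measurable_flow Lb0 lb hX t)).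
rewrite (Rintegral_full mY muY m1); last exact: (@bounded_integrable _ _ _ _ _ _ M).
by rewrite (Rintegral_full mY muY m2)//; exact: (@bounded_integrable _ _ _ _ _ _ M).
Qed.

(** The difference quotients of f along the flow have mean 0 by invariance, and
    are bounded because f is Lipschitz. *)
Lemma invariant_flux (f : 'rV[R]_n -> R) (L : R) :
  Defs.periodic f -> 0 <= L -> lipfun f L -> (forall x, differentiable f x) ->
  \int[mu]_x (\sum_i b x 0 i * 'D_(delta_mx 0 i) f x) = 0.
Proof.
move=> pf L0 lf df.
have cf := lipfun_continuous lf.
have cb i : continuous (fun x => b x 0 i).
  exact: (lipfun_continuous (lipfun_coord i lb)).
have [M M0 fM] := periodic_bounded cf pf.
have cfX t : continuous (fun x => f (X t x)).
  have [K K0 XK] := flow_lipschitz Lb0 lb hX t.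
  apply: (@lipfun_continuous _ _ _ (L * K)) => x y.
  by apply: le_trans (lf _ _) _; rewrite -mulrA ler_wpM2l.
pose q k (x : 'rV[R]_n) := (invS k)^-1 * (f (X (0 + invS k *: (1 : R)) x) - f (X 0 x)).
have q0 k : \int[mu]_x q k x = 0.
  have i1 t : mu.-integrable [set: borel n] (EFin \o (fun x => f (X t x))).
    apply: (@bounded_integrable _ _ _ _ _ _ M) => //.
    exact: (measurable_cont (cfX t)).
  rewrite /q RintegralZl//; last exact: integrableB_fun.
  rewrite RintegralB// invariant_integral// invariant_integral//.
  by rewrite subrr mulr0.
have qc x : q k x @[k --> \oo] --> \sum_i b x 0 i * 'D_(delta_mx 0 i) f x.
  have hd := is_derive_curve (df (X 0 x)) (flow_trajectory hX x 0).
  rewrite (flow0 hX) in hd.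
  apply: (@derive_seq _ R^o (fun t => f (X t x)) 0 1 _ (@invS R) hd _ (@cvg_invS R)) => k.
  by rewrite gt_eqF// invS_gt0.
have qM x k : `|q k x| <= L * Mb.
  rewrite /q normrM normfV (gtr0_norm (invS_gt0 k)) ler_pdivrMl ?invS_gt0//.
  apply: le_trans (lf _ _) _; rewrite mulrCA ler_wpM2l//.
  rewrite (flow0 hX) add0r.
  have := flow_displacement hX (invS k *: (1 : R)) x bM.
  have -> : invS k *: (1 : R) = invS k by exact: mulr1.
  by rewrite (gtr0_norm (invS_gt0 k)) mulrC.
have mq k : measurable_fun [set: borel n] (q k : borel n -> R).
  apply: measurable_funM => //; apply: measurable_funB.
    exact: (measurable_cont (cfX _)).
  exact: (measurable_cont (cfX _)).
have ml : measurable_fun [set: borel n]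
    ((fun x => \sum_i b x 0 i * 'D_(delta_mx 0 i) f x) : borel n -> R).
  apply: measurable_sum => i; apply: measurable_funM.
    exact: (measurable_cont (cb i)).
  apply: (measurable_derive (e := delta_mx 0 i) cf) => x.
  by apply: derivableP; exact: diff_derivable.
have h := @Rintegral_cvg _ _ _ mu q _ (fun=> L * Mb) mq ml _ _ _.
have {h} h : \int[mu]_x q k x @[k --> \oo] -->
   \int[mu]_x \sum_i b x 0 i * 'D_(delta_mx 0 i) f x.
  apply: h.
  - exact: (@bounded_integrable _ _ _ _ _ _ `|L * Mb|).
  - by apply: aeW => x; exact: qc.
  - by apply: aeW => x; exact: qM.
rewrite -(cvg_lim (@Rhausdorff R) h); under eq_fun do rewrite q0.
exact: lim_cst.
Qed.

End invariant_flux.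

Section rotation_vector.
Context {R : realType} (n : nat).
Variables (u1 : 'rV[R]_n.+1 -> R) (u : 'I_n -> 'rV[R]_n.+1 -> R).
Let U x := row_cons (u1 x) (fun k => u k x).
Hypothesis U_C2 : forall j, Ck 2 (fun x => U x 0 j).
Hypothesis JU_C1 : forall i j, Ck_periodic 1 (fun x => 'J U x i j).
Hypothesis detJ_gt0 : forall x, 0 < \det ('J U x).
Let g x := cross (fun k => grad (u k) x).
Variables (c : 'rV[R]_n.+1 -> R) (X : R -> 'rV[R]_n.+1 -> 'rV[R]_n.+1).
Hypothesis hc : periodic_lipschitz c.
Hypothesis hX : is_flow (fun x => c x *: g x) X.
Variable mu : probability (borel (R:=R) n.+1) R.
Hypothesis mu_inv : invariant_measures X mu.

Let int_mu (f : 'rV[R]_n.+1 -> R) : periodic_lipschitz f ->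
  mu.-integrable [set: borel n.+1] (EFin \o f).
Proof.
move=> hf; have [B B0 fB] := periodic_lipschitz_bounded hf.
have [_ [L L0 lf]] := hf.
apply: (@bounded_integrable _ _ _ _ _ _ B) => //.
exact: (measurable_cont (lipfun_continuous lf)).
Qed.

(** Testing the invariance of mu with the periodic part of U determines the
    product of the mean of b with M, and M is invertible. *)
Lemma rotation_vector : integralv mu (fun x => c x *: g x) =
  (\int[mu]_x (c x * \det ('J U x))) *: drift u1 u.
Proof.
have hg := cross_grad_periodic_lipschitz U_C2 JU_C1.
have hcg i : periodic_lipschitz (fun x => (c x *: g x) 0 i).
  rewrite (_ : (fun x => _) = (fun x => c x * g x 0 i)).
    exact: (periodic_lipschitzM hc (hg i)).
  by apply/funext => x; rewrite mxE.
have [pb [L L0 lb]] := periodic_lipschitz_vector hcg.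
have [Mb bM] := periodic_lipschitz_vector_bounded hcg.
have [muY _] := mu_inv.
have iE i : integralv mu (fun x => c x *: g x) 0 i = \int[mu]_x (c x * g x 0 i).
  rewrite [LHS]mxE Rintegral_full//.
  - by apply: eq_Rintegral => x _; rewrite [LHS]mxE.
  - exact: measurable_Y.
  - by have [_ [K _ lK]] := hcg i; exact: (measurable_cont (lipfun_continuous lK)).
  - exact: int_mu.
have lJ i j : periodic_lipschitz (fun x => 'J U x i j).
  exact: C1_periodic_lipschitz.
apply: (can_inj (mulmxK (linear_part_unit U_C2 JU_C1 detJ_gt0))).
rewrite -scalemxAl drift_linear_part//.
apply/rowP => j.
have dP x : differentiable (periodic_part u1 u j) x.
  exact: differentiable_periodic_part.
have [LP LP0 lP] := periodic_part_lipschitz U_C2 JU_C1 j.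
have := invariant_flux L0 lb bM hX mu_inv
  (periodic_part_periodic U_C2 JU_C1 j) LP0 lP dP.
have E x : \sum_i (c x *: g x) 0 i * 'D_(delta_mx 0 i) (periodic_part u1 u j) x =
    (j == ord0)%:R * (c x * \det ('J U x)) -
    \sum_i linear_part u1 u i j * (c x * g x 0 i).
  rewrite mulrCA -(jac_dot_cross U_C2) mulr_sumr -sumrB; apply: eq_bigr => i _.
  have [_ ->] := is_derive_periodic_part U_C2 i j x.
  rewrite [(c x *: g x) 0 i]mxE.
  by move: (c x) (g x 0 i) ('J U x i j) (linear_part u1 u i j) => *; ring.
under eq_Rintegral do rewrite E.
have id : periodic_lipschitz (fun x => c x * \det ('J U x)).
  exact: (periodic_lipschitzM hc (det_jacobian_periodic_lipschitz JU_C1)).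
have icg i : periodic_lipschitz (fun x => c x * g x 0 i).
  exact: (periodic_lipschitzM hc (hg i)).
rewrite RintegralB//; last 2 first.
- by apply: int_mu; exact: periodic_lipschitzZ.
- by apply: integrable_fun_sum => // i; apply: int_mu; exact: periodic_lipschitzZ.
move=> /eqP; rewrite subr_eq0 => /eqP.
rewrite RintegralZl//; last exact: int_mu.
rewrite Rintegral_fun_sum//; last first.
  by move=> i; apply: int_mu; exact: periodic_lipschitzZ.
move=> E1; rewrite [RHS]mxE [X in _ = _ * X]mxE eqxx/= [RHS]mulrC E1 mxE.
apply: eq_bigr => i _; rewrite iE RintegralZl//; last exact: int_mu.
by rewrite mulrC.
Qed.

End rotation_vector.

(** * Harmonic means as limits *)

Section harmonic_mean.
Context {R : realType} (n : nat).
Variables (s : 'rV[R]_n -> R) (d : nat -> 'rV[R]_n -> R).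
Hypothesis ms : measurable_fun [set: borel n] (s : borel n -> R).
Hypothesis md : forall k, measurable_fun [set: borel n] (d k : borel n -> R).
Hypothesis s_ge0 : forall x, 0 <= s x.
Hypothesis d_gt0 : forall k x, 0 < d k x.
Hypothesis s_le : forall k x, s x <= (d k x)^-1.
Hypothesis d_cvg : forall x, (d k x)^-1 @[k --> \oo] --> s x.
Hypothesis int_d : forall k,
  (lebesgueY n).-integrable [set: borel n] (EFin \o d k).

Let lam := lebesgueY (R := R) n.
Let f (x : borel n) : \bar R := (((s x)%:E)^-1)%E.

Let d_le_f k x : ((d k x)%:E <= f x)%E.
Proof.
rewrite /f inver; case: eqP => [_|/eqP sx0]; first exact: leey.
rewrite lee_fin -[leLHS]invrK lef_pV2 ?posrE ?invr_gt0//.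
by rewrite lt_neqAle eq_sym sx0 s_ge0.
Qed.

Let d_cvg_f x : (d k x)%:E @[k --> \oo] --> f x.
Proof.
rewrite /f inver; case: eqP => [sx0|/eqP sx0].
  apply/cvgeryP; apply/gtr0_cvgV0; first exact: nearW.
  by have := @d_cvg x; rewrite sx0.
apply/fine_cvgP; split; first exact: nearW.
by under eq_fun do rewrite /= -[d _ x]invrK; exact: cvgV.
Qed.

Let mf : measurable_fun [set: borel n] f.
Proof.
apply: (@emeasurable_fun_cvg _ _ _ setT (fun k (x : borel n) => (d k x)%:E) f) => [k|x _].
  exact/measurable_EFinP.
exact: d_cvg_f.
Qed.

Let f_ge0 x : (0 <= f x)%E.
Proof. by apply: le_trans (d_le_f 0 x); rewrite lee_fin ltW. Qed.

Let mY : measurable (Y n : set (borel n)) := @measurable_Y R n.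

Let intE k : (\int[lam]_(x in Y n) (d k x)%:E)%E = (\int[lam]_x d k x)%:E.
Proof.
rewrite -(Rintegral_full mY (lebesgueY_Y n) (md k) (int_d k)).
rewrite /Rintegral fineK//.
apply: integrable_fin_num => //.
by apply: integrableS (int_d k).
Qed.

Let I : \bar R := (\int[lam]_(x in Y n) f x)%E.

Let int_le k : ((\int[lam]_x d k x)%:E <= I)%E.
Proof.
rewrite -intE; apply: ge0_le_integral => //.
- by move=> x _; rewrite lee_fin ltW.
- exact/measurable_EFinP/(measurable_funS measurableT).
- exact: (measurable_funS measurableT).
Qed.

Let int_cvg : (\int[lam]_x d k x)%:E @[k --> \oo] --> I.
Proof.
have le_I : (I <= limn_einf (fun k => (\int[lam]_x d k x)%:E))%E.
  have := @fatou _ _ _ lam _ mY (fun k x => (d k x)%:E).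
  rewrite (_ : (fun k => \int[lam]_(x in Y n) (d k x)%:E)%E =
    fun k => (\int[lam]_x d k x)%:E); last by apply/funext => k; exact: intE.
  have hm k : measurable_fun (Y n : set (borel n)) (fun x => (d k x)%:E).
    exact/measurable_EFinP/(measurable_funS measurableT).
  have h0 k (x : borel n) : Y n x -> (0 <= (d k x)%:E)%E.
    by move=> _; rewrite lee_fin ltW.
  move=> /(_ hm h0); apply: le_trans; rewrite /I.
  under [leRHS]eq_integral => x _.
    rewrite is_cvg_limn_einfE; last by apply/cvg_ex; exists (f x); exact: d_cvg_f.
    rewrite (cvg_lim _ (@d_cvg_f x))//; over.
  exact: lexx.
have h : ((-%E \o (fun k => (\int[lam]_x d k x)%:E)) k)%E @[k --> \oo] --> (- I)%E.
  apply: limn_esup_le_cvg.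
    by rewrite limn_esupN leeN2.
  by move=> k; have := int_le k; rewrite -leeN2; exact.
rewrite -[I]oppeK.
rewrite (_ : (fun k => _) = fun k => (- (- (\int[lam]_x d k x)%:E))%E).
  exact: cvgeN.
by apply/funext => k; rewrite oppeK.
Qed.

Hypothesis int_gt0 : forall k, 0 < \int[lam]_x d k x.

Let I_gt0 : (0 < I)%E.
Proof. by apply: lt_le_trans (int_le 0); rewrite lte_fin. Qed.

(** The integrals of d k are at most that of 1 / s as s <= 1 / d k, and Fatou's
    lemma gives the other bound; both make sense when 1 / s is not
    integrable. *)
Lemma hmean_cvg : (\int[lam]_x d k x)^-1 @[k --> \oo] --> hmean s.
Proof.
rewrite /hmean -/I; move: (I) I_gt0 int_cvg => [r r0 hr|_ hy|//].
  rewrite lte_fin in r0.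
  have -> : fine (r%:E^-1)%E = r^-1 by rewrite inver gt_eqF.
  apply: cvgV; first by rewrite gt_eqF.
  by have /fine_cvgP[_] := hr.
rewrite (_ : fine (+oo^-1)%E = 0)//; apply/gtr0_cvgV0.
  exact: nearW.
exact/cvgeryP.
Qed.

Let ig : 0 < hmean s -> lam.-integrable [set: borel n] f.
Proof.
move=> h.
apply/integrableP; split => //.
under eq_integral do rewrite gee0_abs//.
have muDC : lam (~` Y n) = 0 by rewrite probability_setC// lebesgueY_Y subee.
rewrite (ge0_negligible_integral (measurableC mY) measurableT mf _ muDC)//.
rewrite setTD setCK -/I ltey; apply/eqP => Iy.
by move: h; rewrite /hmean -/I Iy ltxx.
Qed.

Lemma hmean_gt0_ae : 0 < hmean s -> {ae lam, forall x, s x != 0}.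
Proof.
move=> h; have [N [mN N0 hN]] := integrable_ae measurableT (ig h).
exists N; split => // x /= hx; apply: hN => /= fx; apply: hx; apply/eqP => sx0.
by have := fx Logic.I; rewrite /f sx0 inver eqxx.
Qed.

Let fE : 0 < hmean s -> {ae lam, forall x, [set: borel n] x -> f x = ((s x)^-1)%:E}.
Proof.
move=> h; have [N [mN N0 hN]] := hmean_gt0_ae h.
exists N; split => // x /= hx; apply: hN => /= sx0; apply: hx => _.
by rewrite /f inver (negPf sx0).
Qed.

Let msV : measurable_fun [set: borel n] (fun x : borel n => (s x)^-1).
Proof. exact: measurable_invr. Qed.

Lemma hmean_gt0_integrable : 0 < hmean s ->
  lam.-integrable [set: borel n] (EFin \o (fun x => (s x)^-1)).
Proof.
move=> h.
apply: (le_integrable measurableT _ _ (ig h)); first exact/measurable_EFinP.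
move=> x _; rewrite [leRHS]gee0_abs// /= ger0_norm ?invr_ge0//.
by rewrite /f inver; case: eqP => // _; exact: leey.
Qed.

Lemma hmean_gt0_integral : 0 < hmean s -> \int[lam]_x (s x)^-1 = (hmean s)^-1.
Proof.
move=> h; rewrite /Rintegral.
have mS : measurable_fun [set: borel n] (fun x : borel n => ((s x)^-1)%:E).
  exact/measurable_EFinP.
rewrite -(@ae_eq_integral _ _ _ lam setT _ _ measurableT mf mS (fE h)).
have muDC : lam (~` Y n) = 0 by rewrite probability_setC// lebesgueY_Y subee.
rewrite (ge0_negligible_integral (measurableC mY) measurableT mf _ muDC)//.
rewrite setTD setCK /hmean -/I.
move: (I) I_gt0 => [r|_|//]; last by rewrite /= invr0.
by rewrite lte_fin => r0; rewrite inver gt_eqF//= invrK.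
Qed.

End harmonic_mean.

(** * Convex combinations and densities of probabilities *)

Section probabilities.
Context {R : realType} d (T : measurableType d).
Implicit Types mu nu : probability T R.

Lemma Rintegral_shift mu (f : T -> R) (M : R) :
  measurable_fun [set: T] f -> (forall x, `|f x| <= M) ->
  \int[mu]_x f x = \int[mu]_x (f x + M) - M.
Proof.
move=> mf fM; rewrite RintegralD//.
- by rewrite Rintegral_prob_cst addrK.
- exact: (@bounded_integrable _ _ _ _ _ _ M).
- exact: (@bounded_integrable _ _ _ _ _ _ `|M|).
Qed.

Section convex.
Variables (mu nu : probability T R) (t : R).
Hypotheses (t0 : 0 <= t) (t1 : 0 <= 1 - t).

Definition convex_measure := measure_add (mscale (NngNum t0) mu) (mscale (NngNum t1) nu).

HB.instance Definition _ := Measure.on convex_measure.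

Let convex_measureE A : convex_measure A = (t%:E * mu A + (1 - t)%:E * nu A)%E.
Proof. exact: measure_addE. Qed.

Let convex_measure_setT : convex_measure setT = 1%E.
Proof.
have E (p : probability T R) : p setT = 1%E by exact: probability_setT.
by rewrite convex_measureE !E !mule1 -EFinD addrC subrK.
Qed.

HB.instance Definition _ :=
  Measure_isProbability.Build _ _ _ convex_measure convex_measure_setT.

Lemma convex_probability : exists P : probability T R,
  (forall A, P A = (t%:E * mu A + (1 - t)%:E * nu A)%E) /\
  (forall (f : T -> R) (M : R), measurable_fun [set: T] f -> (forall x, `|f x| <= M) ->
    \int[P]_x f x = t * \int[mu]_x f x + (1 - t) * \int[nu]_x f x).
Proof.
pose P : probability T R := convex_measure.
have hP (f : T -> R) (M : R) : measurable_fun [set: T] f -> (forall x, 0 <= f x <= M) ->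
    \int[P]_x f x = t * \int[mu]_x f x + (1 - t) * \int[nu]_x f x.
  move=> mf fM.
  have f0 x : [set: T] x -> (0 <= (f x)%:E)%E.
    by move=> _; rewrite lee_fin; have /andP[] := fM x.
  have mf' : measurable_fun [set: T] (fun x => (f x)%:E) by exact/measurable_EFinP.
  have fin (p : probability T R) : (\int[p]_x (f x)%:E)%E \is a fin_num.
    apply: integrable_fin_num => //; apply: (@bounded_integrable _ _ _ _ _ _ M) => // x.
    by have /andP[h0 h1] := fM x; rewrite ger0_norm.
  rewrite /Rintegral ge0_integral_measure_add// !ge0_integral_mscale//.
  by rewrite fineD ?fin_numM// ?fineM//; exact: fin.
exists P; split=> [A|f M mf fM]; first exact: convex_measureE.
rewrite (Rintegral_shift _ mf fM) (Rintegral_shift mu mf fM).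
rewrite (Rintegral_shift nu mf fM) (hP (fun x => f x + M) (M + M)).
- ring.
- exact: measurable_funD.
- move=> x; have := fM x; rewrite ler_norml => /andP[h1 h2].
  by apply/andP; split; lra.
Qed.

End convex.

Section density.
Variables (mu : probability T R) (w : T -> R).
Hypothesis mw : measurable_fun [set: T] w.
Hypothesis w0 : forall x, 0 <= w x.
Hypothesis iw : mu.-integrable [set: T] (EFin \o w).
Hypothesis w1 : \int[mu]_x w x = 1.

Let mw' : measurable_fun [set: T] (EFin \o w). Proof. exact/measurable_EFinP. Qed.

Let w0' x : (0 <= (w x)%:E)%E. Proof. by rewrite lee_fin. Qed.

Definition density_measure (A : set T) := (\int[mu]_(x in A) (w x)%:E)%E.

Let density0 : density_measure set0 = 0%E. Proof. exact: integral_set0. Qed.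

Let density_ge0 A : (0 <= density_measure A)%E. Proof. exact: integral_ge0. Qed.

Let density_additive : semi_sigma_additive density_measure.
Proof. exact: semi_sigma_additive_nng_induced mw' w0'. Qed.

HB.instance Definition _ := isMeasure.Build _ _ _ density_measure
  density0 density_ge0 density_additive.

Let density_setT : density_measure setT = 1%E.
Proof.
rewrite /density_measure -[LHS]fineK; last exact: integrable_fin_num.
by rewrite [X in X%:E]w1.
Qed.

HB.instance Definition _ :=
  Measure_isProbability.Build _ _ _ density_measure density_setT.

Lemma density_probability : exists P : probability T R,
  (forall A, measurable A -> mu A = 1%E -> P A = 1%E) /\
  (forall (f : T -> R) (M : R), measurable_fun [set: T] f -> (forall x, `|f x| <= M) ->
    \int[P]_x f x = \int[mu]_x (f x * w x)).
Proof.
pose P : probability T R := density_measure.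
exists P; split=> [B mB muB|f M mf fM].
  rewrite -[RHS]density_setT /= /density_measure.
  have muC : mu (~` B) = 0 by rewrite probability_setC// muB subee.
  rewrite [RHS](ge0_negligible_integral (measurableC mB) measurableT mw' (fun x _ => w0' x) muC).
  by rewrite setTD setCK.
have dom : P `<< mu.
  apply/null_content_dominatesP => A mA muA0.
  by apply: null_set_integral => //; exact: (measurable_funS measurableT).
have iP : P.-integrable [set: T] (EFin \o f) by exact: (@bounded_integrable _ _ _ _ _ _ M).
rewrite /Rintegral -(Radon_Nikodym_change_of_variables dom)//; congr fine.
apply: ae_eq_integral => //.
- apply: emeasurable_funM; first exact/measurable_EFinP.
  apply: (measurable_int mu).
  by apply: Radon_Nikodym_integrable; exact: dom.
- by apply/measurable_EFinP; exact: measurable_funM.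
- under [X in ae_eq _ _ _ X]eq_fun do rewrite EFinM.
  apply: ae_eqe_mul2l => /=.
  rewrite Radon_NikodymE//=; case: cid => /= h [h1 h2 h3].
  apply: integral_ae_eq => //.
  by move=> E _ mE; rewrite -h3.
Qed.

End density.

End probabilities.

(** * The segment inside the rotation set *)

Section rotation_segment.
Context {R : realType} (n : nat).
Variables (g b : 'rV[R]_n -> 'rV[R]_n) (dg : 'I_n -> 'rV[R]_n -> R).
Variables (s : 'rV[R]_n -> R) (X : R -> 'rV[R]_n -> 'rV[R]_n).
Variables (Lg L Mb : R).
Hypothesis pg : Defs.periodic g.
Hypothesis Lg0 : 0 <= Lg.
Hypothesis lg : forall x y, `|g x - g y| <= Lg * `|x - y|.
Hypothesis dgE : forall i x, is_derive x (delta_mx 0 i) (fun x => g x 0 i) (dg i x).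
Hypothesis div : forall x, \sum_i dg i x = 0.
Hypothesis bE : forall x, b x = s x *: g x.
Hypothesis pb : Defs.periodic b.
Hypothesis L0 : 0 <= L.
Hypothesis lb : forall x y, `|b x - b y| <= L * `|x - y|.
Hypothesis bM : forall x, `|b x| <= Mb.
Let lam := lebesgueY (R := R) n.
Hypothesis ms : measurable_fun [set: borel n] (fun x : borel n => (s x)^-1).
Hypothesis int_s : lam.-integrable [set: borel n] (EFin \o (fun x => (s x)^-1)).
Hypothesis s_ge0 : forall x, 0 <= s x.
Hypothesis s_neq0 : {ae lam, forall x, s x != 0}.
Hypothesis hX : is_flow b X.
Variables (h : R) (z : 'rV[R]_n).
Hypothesis h_gt0 : 0 < h.
Hypothesis hE : \int[lam]_x (s x)^-1 = h^-1.
Hypothesis Yz : Y n z.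
Hypothesis bz : b z = 0.

Let mbi i : measurable_fun [set: borel n] ((fun x => b x 0 i) : borel n -> R).
Proof. exact: (measurable_cont (lipfun_continuous (lipfun_coord i lb))). Qed.

Let mgi i : measurable_fun [set: borel n] ((fun x => g x 0 i) : borel n -> R).
Proof. exact: (measurable_cont (lipfun_continuous (lipfun_coord i lg))). Qed.

Let bMi i x : `|b x 0 i| <= Mb.
Proof. exact: le_trans (normr_coord_le _ _) (bM x). Qed.

Let lamY : lam (Y n) = 1%E := lebesgueY_Y n.

Let mY : measurable (Y n : set (borel n)) := @measurable_Y R n.

Let w x := h * (s x)^-1.

(** Against the probability of density h / s the mean of b is h times that of g,
    since b / s = g almost everywhere; against the Dirac mass at z it is 0. *)
Lemma rotation_set_segment (r : R) : 0 <= r <= 1 ->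
  rotation_set b X (r *: (h *: integralv lam g)).
Proof.
move=> /andP[r0 r1]; have r1' : 0 <= 1 - r by rewrite subr_ge0.
have [|x|||mu [mu1 muE]] := @density_probability _ _ _ lam w.
- exact: measurable_funM.
- by rewrite mulr_ge0 ?invr_ge0// ltW.
- by rewrite /comp /w; under eq_fun do rewrite EFinM; exact: integrableZl.
- by rewrite /w RintegralZl// hE divff// gt_eqF.
have [P [PA PE]] := @convex_probability _ _ _ mu (dirac (z : borel n)) r r0 r1'.
have dE (f : borel n -> R) : measurable_fun [set: borel n] f ->
    \int[dirac (z : borel n)]_x f x = f z.
  move=> mf; rewrite /Rintegral integral_dirac//; last exact/measurable_EFinP.
  by rewrite diracT mul1e.
have PY : P (Y n) = 1%E.
  rewrite PA mu1// [X in (_ + _ * X)%E](_ : _ = 1%E); last first.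
    by rewrite /= /dirac indicE mem_set.
  by rewrite !mule1 -EFinD addrC subrK.
have mX t := measurable_flow L0 lb hX t.
exists P.
  split=> // t psi [cpsi ppsi]; have [M M0 psiM] := periodic_bounded cpsi ppsi.
  have m2 := measurable_cont cpsi.
  have m1 : measurable_fun [set: borel n] ((fun x => psi (X t x)) : borel n -> R).
    exact: (measurableT_comp m2 (mX t)).
  rewrite (Rintegral_full mY PY m1); last exact: (@bounded_integrable _ _ _ _ _ _ M).
  rewrite (Rintegral_full mY PY m2); last exact: (@bounded_integrable _ _ _ _ _ _ M).
  rewrite !(PE _ M)// !dE// (flow_stationary L0 lb hX)//; congr (_ * _ + _).
  rewrite !(muE _ M)//.
  have iV (f : borel n -> R) : measurable_fun [set: borel n] f ->
      (forall x, `|f x| <= M) ->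
      \int[lam]_x (f x * w x) = h * \int[lam]_x (f x * (s x)^-1).
    move=> mf fM; rewrite -RintegralZl//.
      by apply: eq_Rintegral => x _; rewrite /w mulrCA.
    rewrite /comp; under eq_fun do rewrite mulrC EFinM.
    apply: integrableMl => //.
    by exists M; split; [exact: num_real|move=> N MN x _ /=; exact: le_trans (ltW MN)].
  rewrite !iV//; congr (_ * _).
  exact: (invariant_density pg Lg0 lg dgE div bE pb L0 lb bM ms int_s s_ge0 s_neq0 hX).
apply/rowP => i; rewrite [LHS]mxE [RHS]mxE [X in _ * X]mxE [X in _ * (_ * X)]mxE.
have [G gG] : exists G, forall x, `|g x 0 i| <= G.
  have [|x k|G _ gG] := @periodic_bounded _ _ (fun x => g x 0 i).
  - exact: (lipfun_continuous (lipfun_coord i lg)).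
  - by rewrite pg.
  - by exists G.
have ig : lam.-integrable [set: borel n] (EFin \o (fun x => g x 0 i)).
  exact: (@bounded_integrable _ _ _ _ _ _ G).
rewrite (Rintegral_full mY PY (mbi i)); last exact: (@bounded_integrable _ _ _ _ _ _ Mb).
rewrite (PE _ Mb)// dE// bz [X in _ + _ * X]mxE mulr0 addr0; congr (_ * _).
rewrite (muE _ Mb)// (Rintegral_full mY lamY (mgi i))// -RintegralZl//.
rewrite /Rintegral; congr fine; apply: ae_eq_integral => //.
- apply/measurable_EFinP; apply: measurable_funM => //; exact: measurable_funM.
- by apply/measurable_EFinP; exact: measurable_funM.
apply: (@filterS _ _ (ae_filter_ringOfSetsType lam) _ _ _ s_neq0) => x sx0 _.
by rewrite bE mxE /w; congr EFin; field.
Qed.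

End rotation_segment.

(** * Limits of the drifts *)

Lemma uniform_onP (R : realType) (T : choiceType) (V : normedModType R) (A : set T)
    (f_ : nat -> T -> V) (f : T -> V) :
  {uniform A, f_ @ \oo --> f} <->
  forall e : R, 0 < e -> \forall k \near \oo, forall x, A x -> `|f x - f_ k x| < e.
Proof.
split=> [h e e0|h].
  have : nbhs (f : {uniform` A -> V})
      ([set g | forall x, A x -> ball (f x) e (g x)] : set {uniform` A -> V}).
    apply/uniform_nbhs; exists [set xy | ball xy.1 e xy.2]; split => //.
    by rewrite -entourage_ballE; exists e.
  move=> /h h1; near=> k; move=> x Ax.
  have : forall x, A x -> ball (f x) e (f_ k x) by near: k; exact: h1.
  by move=> /(_ x Ax); rewrite -ball_normE.
move=> P /uniform_nbhs[E []]; rewrite -entourage_ballE => -[e /= e0 eE] EP.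
have := h e e0; apply: filterS => k hk; apply: EP => x Ax; apply: eE => /=.
by rewrite -ball_normE; exact: hk.
Unshelve. all: by end_near. Qed.

(** An error that stays bounded in t disappears after division by t. *)
Lemma asymptotic_velocity (R : realType) (V : normedModType R) (phi : R -> V) (z : V) :
  (forall e, 0 < e -> exists C, forall t, 0 < t ->
     exists2 v, `|v - z| <= e & `|phi t - t *: v| <= C) ->
  t^-1 *: phi t @[t --> +oo] --> z.
Proof.
move=> h; apply/cvgrPdist_le => e e0.
have e2 : 0 < e / 2 by rewrite divr_gt0.
have [C hC] := h _ e2.
near=> t.
have t0 : 0 < t by near: t; exact: nbhs_pinfty_gt.
have [v vz vC] := hC t t0.
have tC : C / (e / 2) < t.
  by near: t; apply: nbhs_pinfty_gt; exact: num_real.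
rewrite distrC.
have -> : t^-1 *: phi t - z = t^-1 *: (phi t - t *: v) + (v - z).
  by rewrite scalerBr scalerA mulVf ?gt_eqF// scale1r addrA subrK.
apply: le_trans (ler_normD _ _) _; rewrite [leRHS](splitr e); apply: lerD => //.
rewrite normrZ gtr0_norm ?invr_gt0// ler_pdivrMl//.
apply: le_trans vC _; rewrite ltW//.
by rewrite -ltr_pdivrMr.
Unshelve. all: by end_near. Qed.

Section limit_field.
Context {R : realType} (n : nat).
Variables (u1 : nat -> 'rV[R]_n.+1 -> R) (u : 'I_n -> 'rV[R]_n.+1 -> R).
Let U k x := row_cons (u1 k x) (fun j => u j x).
Hypothesis U_C2 : forall k j, Ck 2 (fun x => U k x 0 j).
Hypothesis JU_C1 : forall k i j, Ck_periodic 1 (fun x => 'J (U k) x i j).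
Let d k x := \det ('J (U k) x).
Hypothesis d_gt0 : forall k x, 0 < d k x.
Variable s : 'rV[R]_n.+1 -> R.
Hypothesis hs : periodic_lipschitz s.
Hypothesis s_ge0 : forall x, 0 <= s x.
Hypothesis s_le : forall k x, s x <= (d k x)^-1.
Hypothesis s_cvg : forall x, (d k x)^-1 @[k --> \oo] --> s x.

Let g x := cross (fun k => grad (u k) x).
Let lam := lebesgueY (R := R) n.+1.

Let hd k : periodic_lipschitz (d k).
Proof. exact: (det_jacobian_periodic_lipschitz (JU_C1 k)). Qed.

Let md k : measurable_fun [set: borel n.+1] (d k : borel n.+1 -> R).
Proof. by have [_ [L _ lL]] := hd k; exact: (measurable_cont (lipfun_continuous lL)). Qed.

Let ms : measurable_fun [set: borel n.+1] (s : borel n.+1 -> R).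
Proof. by have [_ [L _ lL]] := hs; exact: (measurable_cont (lipfun_continuous lL)). Qed.

Let int_d k : lam.-integrable [set: borel n.+1] (EFin \o d k).
Proof.
have [B B0 dB] := periodic_lipschitz_bounded (hd k).
exact: (@bounded_integrable _ _ _ _ _ _ B).
Qed.

Let int_gt0 k : 0 < \int[lam]_x d k x.
Proof. exact: (mean_det_gt0 (JU_C1 k) (d_gt0 k)). Qed.

Definition limit_drift := hmean s *: mean_cross u.

Lemma drift_cvg : drift (u1 k) u @[k --> \oo] --> limit_drift.
Proof.
apply: cvgZr_tmp.
exact: (hmean_cvg md s_ge0 d_gt0 s_le s_cvg int_d int_gt0).
Qed.

Lemma mean_cross_neq0 : mean_cross u != 0.
Proof.
have := drift_neq0 (U_C2 0) (JU_C1 0) (d_gt0 0).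
by apply: contraNN => /eqP; rewrite /drift => ->; rewrite scaler0.
Qed.

Lemma mean_cross_integral : mean_cross u = integralv lam g.
Proof.
have hg := cross_grad_periodic_lipschitz (U_C2 0) (JU_C1 0).
apply/rowP => i; rewrite [LHS]mxE [RHS]mxE.
have [B _ gB] := periodic_lipschitz_bounded (hg i).
have mg : measurable_fun [set: borel n.+1] ((fun x => g x 0 i) : borel n.+1 -> R).
  by have [_ [K _ lK]] := hg i; exact: (measurable_cont (lipfun_continuous lK)).
rewrite (Rintegral_full (@measurable_Y R n.+1) (lebesgueY_Y n.+1) mg)//.
exact: (@bounded_integrable _ _ _ _ _ _ B).
Qed.

Variable X : R -> 'rV[R]_n.+1 -> 'rV[R]_n.+1.
Hypothesis hX : is_flow (fun x => s x *: g x) X.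

(** By the mean value theorem the increment of u1 along the trajectory is t times
    a value of s * d k. *)
Lemma flow_drift k : exists C, forall x t, exists y,
  `|X t x - x - (s y * d k y * t) *: drift (u1 k) u| <= C.
Proof.
have [C hC] := trajectory_drift (U_C2 k) (JU_C1 k) (d_gt0 k).
exists C => x t; have tX := flow_trajectory hX x.
have [c _ E] := MVT_global 0 t (is_derive_first_coordinate (U_C2 k) tX).
exists (X c x); have := hC s _ tX t; rewrite E subr0.
by rewrite (flow0 hX).
Qed.

Let sd_ge0 k y : 0 <= s y * d k y.
Proof. by rewrite mulr_ge0// ltW. Qed.

Let sd_le1 k y : s y * d k y <= 1.
Proof. by rewrite -ler_pdivlMr// div1r. Qed.

(** The factor s * d k in flow_drift only has to be close to 1 when the limit drift
    is nonzero. *)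
Lemma flow_velocity : (forall e, 0 < e -> \forall k \near \oo, forall y,
    (1 - s y * d k y) * `|limit_drift| <= e) ->
  forall x, t^-1 *: X t x @[t --> +oo] --> limit_drift.
Proof.
move=> h x; apply: asymptotic_velocity => e e0.
have e3 : 0 < e / 3 by rewrite divr_gt0.
have /cvgrPdist_le/(_ _ e3) hd' := drift_cvg.
have [N _ hN] : \forall k \near \oo, (forall y, (1 - s y * d k y) * `|limit_drift| <= e / 3) /\
    `|limit_drift - drift (u1 k) u| <= e / 3.
  by near=> k; split; near: k; [exact: h|exact: hd'].
have [hq hdr] := hN N (leqnn _).
have [C hC] := flow_drift N; exists (C + `|x|) => t t0; have [y hy] := hC x t.
have q0 := sd_ge0 N y; have q1 := sd_le1 N y; have hqy := hq y.
move: (s y * d N y) q0 q1 hqy hy => q q0 q1 hqy hy.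
exists (q *: drift (u1 N) u).
  have -> : q *: drift (u1 N) u - limit_drift =
      q *: (drift (u1 N) u - limit_drift) - (1 - q) *: limit_drift.
    by rewrite scalerBl scale1r scalerBr opprB addrA subrK.
  apply: le_trans (ler_normB _ _) _; rewrite [X in X + _]normrZ [X in _ + X]normrZ.
  rewrite (ger0_norm q0) ger0_norm ?subr_ge0//.
  have h1 : q * `|drift (u1 N) u - limit_drift| <= e / 3.
    by rewrite distrC -[leRHS]mul1r ler_pM.
  by apply: le_trans (lerD h1 hqy) _; lra.
rewrite scalerA [t * _]mulrC.
rewrite [X in `|X|](_ : _ = X t x - x - (q * t) *: drift (u1 N) u + x).
  by apply: le_trans (ler_normD _ _) _; rewrite lerD2r.
by rewrite [in RHS]addrAC subrK.
Unshelve. all: by end_near. Qed.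

(** The mean of b is a multiple of drift (u1 k) u with a coefficient in [0, 1], for
    every k. All these drifts are multiples of mean_cross u, so that its
    coefficient r on mean_cross u is at most the inverse of the mean of d k for
    every k, hence at most hmean s. *)
Lemma rotation_set_sub : 0 < hmean s ->
  rotation_set (fun x => s x *: g x) X `<=` segment0 limit_drift.
Proof.
move=> h0 _ [mu mu_inv <-].
pose S k := \int[mu]_x (s x * d k x).
have E k : integralv mu (fun x => s x *: g x) = (S k / mean_det (u1 k) u) *: mean_cross u.
  rewrite -scalerA.
  exact: (rotation_vector (U_C2 k) (JU_C1 k) (d_gt0 k) hs hX mu_inv).
have msd k : measurable_fun [set: borel n.+1] ((fun x => s x * d k x) : borel n.+1 -> R).
  exact: measurable_funM.
have isd k : mu.-integrable [set: borel n.+1] (EFin \o (fun x => s x * d k x)).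
  apply: (@bounded_integrable _ _ _ _ _ _ 1) => // x.
  by rewrite ger0_norm.
have S0 k : 0 <= S k by apply: Rintegral_ge0.
have S1 k : S k <= 1.
  rewrite -[leRHS](Rintegral_prob_cst mu); apply: le_Rintegral => //.
  by apply: (@bounded_integrable _ _ _ _ _ _ 1) => // x; rewrite normr1.
pose r := S 0 / mean_det (u1 0) u.
have rk k : S k / mean_det (u1 k) u = r.
  have : (S k / mean_det (u1 k) u) *: mean_cross u = r *: mean_cross u.
    exact: (etrans (esym (E k)) (E 0)).
  move: (mean_cross u) mean_cross_neq0 (S k / mean_det (u1 k) u) r => v v0 p q pq.
  apply/eqP; rewrite -subr_eq0; apply: contraNT v0 => pq0.
  by have := scalemx_eq0 (p - q) v; rewrite scalerBl pq subrr eqxx (negPf pq0) => /esym.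
have m0 k : 0 < mean_det (u1 k) u := int_gt0 k.
have r0 : 0 <= r by rewrite divr_ge0// ltW.
have rle : r <= hmean s.
  have hc := hmean_cvg md s_ge0 d_gt0 s_le s_cvg int_d int_gt0.
  rewrite -(cvg_lim (@Rhausdorff R) hc).
  apply: limr_ge; first by apply/cvg_ex; eexists; exact: hc.
  apply: nearW => k; rewrite -(rk k) -[leRHS]mul1r; apply: ler_wpM2r => //.
  by rewrite invr_ge0 ltW.
exists (r / hmean s).
  rewrite /= in_itv/=; apply/andP; split; first by apply: divr_ge0 => //; exact: ltW.
  by rewrite ler_pdivrMr// mul1r.
by rewrite /limit_drift scalerA divfK ?gt_eqF// (E 0).
Qed.

Lemma rotation_set_sup z : 0 < hmean s -> Y n.+1 z -> s z = 0 ->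
  segment0 limit_drift `<=` rotation_set (fun x => s x *: g x) X.
Proof.
move=> h0 Yz sz _ [r /= r01 <-].
have [dg [dgE div]] := cross_grad_solenoidal (U_C2 0) (JU_C1 0).
have hg := cross_grad_periodic_lipschitz (U_C2 0) (JU_C1 0).
have [pg [Lg Lg0 lg]] := periodic_lipschitz_vector hg.
have hb i : periodic_lipschitz (fun x => (s x *: g x) 0 i).
  rewrite (_ : (fun x => _) = (fun x => s x * g x 0 i)).
    exact: (periodic_lipschitzM hs (hg i)).
  by apply/funext => x; rewrite mxE.
have [pb [L L0 lb]] := periodic_lipschitz_vector hb.
have [Mb bM] := periodic_lipschitz_vector_bounded hb.
rewrite /limit_drift mean_cross_integral.
apply: (@rotation_set_segment _ _ g (fun x => s x *: g x) dg s X Lg L Mb) => //.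
- exact: measurable_invr.
- exact: (hmean_gt0_integrable ms md s_ge0 d_gt0 s_le s_cvg h0).
- exact: (hmean_gt0_ae md s_ge0 d_gt0 s_le s_cvg h0).
- exact: (hmean_gt0_integral ms md s_ge0 d_gt0 s_le s_cvg int_d int_gt0 h0).
- by rewrite sz scale0r.
Qed.

End limit_field.

(** * Asymptotics of the flow and rotation set *)

Theorem corollary3p5 (R : realType) (m : nat)
    (u1 : nat -> 'rV[R]_m.+2 -> R) (u : 'I_m.+1 -> 'rV[R]_m.+2 -> R)
    (a rho : 'rV[R]_m.+2 -> R) :
  let U (n : nat) (x : 'rV[R]_m.+2) := row_cons (u1 n x) (fun k => u k x) in
  let rho_ (n : nat) (x : 'rV[R]_m.+2) := 1 / (a x * \det ('J (U n) x)) in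
  let gradperp (x : 'rV[R]_m.+2) := perp (fun k => grad (u k) x) in
  let Phi (x : 'rV[R]_m.+2) := a x *: gradperp x in
  let b_ (n : nat) (x : 'rV[R]_m.+2) := rho_ n x *: Phi x in
  let b (x : 'rV[R]_m.+2) := rho x *: Phi x in
  let arho := hmean (fun x => a x * rho x) in
  let zeta := arho *: integralv (lebesgueY m.+2) gradperp in
  (forall n, (0 < n)%N -> forall j, Ck 2 (fun x => U n x 0 j)) ->
  (forall n, (0 < n)%N -> forall i j,
      Ck_periodic 1 (fun x => 'J (U n) x i j)) ->
  Ck_periodic 1 a ->
  (forall x, Y m.+2 x -> 0 < a x) ->
  (forall n, (0 < n)%N -> forall x, Y m.+2 x -> 0 < \det ('J (U n) x)) ->
  Ck_periodic 1 rho ->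
  {uniform Y m.+2, rho_ @ \oo --> rho} ->
  (forall n, (0 < n)%N -> forall x, Y m.+2 x -> rho x <= rho_ n x) ->
  {uniform Y m.+2, b_ @ \oo --> b} /\
  forall X : R -> 'rV[R]_m.+2 -> 'rV[R]_m.+2, is_flow b X ->
    [/\ (forall x, Y m.+2 x -> 0 < rho x) ->
          forall x, Y m.+2 x -> t^-1 *: X t x @[t --> +oo] --> zeta,
        (exists2 x, Y m.+2 x & rho x = 0) -> arho = 0 ->
          forall x, Y m.+2 x ->
            t^-1 *: X t x @[t --> +oo] --> (0 : 'rV[R]_m.+2)
      & (exists2 x, Y m.+2 x & rho x = 0) -> 0 < arho ->
          rotation_set b X = segment0 zeta /\ zeta <> 0].
Proof.
move=> U rho_ gradperp Phi b_ b arho zeta U_C2 JU_C1 C1a a_gt0 det_gt0 C1rho rho_cvg rho_le.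
(* the hypotheses concern positive indices: the sequence is shifted by one *)
pose d k x := \det ('J (U k.+1) x).
pose s x := a x * rho x.
have a_lip := C1_periodic_lipschitz C1a; have rho_lip := C1_periodic_lipschitz C1rho.
have [[pa _] [prho _]] := (a_lip, rho_lip).
have s_lip : periodic_lipschitz s by exact: periodic_lipschitzM a_lip rho_lip.
have d_lip k : periodic_lipschitz (d k).
  exact: (det_jacobian_periodic_lipschitz (JU_C1 k.+1 isT)).
have a_pos x : 0 < a x by exact: (periodic_forall (P := fun r => 0 < r) pa a_gt0).
have d_pos k x : 0 < d k x.
  by have [pd _] := d_lip k; exact: (periodic_forall (P := fun r => 0 < r) pd (det_gt0 k.+1 isT)).
have rhoE k x : rho_ k.+1 x = (d k x)^-1 / a x by rewrite /rho_ div1r invfM mulrC.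
have rho_per k : Defs.periodic (rho_ k.+1).
  by move=> x z; rewrite !rhoE pa; have [pd _] := d_lip k; rewrite pd.
have rho_le' k x : rho x <= rho_ k.+1 x.
  have [y [z [Yy ->]]] := decomp_Y x.
  by rewrite prho rho_per; exact: rho_le.
have rho_unif e : 0 < e -> \forall k \near \oo, forall x, `|rho x - rho_ k.+1 x| < e.
  move=> e0; have [N _ hN] := (uniform_onP _ _ _).1 rho_cvg e e0.
  exists N => // k /= Nk x; have [y [z [Yy ->]]] := decomp_Y x.
  by rewrite prho rho_per; apply: hN => //=; exact: leqW.
have aMrho k x : a x * rho_ k.+1 x = (d k x)^-1.
  by rewrite rhoE mulrC divfK// gt_eqF.
have s_le k x : s x <= (d k x)^-1 by rewrite -aMrho ler_pM2l.
have rho_ge0 x : 0 <= rho x.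
  rewrite leNgt; apply/negP => r0; have r0' : 0 < - rho x by rewrite oppr_gt0.
  have [N _ /(_ N (leqnn N))/(_ x)] := rho_unif _ r0'.
  rewrite ltNge distrC => /negP; apply; apply: le_trans (ler_norm _).
  by rewrite lerDr rhoE divr_ge0// ?invr_ge0 ltW.
have s_ge0 x : 0 <= s x by rewrite mulr_ge0// ltW.
have s_cvg x : (d k x)^-1 @[k --> \oo] --> s x.
  under eq_fun do rewrite -aMrho; apply: cvgMl_tmp.
  apply/cvgrPdist_lt => e e0; have := rho_unif e e0.
  by apply: filterS => k; exact.
pose g x := cross (fun k => grad (u k) x).
have gE : gradperp = g by apply/funext => x; exact: perpE.
have bE : b = fun x => s x *: g x.
  by apply/funext => x; rewrite /b /Phi gE scalerA mulrC.
pose v1 k := u1 k.+1.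
have U_C2' k j : Ck 2 (fun x => row_cons (v1 k x) (fun i => u i x) 0 j).
  exact: U_C2.
have JU_C1' k i j :
    Ck_periodic 1 (fun x => 'J (fun x => row_cons (v1 k x) (fun i => u i x)) x i j).
  exact: JU_C1.
have hg := cross_grad_periodic_lipschitz (U_C2' 0%N) (JU_C1' 0%N).
have zetaE : zeta = limit_drift u s.
  rewrite /zeta gE /limit_drift; congr (_ *: _).
  exact/esym/(mean_cross_integral U_C2' JU_C1').
split.
  apply/uniform_onP => e e0.
  have hPhi i : periodic_lipschitz (fun x => Phi x 0 i).
    rewrite /Phi gE (_ : (fun x => _) = (fun x => a x * g x 0 i)).
      exact: (periodic_lipschitzM a_lip (hg i)).
    by apply/funext => x; rewrite mxE.
  have [M PhiM] := periodic_lipschitz_vector_bounded hPhi.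
  have M1 : 0 < `|M| + 1 by rewrite ltr_wpDl.
  have := (uniform_onP _ _ _).1 rho_cvg (e / (`|M| + 1)) (divr_gt0 e0 M1).
  apply: filterS => k hk x Yx; rewrite /b /b_ -scalerBl normrZ.
  apply: (@le_lt_trans _ _ (`|rho x - rho_ k x| * (`|M| + 1))).
    apply: ler_wpM2l => //; apply: le_trans (PhiM x) _.
    by apply: le_trans (ler_norm _) _; rewrite lerDl.
  by rewrite -ltr_pdivlMr//; exact: hk.
rewrite bE zetaE => X hX; split.
- move=> rho_pos x _; apply: (flow_velocity U_C2' JU_C1' d_pos s_ge0 s_le s_cvg hX).
  move=> e e0.
  have [|c hc] := @periodic_min _ _ rho _ prho.
    by have [_ [L _ lL]] := rho_lip; exact: lipfun_continuous lL.
  have c0 : 0 < rho c by exact: (periodic_forall (P := fun r => 0 < r) prho rho_pos).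
  (* rho c is the minimum of rho, so 1 - rho / rho_ k <= `|rho - rho_ k| / rho c *)
  pose K := `|limit_drift u s| + 1.
  have K0 : 0 < K by rewrite ltr_wpDl.
  have := rho_unif (rho c * e / K) (divr_gt0 (mulr_gt0 c0 e0) K0).
  apply: filterS => k hk y.
  have rk0 : 0 < rho_ k.+1 y by apply: lt_le_trans c0 _; apply: le_trans (hc y) _.
  have -> : s y * d k y = rho y / rho_ k.+1 y.
    rewrite /s rhoE; move: (d k y) (a y) (rho y) (d_pos k y) (a_pos y) => D A r D0 A0.
    by field; rewrite !gt_eqF.
  have -> : 1 - rho y / rho_ k.+1 y = (rho_ k.+1 y - rho y) / rho_ k.+1 y.
    by rewrite mulrBl divff// gt_eqF.
  apply: (@le_trans _ _ ((rho c * e / K) / rho c * K)); last first.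
    by rewrite le_eqVlt; apply/orP; left; apply/eqP; field; rewrite !gt_eqF.
  apply: ler_pM => //.
  + by rewrite divr_ge0// ?subr_ge0// ltW.
  + apply: ler_pM.
    * by rewrite subr_ge0.
    * by rewrite invr_ge0 ltW.
    * by apply: le_trans (ler_norm _) _; rewrite distrC ltW.
    * by rewrite lef_pV2 ?posrE//; apply: le_trans (hc y) _.
  + by rewrite /K lerDl.
- move=> _ arho0 x _.
  have z0 : limit_drift u s = 0 by rewrite -zetaE /zeta arho0 scale0r.
  rewrite -z0; apply: (flow_velocity U_C2' JU_C1' d_pos s_ge0 s_le s_cvg hX).
  by move=> e e0; apply: nearW => k y; rewrite z0 normr0 mulr0 ltW.
- move=> [z Yz rz] arho0; split; last first.
    apply/eqP; rewrite scalemx_eq0 negb_or gt_eqF//=.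
    exact: (mean_cross_neq0 U_C2' JU_C1' d_pos).
  apply/seteqP; split.
    exact: (rotation_set_sub U_C2' JU_C1' d_pos s_lip s_ge0 s_le s_cvg hX).
  apply: (rotation_set_sup U_C2' JU_C1' d_pos s_lip s_ge0 s_le s_cvg hX arho0 Yz).
  by rewrite /s rz mulr0.
Qed.
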